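(* Let $\mathbf{X}=(X,\mathcal{A},\mu,T)$ be a dynamical system and $\mathcal{F}=(\mathcal{F}_n)_{n\le0}$ a weak Pinsker filtration on $\mathbf{X}$. Then (i) $\mathbf{X}$ is a K-system if and only if $\mathcal{F}$ is Kolmogorovian, i.e. $\bigcap_{n\le0}\mathcal{F}_n=\{\varnothing,X\}$ mod $\mu$; (ii) if $\mathcal{F}$ is of product type, then $\mathbf{X}$ is Bernoulli.
   Context: A dynamical system consists of a Lebesgue probability space $(X,\mathcal{A},\mu)$ and an invertible measure-preserving $T$. Factor $\sigma$-algebras are sub-$\sigma$-algebras $\mathcal{B}$ with $T^{-1}\mathcal{B}=\mathcal{B}$ mod $\mu$. Entropy: for finite-valued $\xi_0$, $h_\mu(\xi,T)=\lim_n\frac1nH_\mu((\xi_0\circ T^k)_{0\le k\le n})$; $h_\mu(\mathcal{B},T)$ is the supremum over $\mathcal{B}$-measurable $\xi_0$. The Pinsker factor is $\Pi_{\mathbf{X}}=\{A\in\mathcal{A}:h_\mu(\mathbbm{1}_A,T)=0\}$; $\mathbf{X}$ is a K-system if $\Pi_{\mathbf{X}}$ is trivial. A factor $\sigma$-algebra $\mathcal{C}$ (or $\mathbf{X}$, if $\mathcal{C}=\mathcal{A}$) is Bernoulli if $\mathcal{C}=\sigma(\xi)$ mod $\mu$ for some i.i.d. process $\xi=(\xi_0\circ T^n)_n$. If $\mathcal{B}\subset\mathcal{C}$ are factor $\sigma$-algebras, $\mathcal{C}$ is relatively Bernoulli over $\mathcal{B}$ if there is an i.i.d. process $\xi$ with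 $\sigma(\xi)\subset\mathcal{C}$ independent of $\mathcal{B}$ and $\mathcal{C}=\mathcal{B}\vee\sigma(\xi)$ mod $\mu$. A weak Pinsker filtration is a sequence $(\mathcal{F}_n)_{n\le0}$ of factor $\sigma$-algebras with $\mathcal{F}_n\subset\mathcal{F}_{n+1}$, $\mathcal{F}_0=\mathcal{A}$, $\mathcal{F}_{n+1}$ relatively Bernoulli over $\mathcal{F}_n$ for $n\le-1$, and $h_\mu(\mathcal{F}_n,T)\to0$ as $n\to-\infty$. It is of product type if there are mutually independent factor $\sigma$-algebras $(\mathcal{C}_n)_{n\le0}$ with $\mathcal{F}_n=\bigvee_{k\le n}\mathcal{C}_k$ mod $\mu$ for all $n\le0$. *)

(* Defs.v *)
From HB Require Import structures.
From mathcomp Require Import all_boot all_order all_algebra.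
From mathcomp Require Import all_classical all_reals all_analysis.
Set Implicit Arguments. Unset Strict Implicit. Unset Printing Implicit Defensive.
Import Order.TTheory GRing.Theory Num.Theory.
Import numFieldNormedType.Exports.
Local Open Scope classical_set_scope.
Local Open Scope ring_scope.

Section DynSys.
Context (R : realType) (d : measure_display) (X : measurableType d)
        (P : probability X R).

Definition subset_mod (B C : set (set X)) : Prop :=
  forall A, B A -> exists A', C A' /\ P ((A `\` A') `|` (A' `\` A)) = 0%E.

Definition eq_mod (B C : set (set X)) : Prop := subset_mod B C /\ subset_mod C B.

Definition sub_sigma (B : set (set X)) : Prop :=
  B `<=` measurable /\ sigma_algebra setT B.

(** Lebesgue probability space, read as: the sigma-algebra is generated,
    mod P, by a single real measurable function. *)
Definition lebesgue_space : Prop :=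
  exists f : X -> R, measurable_fun setT f /\
    eq_mod measurable <<s [set f @^-1` B | B in (measurable : set (set R))] >>.

Definition invertible_mp (T Tinv : X -> X) : Prop :=
  [/\ measurable_fun setT T, measurable_fun setT Tinv,
      cancel T Tinv, cancel Tinv T &
      forall A, measurable A -> P (T @^-1` A) = P A].

Definition iterz (T Tinv : X -> X) (n : int) : X -> X :=
  match n with
  | Posz k => iter k T
  | Negz k => iter k.+1 Tinv
  end.

Definition factor (T : X -> X) (B : set (set X)) : Prop :=
  sub_sigma B /\ eq_mod [set T @^-1` A | A in B] B.

Definition mindep (I : eqType) (G : I -> set (set X)) : Prop :=
  forall (s : seq I) (A : I -> set X), uniq s ->
    (forall i, i \in s -> G i (A i)) ->
    P (\big[setI/setT]_(i <- s) A i) = (\prod_(i <- s) P (A i))%E.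

Definition indep2 (B C : set (set X)) : Prop :=
  forall A A', B A -> C A' -> P (A `&` A') = (P A * P A')%E.

Definition sigma_rv (f : X -> R) : set (set X) :=
  <<s [set f @^-1` B | B in (measurable : set (set R))] >>.

Definition proc (T Tinv : X -> X) (xi0 : X -> R) (n : int) : X -> R :=
  xi0 \o iterz T Tinv n.

Definition sigma_proc (T Tinv : X -> X) (xi0 : X -> R) : set (set X) :=
  <<s \bigcup_(n in [set: int]) sigma_rv (proc T Tinv xi0 n) >>.

(** xi is an i.i.d. process (identical distribution of the coordinates is
    automatic from T being measure preserving, but we state it anyway) *)
Definition iid_proc (T Tinv : X -> X) (xi0 : X -> R) : Prop :=
  [/\ measurable_fun setT xi0,
      mindep (fun n : int => sigma_rv (proc T Tinv xi0 n)) &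
      forall n (B : set R), measurable B ->
        P (proc T Tinv xi0 n @^-1` B) = P (xi0 @^-1` B)].

Definition bernoulli_factor (T Tinv : X -> X) (C : set (set X)) : Prop :=
  exists xi0 : X -> R, iid_proc T Tinv xi0 /\ eq_mod C (sigma_proc T Tinv xi0).

Definition bernoulli_sys (T Tinv : X -> X) : Prop :=
  bernoulli_factor T Tinv measurable.

Definition rel_bernoulli (T Tinv : X -> X) (B C : set (set X)) : Prop :=
  exists xi0 : X -> R, [/\ iid_proc T Tinv xi0,
    subset_mod (sigma_proc T Tinv xi0) C,
    indep2 (sigma_proc T Tinv xi0) B &
    eq_mod C <<s B `|` sigma_proc T Tinv xi0 >>].

Definition cyl_prob (F : finType) (T : X -> X) (xi0 : X -> F) (n : nat)
    (w : {ffun 'I_n.+1 -> F}) : R :=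
  fine (P [set x | forall j : 'I_n.+1, xi0 (iter j T x) = w j]).

Definition Hn (F : finType) (T : X -> X) (xi0 : X -> F) (n : nat) : R :=
  - \sum_(w : {ffun 'I_n.+1 -> F}) cyl_prob T xi0 w * ln (cyl_prob T xi0 w).

Definition entropy_proc (F : finType) (T : X -> X) (xi0 : X -> F) : R :=
  limn (fun n : nat => Hn T xi0 n / n%:R).

Definition entropy_factor (T : X -> X) (B : set (set X)) : \bar R :=
  ereal_sup [set r | exists (F : finType) (xi0 : X -> F),
     (forall v : F, B (xi0 @^-1` [set v])) /\ r = (entropy_proc T xi0)%:E].

Definition pinsker (T : X -> X) : set (set X) :=
  [set A | measurable A /\
     entropy_proc T (fun x => (x \in A) : bool) = 0].

Definition K_system (T : X -> X) : Prop :=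
  forall A, pinsker T A -> P A = 0%E \/ P A = 1%E.

(** Weak Pinsker filtration, reindexed: F m stands for F_{-m}, m : nat. *)
Definition weak_pinsker (T Tinv : X -> X) (F : nat -> set (set X)) : Prop :=
  [/\ forall m, factor T (F m),
      forall m, subset_mod (F m.+1) (F m),
      eq_mod (F 0%N) measurable,
      forall m, rel_bernoulli T Tinv (F m.+1) (F m) &
      (fun m => entropy_factor T (F m)) @ \oo --> 0%E].

(** Kolmogorovian: the intersection (in the measure algebra, i.e. of the
    P-completions) of the F m is trivial mod P. *)
Definition kolmogorovian (F : nat -> set (set X)) : Prop :=
  forall A, measurable A -> (forall m, subset_mod [set A] (F m)) ->
    P A = 0%E \/ P A = 1%E.

Definition product_type (T : X -> X) (F : nat -> set (set X)) : Prop :=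
  exists C : nat -> set (set X),
    [/\ forall j, factor T (C j), mindep C &
        forall m, eq_mod (F m) <<s \bigcup_(j in [set j | (m <= j)%N]) C j >>].

End DynSys.

(* Main.v *)
(* (i) Let [alpha] be a zero entropy process measurable for [F m], let [xi] be the
   i.i.d. process that completes [F (m+1)] to [F m], and let [beta] be measurable
   for [F (m+1)].  The mutual information of [N] steps of [xi] and of
   [(alpha, beta)] is superadditive in [N] and at most
   [H (alpha_1, ..., alpha_N) = o(N)], hence zero.  So [(alpha, beta)] is
   independent of [xi], and [alpha] is measurable for [F (m+1)]: the zero entropy
   sets lie in every [F m].  Conversely the entropy of [F m] tends to zero.

   (ii) Encode the i.i.d. processes of all levels by one sequence of bits.  For
   each [M] the bits of level [< M] are i.i.d. and independent of [F M], and
   generate everything together with [F M].  The product structure provides a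
   factor [D M] independent of [F M], and a function measurable for it can be
   predicted from the bits and from the word [k] read off [F M].  To remove the
   dependence on [k], cut time into long blocks by means of markers of [F M] and
   permute the letters inside every block, by a permutation depending on [k] and
   on the letters themselves: Marton's transport inequality (applied through the
   common target in [D M]) and Birkhoff's theorem give, for each [k], a
   type-preserving bijection of words after which the predictor of [k] nearly
   agrees with that of one fixed [k0].  Type-preserving bijections keep the
   bits i.i.d. and independent of [F M].  The new bits are close to the old ones,
   and nearly determine a given set without help of [F M].  Iterating over a
   dense sequence of sets, the bits converge to an i.i.d. generator. *)
Require Import Defs.
From HB Require Import structures.
From mathcomp Require Import all_boot all_order all_algebra all_fingroup.
From mathcomp Require Import zify ring lra.
Set Implicit Arguments. Unset Strict Implicit. Unset Printing Implicit Defensive.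
Import Order.TTheory GRing.Theory Num.Theory.

(** * Permutations and doubly stochastic matrices *)

(** Words of different types may have different probabilities, so there is in general no
    measure-preserving bijection close to a given coupling of two i.i.d. words. Within a type all
    words are equally likely, and words of length [n] have only polynomially many types, so fixing
    the type costs an entropy [O(ln n)], negligible per letter. This is why the recoding only
    permutes the letters of a block. The markers have to be known on both sides: they must belong to
    [F M], over which the recoded bits stay i.i.d., and they must be functions of the bits, or the
    new predictor would still need [F M]. They are read off one nontrivial bit of a level [m >= M]:
    it lies in [F M], and it is a bit of the sequence that the step leaves untouched. If no level
    [>= M] has a nontrivial bit, then [F M] lies up to null sets in every later [F m], is trivial by
    the product structure, and the bits of level [< M] generate already. Each [F m] is replaced by
    its completion, which is exactly invariant, so that null sets need not be tracked. *)

Lemma hall (V : finType) (N : V -> {set V}) (A : {set V}) :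
  (forall B : {set V}, B \subset A -> #|B| <= #|\bigcup_(x in B) N x|)%N ->
  exists f : V -> V, {in A, forall x, f x \in N x} /\ {in A &, injective f}.
Proof.
elim: {A}#|A| {-2}A (leqnn #|A|) N => [|n IHn] A leA N hN.
  move: leA; rewrite leqn0 cards_eq0 => /eqP ->.
  by exists id; split=> x; rewrite inE.
have [->|/set0Pn [x0 Ax0]] := eqVneq A set0.
  by exists id; split=> x; rewrite inE.
have NU (B C : {set V}) :
    \bigcup_(x in B :|: C) N x = (\bigcup_(x in B) N x) :|: \bigcup_(x in C) N x.
  by rewrite bigcup_setU.
(* A critical set [B] is matched inside its neighbours. Hall's condition survives on the rest after
   these neighbours are deleted, as counting with [C :|: B] shows. *)
case: (boolP [exists B : {set V},
   [&& B \proper A, B != set0 & (#|\bigcup_(x in B) N x| <= #|B|)%N]]).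
- case/existsP=> B /and3P[BA Bn0 NB].
  have [f1 [f1N f1i]] : exists f : V -> V,
      {in B, forall x, f x \in N x} /\ {in B &, injective f}.
    apply: IHn => [|C CB]; last first.
      exact/hN/(subset_trans CB)/proper_sub.
    by rewrite -ltnS; apply: leq_trans leA; apply: proper_card.
  have [f2 [f2N f2i]] : exists f : V -> V,
      {in A :\: B, forall x, f x \in N x :\: \bigcup_(x in B) N x} /\
      {in A :\: B &, injective f}.
    apply: (IHn _ _ (fun x => N x :\: \bigcup_(x in B) N x)) => [|C CAB].
      rewrite -ltnS; apply: leq_trans leA; apply: proper_card.
      rewrite properE subsetDl; apply/subsetPn; case/set0Pn: Bn0 => z zB.
      by exists z; rewrite ?inE ?zB // (subsetP (proper_sub BA)).
    have -> : \bigcup_(x in C) (N x :\: \bigcup_(x in B) N x) =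
              (\bigcup_(x in C) N x) :\: \bigcup_(x in B) N x.
      apply/setP=> y; rewrite inE; apply/bigcupP/andP => [[x xC]|[yB /bigcupP[x xC yN]]].
        by rewrite inE => /andP[? ?]; split=> //; apply/bigcupP; exists x.
      by exists x => //; rewrite inE yB.
    have CB0 : C :&: B = set0.
      apply/setP=> y; rewrite !inE; apply/negP=> /andP[yC yB].
      by move/subsetP: CAB => /(_ y yC); rewrite inE yB.
    have := hN (C :|: B); rewrite NU cardsU CB0 cards0 subn0 => hCB.
    have {}hCB : (#|C| + #|B| <= #|(\bigcup_(x in C) N x) :|: \bigcup_(x in B) N x|)%N.
      apply: hCB; rewrite subUset (proper_sub BA) andbT.
      by apply: subset_trans CAB _; apply: subsetDl.
    have E : #|(\bigcup_(x in C) N x) :|: \bigcup_(x in B) N x| =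
         (#|(\bigcup_(x in C) N x) :\: \bigcup_(x in B) N x| + #|\bigcup_(x in B) N x|)%N.
      rewrite -[LHS](cardsID (\bigcup_(x in B) N x)) addnC setDUl setDv setU0.
      by congr (_ + #|pred_of_set _|)%N; rewrite setIC; apply/setIidPl; apply: subsetUr.
    rewrite E in hCB.
    by rewrite -(leq_add2r #|B|); apply: leq_trans hCB _; rewrite leq_add2l.
  exists (fun x => if x \in B then f1 x else f2 x); split=> [x xA|x y xA yA].
    case: ifP => xB; first exact: f1N.
    have := f2N x; rewrite !inE xB xA => /(_ isT) /andP[_ ->] //.
  have aux z z' : z \in B -> z' \in A -> z' \notin B -> f1 z <> f2 z'.
    move=> zB z'A z'B e; have := f2N z'; rewrite !inE z'B z'A => /(_ isT).
    by case/andP=> /negP[]; rewrite -e; apply/bigcupP; exists z => //; apply: f1N.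
  case: ifPn => xB; case: ifPn => yB.
  + exact: f1i.
  + by move=> /aux; case.
  + by move=> /esym /aux; case.
  + by apply: f2i; rewrite inE ?xB ?yB.
(* Without critical sets, every nonempty proper subset has a neighbour to spare, so [x0] may take
   any neighbour [y0]. *)
rewrite negb_exists => /forallP crit.
have [y0 y0N] : exists y, y \in N x0.
  apply/set0Pn; rewrite -card_gt0; have := hN [set x0].
  by rewrite sub1set Ax0 cards1 big_set1 => /(_ isT).
have [f [fN fi]] : exists f : V -> V,
    {in A :\ x0, forall x, f x \in N x :\ y0} /\ {in A :\ x0 &, injective f}.
  apply: (IHn _ _ (fun x => N x :\ y0)) => [|C CA].
    by rewrite -ltnS; apply: leq_trans leA; rewrite [X in (_ < X)%N](cardsD1 x0) Ax0.
  have [->|Cn0] := eqVneq C set0; first by rewrite cards0.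
  have -> : \bigcup_(x in C) (N x :\ y0) = (\bigcup_(x in C) N x) :\ y0.
    apply/setP=> y; rewrite !inE; apply/bigcupP/andP => [[x xC]|[yB /bigcupP[x xC yN]]].
      by rewrite !inE => /andP[? ?]; split=> //; apply/bigcupP; exists x.
    by exists x => //; rewrite !inE yB.
  have := crit C; rewrite Cn0 andTb negb_and -ltnNge => /orP[|lt].
    case/negP; apply: sub_proper_trans CA _; exact: (properD1 Ax0).
  by rewrite -ltnS; apply: leq_trans lt _; rewrite (cardsD1 y0); case: (y0 \in _).
exists (fun x => if x == x0 then y0 else f x); split=> [x xA|x y xA yA].
  case: eqP => [->//|/eqP xx0]; have := fN x; rewrite !inE xx0 xA => /(_ isT).
  by case/andP.
have aux z : z \in A -> z != x0 -> f z <> y0.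
  by move=> zA zx e; have := fN z; rewrite !inE zx zA e eqxx => /(_ isT).
case: (eqVneq x x0) => [->|xx0]; case: (eqVneq y x0) => [->|yx0] //.
- by move=> /esym /aux; case.
- by move=> /aux; case.
- by apply: fi; rewrite !inE ?xx0 ?yx0.
Qed.

Local Open Scope ring_scope.

(** Hall's condition for the support: the rows of [B] carry mass [#|B|], all of it in the
    neighbouring columns, each of total mass 1. *)
Lemma doubly_stochastic_perm (R : realFieldType) (V : finType) (M : V -> V -> R) :
  (forall x y, 0 <= M x y) -> (forall x, \sum_y M x y = 1) ->
  (forall y, \sum_x M x y = 1) -> exists s : {perm V}, forall x, 0 < M x (s x).
Proof.
move=> M0 Mr Mc.
have [B _|f [fN fi]] := @hall V (fun x => [set y | M x y != 0]) [set: V].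
  rewrite -(ler_nat R); set N := \bigcup_(_ in _) _.
  have -> : #|B|%:R = \sum_(x in B) \sum_(y in N) M x y.
    rewrite -sum1_card natr_sum; apply: eq_bigr => x xB.
    rewrite -(Mr x) (bigID (mem N)) /= [X in _ + X]big1 ?addr0 // => y.
    by apply: contraNeq => Mxy; apply/bigcupP; exists x; rewrite ?inE.
  rewrite exchange_big /= -sum1_card natr_sum; apply: ler_sum => y _.
  rewrite -(Mc y) [leRHS](bigID (mem B)) /= lerDl.
  by apply: sumr_ge0 => x _; apply: M0.
have fi' : injective f by move=> x y; apply: fi; rewrite inE.
exists (perm fi') => x; rewrite permE lt_neqAle M0 andbT eq_sym.
by have := fN x; rewrite !inE => ->.
Qed.

(* A doubly stochastic matrix is a mixture of permutation matrices; peeling off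
   one permutation of the support either already beats the average cost, or
   leaves a mixture with smaller support and no larger cost. *)
Lemma birkhoff_min (R : realFieldType) (V : finType) (M C : V -> V -> R) :
  (forall x y, 0 <= M x y) -> (forall x, \sum_y M x y = 1) ->
  (forall y, \sum_x M x y = 1) ->
  exists s : {perm V}, (forall x, 0 < M x (s x)) /\
    \sum_x C x (s x) <= \sum_x \sum_y M x y * C x y.
Proof.
elim: {M}#|[pred p | M p.1 p.2 != 0]| {-2}M (leqnn #|[pred p : V * V | M p.1 p.2 != 0]|)
  => [|n IHn] M leM M0 Mr Mc; have [s sM] := doubly_stochastic_perm M0 Mr Mc.
  have V0 (x : V) : False.
    move: leM; rewrite leqn0 => /eqP/card0_eq /(_ (x, s x)).
    by rewrite !inE /= => /negbFE/eqP M0'; have := sM x; rewrite M0' ltxx.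
  by exists s; split=> //; rewrite !big1 // => x; case: (V0 x).
have [le|lt] := lerP (\sum_x C x (s x)) (\sum_x \sum_y M x y * C x y).
  by exists s.
case: (pickP (fun _ : V => true)) => [x0 _|V0]; last first.
  by move: lt; rewrite !big_pred0 ?ltxx // => x; have := V0 x.
(* The smallest entry along [s] is the largest weight that can be subtracted with all entries
   staying nonnegative; its cell then leaves the support. *)
pose xm := [arg min_(x < x0) M x (s x)]%O.
have xmP x : M xm (s xm) <= M x (s x).
  by rewrite /xm; case: arg_minP => // i _; apply.
set e := M xm (s xm) in xmP; have e0 : 0 < e by exact: sM.
have Ms1 x : M x (s x) <= 1.
  by rewrite -(Mr x) (bigD1 (s x)) //= lerDl; apply: sumr_ge0.
(* Weight one would make [M] the permutation matrix of [s], whose cost is that of [s], against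
   [lt]. *)
have e1 : e < 1.
  rewrite lt_neqAle Ms1 andbT; apply/eqP=> e1.
  have Ms x : M x (s x) = 1 by apply/le_anti; rewrite Ms1 -e1 xmP.
  suff E : \sum_x \sum_y M x y * C x y = \sum_x C x (s x) by rewrite E ltxx in lt.
  apply: eq_bigr => x _; rewrite (bigD1 (s x)) //= Ms mul1r big1 ?addr0 // => y ys.
  have /eqP : \sum_(y | y != s x) M x y = 0.
    by have := Mr x; rewrite (bigD1 (s x)) //= Ms; lra.
  rewrite psumr_eq0; last by move=> *; apply: M0.
  by move=> /allP /(_ y (mem_index_enum y)); rewrite ys /= => /eqP ->; rewrite mul0r.
pose M' x y := (M x y - e * (y == s x)%:R) / (1 - e).
have e1' : 0 < 1 - e by lra.
have M'0 x y : 0 <= M' x y.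
  apply: divr_ge0; last lra.
  by case: eqP => [->|_]; rewrite ?mulr1 ?mulr0 ?subr0 ?M0 // subr_ge0.
have M'r x : \sum_y M' x y = 1.
  rewrite -mulr_suml sumrB Mr -mulr_sumr (bigD1 (s x)) //= eqxx big1 ?addr0.
    by rewrite mulr1 divff // lt0r_neq0.
  by move=> y /negPf ->.
have M'c y : \sum_x M' x y = 1.
  rewrite -mulr_suml sumrB Mc -mulr_sumr (bigD1 (s^-1 y)%g) //= permKV eqxx big1 ?addr0.
    by rewrite mulr1 divff // lt0r_neq0.
  by move=> x; case: (y =P s x) => // ->; rewrite permK eqxx.
have M'M x y : M' x y != 0 -> M x y != 0.
  apply: contra_neq => Mxy; rewrite /M' Mxy; case: eqP => [ys|_].
    by have := sM x; rewrite -ys Mxy ltxx.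
  by rewrite mulr0 subrr mul0r.
have [||||s' [s'M s'C]] := IHn M' => //.
  rewrite -ltnS; apply: leq_trans leM; apply: proper_card; apply/properP; split.
    by apply/subsetP=> -[x y]; rewrite !inE /=; apply: M'M.
  exists (xm, s xm); rewrite !inE /=; first by rewrite gt_eqF.
  by rewrite negbK /M' eqxx mulr1 -/e subrr mul0r eqxx.
exists s'; split.
  move=> x; rewrite lt_neqAle M0 andbT eq_sym; apply: M'M.
  by rewrite gt_eqF.
(* Since [s] costs more than the average, removing it lowers the average. *)
apply: le_trans s'C _.
have -> : \sum_x \sum_y M' x y * C x y =
   (\sum_x \sum_y M x y * C x y - e * \sum_x C x (s x)) / (1 - e).
  rewrite mulr_sumr -sumrB mulr_suml; apply: eq_bigr => x _.
  transitivity (((\sum_y M x y * C x y) - \sum_y (e * (y == s x)%:R) * C x y) / (1 - e)).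
    by rewrite -sumrB mulr_suml; apply: eq_bigr => y _; rewrite /M'; ring.
  congr ((_ - _) / _); rewrite (bigD1 (s x)) //= eqxx mulr1 big1 ?addr0 //.
  by move=> y /negPf ->; rewrite mulr0 mul0r.
rewrite ler_pdivrMr //; nra.
Qed.

From mathcomp Require Import all_classical all_reals all_analysis.
Import numFieldNormedType.Exports.

(** * Relative entropy and transport *)

Section Divergence.
Variable R : realType.
Implicit Types q m t : R.

Lemma kl_term_ge q m : 0 <= q -> 0 <= m -> (m = 0 -> q = 0) ->
  q - m <= q * ln (q / m).
Proof.
move=> q0 m0 mq; have [->|qn0] := eqVneq q 0; first by rewrite mul0r sub0r oppr_le0.
have qp : 0 < q by rewrite lt_neqAle eq_sym qn0.
have mp : 0 < m by rewrite lt_neqAle m0 eq_sym andbT; apply: contra_neq qn0.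
have : ln (m / q) <= m / q - 1.
  have -> : m / q = 1 + (m / q - 1) by ring.
  have := @le_ln1Dx R (m / q - 1); rewrite [in X in _ -> _ <= X - 1]addrC addrA.
  by rewrite [1 + _]addrC subrK; apply; rewrite ltrBrDl subrr divr_gt0.
have -> : ln (q / m) = - ln (m / q).
  by rewrite -lnV ?posrE ?divr_gt0 // invf_div.
move=> h; rewrite mulrN -lerN2 opprK.
apply: le_trans (ler_wpM2l q0 h) _.
by rewrite mulrBr mulr1 mulrCA divff // mulr1 opprB.
Qed.

(** A pointwise Pinsker inequality. With [u], [v] the square roots, the divergence term dominates
    [(u - v)^2], while the left side is [|u - v| * (u + v)]; the weighted arithmetic-geometric
    inequality with weight [t] does the rest. *)
Lemma abs_le_kl_term q m t : 0 < t -> 0 <= q -> 0 <= m -> (m = 0 -> q = 0) ->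
  `|q - m| <= t^-1 * (q * ln (q / m) - q + m) + t / 2 * (q + m).
Proof.
move=> t0 q0 m0 mq; set u := Num.sqrt q; set v := Num.sqrt m.
have qu : q = u ^+ 2 by rewrite sqr_sqrtr.
have mv : m = v ^+ 2 by rewrite sqr_sqrtr.
have u0 : 0 <= u by apply: sqrtr_ge0.
have v0 : 0 <= v by apply: sqrtr_ge0.
have h : 2 * u ^+ 2 - 2 * u * v <= q * ln (q / m).
  have [u00|un0] := eqVneq u 0; first by rewrite qu u00; lra.
  have vn0 : v != 0.
    by apply: contra_neq un0 => v00; rewrite /u mq ?sqrtr0 // mv v00 expr0n.
  have -> : q / m = (u / v) ^+ 2 by rewrite expr_div_n -qu -mv.
  have up : 0 < u by rewrite lt_neqAle eq_sym un0.
  have vp : 0 < v by rewrite lt_neqAle eq_sym vn0.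
  rewrite lnXn ?divr_gt0 // qu.
  have := @kl_term_ge u v u0 v0; move=> /(_ _)/wrap[]; first by move/eqP; rewrite (negPf vn0).
  rewrite mulr2n; nra.
have -> : `|q - m| = `|u - v| * (u + v).
  by rewrite qu mv subr_sqr normrM [`|u + v|]ger0_norm // addr_ge0.
have t1 : 0 < t^-1 by rewrite invr_gt0.
apply: (@le_trans _ _ (t^-1 * (u - v) ^+ 2 + t / 2 * (u ^+ 2 + v ^+ 2))); last first.
  by apply: lerD; rewrite -?qu -?mv ?ler_pM2l //; move: h qu mv; set L := q * ln _; lra.
rewrite -normr_id -real_normK ?num_real //.
set d := `|u - v|; have d0 : 0 <= d by exact: normr_ge0.
rewrite ger0_norm //.
apply: (@le_trans _ _ (t^-1 * d ^+ 2 + t / 4 * (u + v) ^+ 2)); last first.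
  rewrite lerD2l; have := mulr_ge0 (ltW t0) (sqr_ge0 (u - v)); lra.
rewrite -subr_ge0.
have -> : t^-1 * d ^+ 2 + t / 4 * (u + v) ^+ 2 - d * (u + v) =
   t^-1 * (d - t / 2 * (u + v)) ^+ 2 by field; lra.
by rewrite mulr_ge0 ?sqr_ge0 // ltW.
Qed.

(** The bound is kept linear in the divergence, with [t] free, so that it can be summed along the
    chain rule in [transport]. *)
Lemma sum_abs_le_kl (I : finType) (q m : I -> R) t : 0 < t ->
  (forall i, 0 <= q i) -> (forall i, 0 <= m i) -> (forall i, m i = 0 -> q i = 0) ->
  \sum_i q i = 1 -> \sum_i m i = 1 ->
  \sum_i `|q i - m i| <= t^-1 * (\sum_i q i * ln (q i / m i)) + t.
Proof.
move=> t0 q0 m0 mq q1 m1.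
have -> : t^-1 * (\sum_i q i * ln (q i / m i)) + t =
  \sum_i (t^-1 * (q i * ln (q i / m i) - q i + m i) + t / 2 * (q i + m i)).
  rewrite big_split /= -!mulr_sumr !big_split /= sumrN q1 m1; lra.
by apply: ler_sum => i _; apply: abs_le_kl_term => // ?; apply: mq.
Qed.

End Divergence.

(** * Words, Hamming distance and product laws *)

Section Words.
Variable A : finType.

Definition fcons n (a : A) (w : {ffun 'I_n -> A}) : {ffun 'I_n.+1 -> A} :=
  [ffun i => if unlift ord0 i is Some j then w j else a].

Lemma fcons0 n a (w : {ffun 'I_n -> A}) : fcons a w ord0 = a.
Proof. by rewrite ffunE unlift_none. Qed.

Lemma fconsS n a (w : {ffun 'I_n -> A}) i : fcons a w (lift ord0 i) = w i.
Proof. by rewrite ffunE liftK. Qed.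

Lemma big_fcons (R : realType) n (f : {ffun 'I_n.+1 -> A} -> R) :
  \sum_w f w = \sum_a \sum_w f (fcons a w).
Proof.
rewrite pair_big /= (reindex (fun p : A * {ffun 'I_n -> A} => fcons p.1 p.2)) //=.
exists (fun w => (w ord0, [ffun i => w (lift ord0 i)])) => [[a w] _|w _] /=.
  by rewrite fcons0; congr pair; apply/ffunP=> i; rewrite ffunE fconsS.
apply/ffunP=> i; case: (unliftP ord0 i) => [j|] ->; first by rewrite fconsS ffunE.
by rewrite fcons0.
Qed.

End Words.

Section Hamming.
Variables (R : realType) (A : finType).

Definition ham n (w w' : {ffun 'I_n -> A}) : R := \sum_i (w i != w' i)%:R.

Lemma ham_ge0 n (w w' : {ffun 'I_n -> A}) : 0 <= ham w w'.
Proof. by apply: sumr_ge0 => i _. Qed.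

Lemma hamC n (w w' : {ffun 'I_n -> A}) : ham w w' = ham w' w.
Proof. by apply: eq_bigr => i _; rewrite eq_sym. Qed.

Lemma ham_trans n (w w1 w2 : {ffun 'I_n -> A}) : ham w w2 <= ham w w1 + ham w1 w2.
Proof.
rewrite -big_split; apply: ler_sum => i _ /=; rewrite -natrD ler_nat.
by case: (eqVneq (w i) (w1 i)) => [->|_] //; case: (_ != _).
Qed.

Lemma ham_fcons n a b (w w' : {ffun 'I_n -> A}) :
  ham (fcons a w) (fcons b w') = (a != b)%:R + ham w w'.
Proof.
rewrite /ham big_ord_recl !fcons0; congr (_ + _).
by apply: eq_bigr => i _; rewrite !fconsS.
Qed.

Definition pwr (p : A -> R) n (w : {ffun 'I_n -> A}) : R := \prod_i p (w i).

Lemma pwr_ge0 p n (w : {ffun 'I_n -> A}) : (forall a, 0 <= p a) -> 0 <= pwr p w.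
Proof. by move=> p0; apply: prodr_ge0. Qed.

Lemma pwr_fcons p n a (w : {ffun 'I_n -> A}) : pwr p (fcons a w) = p a * pwr p w.
Proof.
rewrite /pwr big_ord_recl fcons0; congr (_ * _).
by apply: eq_bigr => i _; rewrite fconsS.
Qed.

Lemma sum_pwr p n : \sum_a p a = 1 -> \sum_(w : {ffun 'I_n -> A}) pwr p w = 1.
Proof.
move=> p1; rewrite /pwr -(bigA_distr_bigA (fun _ : 'I_n => p)) /=.
by rewrite big1.
Qed.

(** The common mass [min(r, p)] stays on the diagonal; the excesses [f] and [g], both of total mass
    [v], half the distance of the two laws, are coupled independently. *)
Lemma maximal_coupling (r p : A -> R) :
  (forall a, 0 <= r a) -> (forall a, 0 <= p a) -> \sum_a r a = 1 -> \sum_a p a = 1 ->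
  exists k : A -> A -> R, [/\ forall a b, 0 <= k a b, forall a, \sum_b k a b = r a,
    forall b, \sum_a k a b = p b &
    2 * (\sum_a \sum_b k a b * (a != b)%:R) <= \sum_a `|r a - p a|].
Proof.
move=> r0 p0 r1 p1.
pose f a := Num.max (r a - p a) 0; pose g a := Num.max (p a - r a) 0.
have f0 a : 0 <= f a by rewrite le_max lexx orbT.
have g0 a : 0 <= g a by rewrite le_max lexx orbT.
have fg a : f a - g a = r a - p a by rewrite /f /g !maxEle; do 2 case: ifP; lra.
have fga a : f a + g a = `|r a - p a|.
  rewrite /f /g; case: (lerP (r a) (p a)) => h.
    by rewrite max_r ?max_l ?ler0_norm; lra.
  by rewrite max_l ?max_r ?ger0_norm; lra.
have rf a : f a <= r a by rewrite /f ge_max r0 gerBl p0.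
pose v := \sum_a f a.
have gv : \sum_a g a = v.
  apply/eqP; rewrite eq_sym -subr_eq0 -sumrB; apply/eqP.
  by under eq_bigr do rewrite fg; rewrite sumrB r1 p1 subrr.
have v0 : 0 <= v by apply: sumr_ge0.
(* If [v = 0] all the excesses vanish, so the convention [x / 0 = 0] gives the right value. *)
have vf a : f a * v / v = f a.
  have [v00|vn0] := eqVneq v 0; last by rewrite mulfK.
  move/eqP: (v00); rewrite psumr_eq0 // => /allP /(_ a (mem_index_enum a)) /eqP ->.
  by rewrite !mul0r.
have vg a : g a * v / v = g a.
  have [v00|vn0] := eqVneq v 0; last by rewrite mulfK.
  move/eqP: (v00); rewrite -gv psumr_eq0 // => /allP /(_ a (mem_index_enum a)) /eqP ->.
  by rewrite !mul0r.
exists (fun a b => (a == b)%:R * (r a - f a) + f a * g b / v); split.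
- move=> a b; rewrite addr_ge0 ?mulr_ge0 ?subr_ge0 ?invr_ge0 //.
- move=> a; rewrite big_split /= -mulr_suml -mulr_suml -mulr_sumr gv vf.
  rewrite (bigD1 a) //= eqxx big1; first by rewrite addr0 mul1r subrK.
  by move=> b; rewrite eq_sym => /negPf ->.
- move=> b; rewrite big_split /= (bigD1 b) //= eqxx mul1r big1 ?addr0; last first.
    by move=> a /negPf ->; rewrite mul0r.
  by rewrite -mulr_suml -mulr_suml -/v [v * _]mulrC vg; have := fg b; lra.
- have -> : \sum_a `|r a - p a| = 2 * v.
    by under eq_bigr do rewrite -fga; rewrite big_split /= gv -/v; lra.
  rewrite ler_pM2l //.
  have E : v = \sum_a \sum_b f a * g b / v.
    by apply: eq_bigr => a _; rewrite -mulr_suml -mulr_sumr gv vf.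
  rewrite [leRHS]E.
  apply: ler_sum => a _; apply: ler_sum => b _.
  case: (a == b); rewrite ?mulr0 ?mul0r ?mulr1 ?add0r //.
  by rewrite !mulr_ge0 ?invr_ge0.
Qed.

(* Marton's transport inequality for product measures; its quadratic form is
   replaced by the equivalent family of linear bounds indexed by [t]. *)
Lemma transport n (p : A -> R) (rho : {ffun 'I_n -> A} -> R) (t : R) : 0 < t ->
  (forall a, 0 <= p a) -> \sum_a p a = 1 ->
  (forall w, 0 <= rho w) -> \sum_w rho w = 1 -> (forall w, pwr p w = 0 -> rho w = 0) ->
  exists k : {ffun 'I_n -> A} -> {ffun 'I_n -> A} -> R,
  [/\ forall w w', 0 <= k w w', forall w, \sum_w' k w w' = rho w,
      forall w', \sum_w k w w' = pwr p w' &
      2 * (\sum_w \sum_w' k w w' * ham w w') <=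
        t^-1 * (\sum_w rho w * ln (rho w / pwr p w)) + n%:R * t].
Proof.
move=> t0 p0 p1; elim: n rho => [|n IHn] rho r0 r1 pr.
  have W0 (w w' : {ffun 'I_0 -> A}) : w = w' by apply/ffunP => -[].
  have P1 (w : {ffun 'I_0 -> A}) : pwr p w = 1 by apply: big1 => -[].
  pose w0 : {ffun 'I_0 -> A} := [ffun i : 'I_0 => match i with Ordinal _ h =>
    False_rect A (notF h) end].
  have s1 (f : {ffun 'I_0 -> A} -> R) : \sum_w f w = f w0.
    by rewrite (bigD1 w0) //= big1 ?addr0 // => w; rewrite (W0 w w0) eqxx.
  have R1 w : rho w = 1 by rewrite (W0 w w0) -s1.
  exists (fun w w' => 1); split => //.
  - by move=> w; rewrite s1 R1.
  - by move=> w; rewrite s1 P1.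
  - by rewrite !s1 R1 P1 invr1 mulr1 ln1 [ham _ _]big1 ?mulr0 ?mul0r ?addr0 // => -[].
pose r1_ a := \sum_w rho (fcons a w).
have r10 a : 0 <= r1_ a by apply: sumr_ge0.
have r11 : \sum_a r1_ a = 1 by rewrite -r1 big_fcons.
have rz a w : r1_ a = 0 -> rho (fcons a w) = 0.
  move/eqP; rewrite psumr_eq0 // => /allP /(_ w (mem_index_enum w)).
  by move=> /eqP.
(* The conditional law of the tail given the first letter [a]. On null letters the product law
   stands in, so that the induction hypothesis applies to every [a]. *)
pose c a w := if r1_ a == 0 then pwr p w else rho (fcons a w) / r1_ a.
have rc a w : rho (fcons a w) = r1_ a * c a w.
  by rewrite /c; case: eqP => [/[dup] /rz -> ->|/eqP h]; rewrite ?mul0r // mulrCA divff ?mulr1.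
have c0 a w : 0 <= c a w.
  by rewrite /c; case: ifP => _; [exact: pwr_ge0|rewrite divr_ge0].
have c1 a : \sum_w c a w = 1.
  rewrite /c; case: eqP => [_|/eqP h]; first exact: sum_pwr.
  by rewrite -mulr_suml divff.
have cp a w : pwr p w = 0 -> c a w = 0.
  move=> h; rewrite /c; case: ifP => // _.
  by rewrite pr ?mul0r // pwr_fcons h mulr0.
have /choice[K HK] : forall a, exists k : {ffun 'I_n -> A} -> {ffun 'I_n -> A} -> R,
  [/\ forall w w', 0 <= k w w',
      forall w, \sum_w' k w w' = c a w, forall w', \sum_w k w w' = pwr p w' &
      2 * (\sum_w \sum_w' k w w' * ham w w') <=
        t^-1 * (\sum_w c a w * ln (c a w / pwr p w)) + n%:R * t].
  by move=> a; exact: IHn (c0 a) (c1 a) (cp a).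
have [k1 [k10 k1r k1p k1c]] := maximal_coupling r10 p0 r11 p1.
have pr1 a : p a = 0 -> r1_ a = 0.
  by move=> h; apply: big1 => w _; apply: pr; rewrite pwr_fcons h mul0r.
have tv := sum_abs_le_kl t0 r10 p0 pr1 r11 p1.
pose h (w : {ffun 'I_n.+1 -> A}) := [ffun i => w (lift ord0 i)] : {ffun 'I_n -> A}.
have hc a w : h (fcons a w) = w by apply/ffunP=> i; rewrite ffunE fconsS.
(* The first letters are coupled maximally, then the tails by the plan of the first letter of [w].
   Every such plan has the same second marginal, so the tail of [w'] is independent of its first
   letter. *)
exists (fun w w' : {ffun 'I_n.+1 -> A} => k1 (w ord0) (w' ord0) * K (w ord0) (h w) (h w')).
have Kr a w : \sum_w' K a w w' = c a w by case: (HK a).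
have Kp a w : \sum_w' K a w' w = pwr p w by case: (HK a).
split.
- by move=> w w'; apply: mulr_ge0 => //; case: (HK (w ord0)) => h0 _ _ _; apply: h0.
- move=> w; have -> : w = fcons (w ord0) (h w).
    by apply/ffunP=> i; case: (unliftP ord0 i) => [j|] ->; rewrite ?fconsS ?fcons0 ?ffunE.
  move: (w ord0) (h w) => a {}w; rewrite big_fcons rc fcons0 hc -k1r mulr_suml.
  apply: eq_bigr => b _; rewrite -Kr mulr_sumr.
  by apply: eq_bigr => w' _; rewrite fcons0 hc.
- move=> w; have -> : w = fcons (w ord0) (h w).
    by apply/ffunP=> i; case: (unliftP ord0 i) => [j|] ->; rewrite ?fconsS ?fcons0 ?ffunE.
  move: (w ord0) (h w) => a {}w; rewrite big_fcons pwr_fcons fcons0 hc -k1p mulr_suml.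
  apply: eq_bigr => b _; rewrite -(Kp b) mulr_sumr.
  by apply: eq_bigr => w' _; rewrite fcons0 hc.
have -> : \sum_(w : {ffun 'I_n.+1 -> A}) \sum_(w' : {ffun 'I_n.+1 -> A}) k1 (w ord0) (w' ord0) * K
  (w ord0) (h w) (h w') * ham w w' =
   \sum_a \sum_b k1 a b * (a != b)%:R +
   \sum_a r1_ a * (\sum_w \sum_w' K a w w' * ham w w').
  rewrite big_fcons -big_split; apply: eq_bigr => a _ /=.
  transitivity (\sum_w \sum_b \sum_w' k1 a b * K a w w' * ((a != b)%:R + ham w w')).
    apply: eq_bigr => w _; rewrite big_fcons; apply: eq_bigr => b _.
    by apply: eq_bigr => w' _; rewrite !fcons0 !hc ham_fcons.
  rewrite exchange_big /= -k1r mulr_suml -big_split; apply: eq_bigr => b _ /=.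
  transitivity (\sum_w k1 a b * ((a != b)%:R * \sum_w' K a w w' +
                  \sum_w' K a w w' * ham w w')).
    apply: eq_bigr => w _; rewrite [in RHS]mulr_sumr -big_split mulr_sumr.
    by apply: eq_bigr => w' _ /=; ring.
  rewrite -mulr_sumr -mulrDr big_split /= -mulr_sumr; congr (_ * (_ + _)).
  by under eq_bigr do rewrite Kr; rewrite c1 mulr1.
(* The chain rule for the divergence. *)
have -> : \sum_w rho w * ln (rho w / pwr p w) =
   \sum_a r1_ a * ln (r1_ a / p a) +
   \sum_a r1_ a * (\sum_w c a w * ln (c a w / pwr p w)).
  rewrite big_fcons -big_split; apply: eq_bigr => a _ /=.
  transitivity (\sum_w (r1_ a * ln (r1_ a / p a) * c a w +
                  r1_ a * (c a w * ln (c a w / pwr p w)))); last first.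
    by rewrite big_split /= -!mulr_sumr c1 mulr1.
  apply: eq_bigr => w _; rewrite rc pwr_fcons.
  have [r1a0|r1an] := eqVneq (r1_ a) 0; first by rewrite r1a0; ring.
  have [ca0|can] := eqVneq (c a w) 0; first by rewrite ca0; ring.
  have pan : p a != 0 by apply: contra_neq r1an => /pr1.
  have pwn : pwr p w != 0 by apply: contra_neq can => /cp.
  have pos (x : R) : 0 <= x -> x != 0 -> 0 < x by rewrite lt_neqAle eq_sym => -> ->.
  have -> : r1_ a * c a w / (p a * pwr p w) = (r1_ a / p a) * (c a w / pwr p w).
    by field; apply/andP; split.
  rewrite lnM ?posrE ?divr_gt0 ?pos ?pwr_ge0 //; ring.
have IH : 2 * (\sum_a r1_ a * (\sum_w \sum_w' K a w w' * ham w w')) <=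
   t^-1 * (\sum_a r1_ a * (\sum_w c a w * ln (c a w / pwr p w))) + n%:R * t.
  have -> : n%:R * t = \sum_a r1_ a * (n%:R * t) by rewrite -mulr_suml r11 mul1r.
  rewrite !mulr_sumr -big_split; apply: ler_sum => a _ /=.
  have [_ _ _ /(ler_wpM2l (r10 a))] := HK a; lra.
rewrite -natr1; lra.
Qed.

(** A law of density at most [b^-1] with respect to the product law has divergence at most [- ln b].
    Conditioning on an event of probability [b] produces such a law. *)
Lemma transport_bounded_density n (p : A -> R) (rho : {ffun 'I_n -> A} -> R) (t b : R) :
  0 < t -> 0 < b -> (forall a, 0 <= p a) -> \sum_a p a = 1 ->
  (forall w, 0 <= rho w) -> \sum_w rho w = 1 -> (forall w, b * rho w <= pwr p w) ->
  exists k : {ffun 'I_n -> A} -> {ffun 'I_n -> A} -> R,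
  [/\ forall w w', 0 <= k w w', forall w, \sum_w' k w w' = rho w,
      forall w', \sum_w k w w' = pwr p w' &
      2 * (\sum_w \sum_w' k w w' * ham w w') <= t^-1 * - ln b + n%:R * t].
Proof.
move=> t0 b0 p0 p1 r0 r1 rb.
have pr w : pwr p w = 0 -> rho w = 0.
  move=> h; have := rb w; rewrite h => h'; apply/le_anti; rewrite r0 andbT.
  by rewrite -(pmulr_rle0 _ b0).
have [k [k0 kr kp kc]] := transport t0 p0 p1 r0 r1 pr.
exists k; split => //; apply: le_trans kc _; rewrite lerD2r ler_pM2l ?invr_gt0 //.
rewrite -[leRHS]mul1r -r1 mulr_suml; apply: ler_sum => w _.
have [->|rn] := eqVneq (rho w) 0; first by rewrite !mul0r.
have rp : 0 < rho w by rewrite lt_neqAle eq_sym rn r0.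
have pp : 0 < pwr p w by apply: lt_le_trans (rb w); rewrite mulr_gt0.
rewrite ler_pM2l // -lnV ?posrE // ler_ln ?posrE ?divr_gt0 ?invr_gt0 //.
by rewrite ler_pdivrMr // ler_pdivlMl.
Qed.

End Hamming.

(** * Recoding of blocks *)

(** [x] and [z] are made conditionally independent given [y], whose law is common to both
    couplings. *)
Lemma glue (R : realFieldType) (X Y Z : finType) (f : X -> Y -> R) (g : Y -> Z -> R) :
  (forall x y, 0 <= f x y) -> (forall y z, 0 <= g y z) ->
  (forall y, \sum_x f x y = \sum_z g y z) ->
  exists h : X -> Y -> Z -> R, [/\ forall x y z, 0 <= h x y z,
    forall x y, \sum_z h x y z = f x y & forall y z, \sum_x h x y z = g y z].
Proof.
move=> f0 g0 fg; pose m y := \sum_x f x y.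
have m0 y : 0 <= m y by apply: sumr_ge0.
exists (fun x y z => f x y * g y z / m y); split.
- by move=> x y z; rewrite !mulr_ge0 ?invr_ge0.
- move=> x y; rewrite -mulr_suml -mulr_sumr -fg -/(m y).
  have [my|my] := eqVneq (m y) 0; last by rewrite mulfK.
  rewrite my mulr0 mul0r; move/eqP: my; rewrite psumr_eq0 //.
  by move=> /allP /(_ x (mem_index_enum x)) /eqP.
- move=> y z; rewrite -mulr_suml -mulr_suml -/(m y) mulrAC.
  have [my|my] := eqVneq (m y) 0; last by rewrite divff ?mul1r.
  rewrite my !mul0r; move/eqP: my; rewrite /m fg psumr_eq0 //.
  by move=> /allP /(_ z (mem_index_enum z)) /eqP.
Qed.

Section WordType.
Variables (R : realType) (A : finType) (n : nat).
Implicit Types w : {ffun 'I_n -> A}.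
Local Notation W := {ffun 'I_n -> A}.

(** The counts are stored in ['I_n.+1] so that types form a [finType] of cardinal [n.+1 ^ #|A|]; the
    logarithm of this cardinal is the price of fixing the type. *)
Definition wtype w : {ffun A -> 'I_n.+1} := [ffun a => inord #|[pred i | w i == a]|].

Definition wperm w (s : 'S_n) : W := [ffun i => w (s i)].

Lemma wtype_perm w w' : wtype w = wtype w' -> exists s : 'S_n, w' = wperm w s.
Proof.
move=> ww'.
have cnt a : #|[pred i | w i == a]| = #|[pred i | w' i == a]|.
  have := congr1 (fun f : {ffun A -> 'I_n.+1} => val (f a)) ww'.
  by rewrite /= !ffunE /= !inordK // ltnS -[leqRHS]card_ord max_card.
have /tuple_permP[s hs] : perm_eq [tuple w' i | i < n] [tuple w i | i < n].
  apply/allP => a _ /=; apply/eqP.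
  have cn (v : W) : count_mem a [tuple v i | i < n] = #|[pred i | v i == a]|.
    by rewrite /= count_map cardE size_filter enumT.
  by rewrite !cn cnt.
exists s; apply/ffunP=> i; rewrite ffunE.
have := congr1 (fun u => nth (w' i) u i) hs.
rewrite -!tnth_nth.
rewrite (tnth_nth (w' i)) /= => _.
have : [tuple w' i | i < n] = [tuple tnth [tuple w i0 | i0 < n] (s i) | i < n] by apply/val_inj.
by move/(congr1 (fun u => tnth u i)); rewrite !tnth_mktuple.
Qed.

Lemma pwr_wperm (p : A -> R) w s : pwr p (wperm w s) = pwr p w.
Proof.
rewrite /pwr [RHS](reindex_inj (@perm_inj _ s)) /=.
by apply: eq_bigr => i _; rewrite ffunE.
Qed.

End WordType.

(** The divergence from the uniform law is nonnegative. *)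
Lemma sum_ln_ge (R : realType) (I : finType) (q : I -> R) : (forall i, 0 <= q i) ->
  \sum_i q i = 1 -> \sum_i q i * - ln (q i) <= ln #|I|%:R.
Proof.
move=> q0 q1.
have I0 : (0 < #|I|)%N.
  rewrite lt0n; apply: contra_eq_neq q1 => /card0_eq I0.
  by rewrite big_pred0 // eq_sym oner_neq0.
have c0 : 0 < #|I|%:R :> R by rewrite ltr0n.
have : \sum_i (q i - #|I|%:R^-1) <= \sum_i q i * ln (q i / #|I|%:R^-1).
  apply: ler_sum => i _; apply: kl_term_ge => //.
  by move/eqP; rewrite invr_eq0 gt_eqF.
rewrite sumrB q1 sumr_const -[X in 1 - X](mulr_natr _ #|I|) mulVf ?gt_eqF // subrr.
have -> : \sum_i q i * ln (q i / #|I|%:R^-1) =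
   - (\sum_i q i * - ln (q i)) + \sum_i q i * ln #|I|%:R.
  rewrite -sumrN -big_split; apply: eq_bigr => i _ /=.
  have [->|qn] := eqVneq (q i) 0; first by rewrite !mul0r oppr0 addr0.
  rewrite invrK lnM ?posrE // ?lt_neqAle 1?eq_sym ?qn ?q0 //; ring.
by rewrite -mulr_suml q1 mul1r; lra.
Qed.

Section SameType.
Variables (R : realType) (A : finType) (n : nat) (p : A -> R) (t : R).
Hypotheses (t0 : 0 < t) (p0 : forall a, 0 <= p a) (p1 : \sum_a p a = 1).
Local Notation W := {ffun 'I_n -> A}.
Local Notation T := {ffun A -> 'I_n.+1}.
Let pw (w : W) := pwr p w.

(* Conditioning [w'] on the type of [w] costs at most the entropy of the type,
   which is logarithmic in [n]; by [transport] both conditional laws are close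
   to the product law, hence to each other. *)
Lemma same_type_coupling (Q : W -> W -> R) :
  (forall w v, 0 <= Q w v) -> (forall w, \sum_v Q w v = pwr p w) ->
  (forall v, \sum_w Q w v = pwr p v) ->
  exists h : W -> W -> W -> R, [/\ forall w v u, 0 <= h w v u,
    forall w v, \sum_u h w v u = Q w v,
    forall u, \sum_w \sum_v h w v u = pwr p u,
    forall w v u, h w v u != 0 -> wtype w = wtype u &
    \sum_w \sum_v \sum_u h w v u * ham R v u <= t^-1 * ln #|T|%:R + n%:R * t].
Proof.
move=> Q0 Ql Qr.
have pw0 w : 0 <= pw w by apply: pwr_ge0.
pose pi s := \sum_(w | wtype w == s) pw w.
have pi0 s : 0 <= pi s by apply: sumr_ge0.
have pi1 : \sum_s pi s = 1.
  rewrite -(@sum_pwr R A p n p1) (partition_big (@wtype A n) xpredT) //=.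
(* [G s], of total mass [pi s], couples the words [v] whose partner [w] has type [s] with the
   product law restricted to type [s]. *)
have /choice[G HG] : forall s, exists G : W -> W -> R, [/\ forall v u, 0 <= G v u,
    forall v, \sum_u G v u = \sum_(w | wtype w == s) Q w v,
    forall u, \sum_v G v u = if wtype u == s then pw u else 0 &
    \sum_v \sum_u G v u * ham R v u <= t^-1 * (pi s * - ln (pi s)) + n%:R * t * pi s].
  move=> s; have [ps|psn] := eqVneq (pi s) 0.
    have pws w : wtype w == s -> pw w = 0.
      move=> ws; move/eqP: ps; rewrite psumr_eq0 // => /allP /(_ w (mem_index_enum w)).
      by rewrite ws /= => /eqP.
    exists (fun _ _ => 0); split => //.
    - move=> v; rewrite big1 // big1 // => w /pws; rewrite /pw -Ql => /eqP.
      by rewrite psumr_eq0 // => /allP /(_ v (mem_index_enum v)) /eqP.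
    - by move=> u; rewrite big1 //; case: ifP => // /pws.
    - rewrite ps mul0r !mulr0 addr0 big1 // => v _; rewrite big1 // => u _.
      by rewrite mul0r.
  have pp : 0 < pi s by rewrite lt_neqAle eq_sym psn pi0.
  pose r v := (\sum_(w | wtype w == s) Q w v) / pi s.
  pose U u := (if wtype u == s then pw u else 0) / pi s.
  have r0 v : 0 <= r v by rewrite divr_ge0 // sumr_ge0.
  have U0 v : 0 <= U v by rewrite divr_ge0 //; case: ifP.
  have r1 : \sum_v r v = 1.
    rewrite -mulr_suml exchange_big /=.
    by under eq_bigr do rewrite Ql; rewrite divff.
  have U1 : \sum_v U v = 1 by rewrite -mulr_suml -big_mkcond /= divff.
  have rp v : pi s * r v <= pwr p v.
    rewrite /r mulrCA divff // mulr1 -(Qr v) [leRHS](bigID (fun w => wtype w == s)) /=.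
    by rewrite lerDl sumr_ge0.
  have Up v : pi s * U v <= pwr p v.
    by rewrite /U mulrCA divff // mulr1; case: ifP => //; rewrite pw0.
  (* Both conditional laws have density at most [(pi s)^-1]. Each is transported to the product law,
     and the two plans are glued along it. *)
  have [k1 [k10 k1r k1p k1c]] := transport_bounded_density t0 pp p0 p1 r0 r1 rp.
  have [k2 [k20 k2r k2p k2c]] := transport_bounded_density t0 pp p0 p1 U0 U1 Up.
  have [|||h [h0 hl hr]] := @glue _ _ _ _ k1 (fun u v => k2 v u) => //.
    by move=> u; rewrite k1p k2p.
  exists (fun v u => pi s * \sum_y h v y u); split.
  - by move=> v u; rewrite mulr_ge0 // sumr_ge0.
  - move=> v; rewrite -mulr_sumr exchange_big /=.
    under eq_bigr do rewrite hl.
    by rewrite k1r /r mulrCA divff // mulr1.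
  - move=> u; rewrite -mulr_sumr exchange_big /=.
    under eq_bigr do rewrite hr.
    by rewrite k2r /U mulrCA divff // mulr1.
  have -> : \sum_v \sum_u pi s * (\sum_y h v y u) * ham R v u =
     pi s * \sum_v \sum_u \sum_y h v y u * ham R v u.
    rewrite mulr_sumr; apply: eq_bigr => v _; rewrite mulr_sumr; apply: eq_bigr => u _.
    by rewrite -mulrA; congr (_ * _); rewrite mulr_suml.
  have E : \sum_v \sum_u \sum_y h v y u * ham R v u <=
     \sum_v \sum_y k1 v y * ham R v y + \sum_v \sum_y k2 v y * ham R v y.
    have -> : \sum_v \sum_y k2 v y * ham R v y = \sum_v \sum_u \sum_y h v y u * ham R y u.
      rewrite [RHS]exchange_big /=; apply: eq_bigr => u _; rewrite [RHS]exchange_big /=.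
      by apply: eq_bigr => y _; rewrite -mulr_suml hr hamC.
    rewrite -big_split; apply: ler_sum => v _ /=.
    have -> : \sum_y k1 v y * ham R v y = \sum_u \sum_y h v y u * ham R v y.
      by rewrite exchange_big; apply: eq_bigr => y _ /=; rewrite -mulr_suml hl.
    rewrite -big_split; apply: ler_sum => u _ /=.
    rewrite -big_split; apply: ler_sum => y _ /=.
    by rewrite -mulrDr (ler_wpM2l (h0 _ _ _)) // ham_trans.
  apply: (@le_trans _ _ (pi s * (t^-1 * - ln (pi s) + n%:R * t))); last by lra.
  rewrite ler_pM2l //; lra.
(* Given the type of [w] and the word [v], the new word [u] is drawn independently of [w]. *)
pose f w (y : T * W) := if wtype w == y.1 then Q w y.2 else 0.
pose g (y : T * W) u := G y.1 y.2 u.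
have [|||h [h0 hl hr]] := @glue _ _ _ _ f g.
- by move=> w y; rewrite /f; case: ifP.
- by move=> y u; rewrite /g; case: (HG y.1).
- by move=> [s v]; rewrite /f /g -big_mkcond /=; case: (HG s) => _ ->.
exists (fun w v u => \sum_s h w (s, v) u); split.
- by move=> w v u; apply: sumr_ge0.
- move=> w v; rewrite exchange_big /=.
  under eq_bigr do rewrite hl /f /=.
  by rewrite -big_mkcond /= (eq_bigl (xpred1 (wtype w))) ?big_pred1_eq // => s; rewrite eq_sym.
- move=> u; under eq_bigr do rewrite exchange_big /=.
  rewrite exchange_big /=.
  have E s : \sum_w \sum_v h w (s, v) u = if wtype u == s then pw u else 0.
    rewrite exchange_big /=; under eq_bigr do rewrite hr.
    by rewrite /g /=; case: (HG s) => _ _ ->.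
  under eq_bigr do rewrite E.
  by rewrite -big_mkcond /= (eq_bigl (xpred1 (wtype u))) ?big_pred1_eq // => s; rewrite eq_sym.
- move=> w v u hn; have [s hs] : exists s, h w (s, v) u != 0.
    apply/existsP; apply: contra_neqT hn; rewrite negb_exists => /forallP hs.
    by apply: big1 => s _; apply/eqP; rewrite -[_ == _]negbK hs.
  have ws : wtype w = s.
    case: (wtype w =P s) => // /eqP/negPf ws.
    have := hl w (s, v); rewrite /f /= ws => /eqP.
    rewrite psumr_eq0 // => /allP /(_ u (mem_index_enum u)) /eqP h00.
    by rewrite h00 eqxx in hs.
  have : g (wtype w, v) u != 0.
    rewrite -hr psumr_neq0 //; apply/hasP; exists w; rewrite ?mem_index_enum //.
    by rewrite lt_neqAle eq_sym ws hs h0.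
  rewrite /g /=; case: (HG (wtype w)) => G0 _ HGu _ Gn.
  have : \sum_v G (wtype w) v u != 0.
    rewrite psumr_neq0 //; apply/hasP; exists v; rewrite ?mem_index_enum //.
    by rewrite lt_neqAle eq_sym Gn G0.
  by rewrite HGu; case: (wtype u =P wtype w) => // _ /eqP.
have -> : \sum_w \sum_v \sum_u (\sum_s h w (s, v) u) * ham R v u =
  \sum_s \sum_v \sum_u G s v u * ham R v u.
  transitivity (\sum_w \sum_s \sum_v \sum_u h w (s, v) u * ham R v u).
    apply: eq_bigr => w _; rewrite [RHS]exchange_big /=; apply: eq_bigr => v _.
    rewrite [RHS]exchange_big /=; apply: eq_bigr => u _.
    by rewrite mulr_suml.
  rewrite exchange_big; apply: eq_bigr => s _ /=.
  rewrite exchange_big; apply: eq_bigr => v _ /=.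
  rewrite exchange_big; apply: eq_bigr => u _ /=.
  by rewrite -mulr_suml hr.
apply: (@le_trans _ _ (\sum_s (t^-1 * (pi s * - ln (pi s)) + n%:R * t * pi s))).
  by apply: ler_sum => s _; case: (HG s).
rewrite big_split /= -!mulr_sumr pi1 mulr1 lerD2r ler_pM2l ?invr_gt0 //.
exact: sum_ln_ge.
Qed.

(** Paired words have the same type, hence the same probability, so dividing [Q] by it yields a
    doubly stochastic matrix; [birkhoff_min] picks a bijection in its support that costs no more
    than the average. *)
Lemma type_preserving_bijection (Q : W -> W -> R) (C : W -> W -> R) :
  (forall w v, 0 <= Q w v) -> (forall w, \sum_v Q w v = pwr p w) ->
  (forall v, \sum_w Q w v = pwr p v) ->
  (forall w v, Q w v != 0 -> wtype w = wtype v) ->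
  exists sg : W -> 'S_n, injective (fun w => wperm w (sg w)) /\
    \sum_w pwr p w * C w (wperm w (sg w)) <= \sum_w \sum_v Q w v * C w v.
Proof.
move=> Q0 Ql Qr Qt.
have Qp w v : Q w v != 0 -> pwr p w = pwr p v.
  by move/Qt/wtype_perm=> [s ->]; rewrite pwr_wperm.
(* Null words are fixed, which keeps the matrix doubly stochastic. *)
pose M w v := if pwr p w == 0 then (w == v)%:R else Q w v / pwr p w.
have p0w w : 0 <= pwr p w by apply: pwr_ge0.
have [|||s [sM sC]] := @birkhoff_min R W M (fun w v => pwr p w * C w v).
- by move=> w v; rewrite /M; case: ifP => // _; rewrite divr_ge0.
- move=> w; rewrite /M; case: (eqVneq (pwr p w) 0) => [_|wn].
    by rewrite (bigD1 w) //= eqxx big1 ?addr0 // => v; rewrite eq_sym => /negPf ->.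
  by rewrite -mulr_suml Ql divff.
- move=> v; have [pv|pv] := eqVneq (pwr p v) 0.
    rewrite (bigD1 v) //= /M pv !eqxx big1 ?addr0 // => w /negPf wv.
    case: ifPn => [_|pwn]; first by rewrite wv.
    case: (eqVneq (Q w v) 0) => [->|/Qp e]; first by rewrite mul0r.
    by rewrite e pv eqxx in pwn.
  rewrite -[RHS](divff pv) -[X in _ = X / _]Qr mulr_suml; apply: eq_bigr => w _.
  rewrite /M; case: (eqVneq (Q w v) 0) => [->|/Qp ->]; last by rewrite (negPf pv).
  rewrite !mul0r; case: ifP => // /eqP pw'; case: eqP => // wv.
  by rewrite -wv pw' eqxx in pv.
have /choice[sg Hsg] : forall w, exists s' : 'S_n, s w = wperm w s'.
  move=> w; have := sM w; rewrite /M; case: ifP => _.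
    case: eqP => [e|]; rewrite ?ltxx // => _; exists 1%g; rewrite -e.
    by apply/ffunP=> i; rewrite ffunE perm1.
  have [->|/Qt/wtype_perm[s' e] _] := eqVneq (Q w (s w)) 0; first by rewrite mul0r ltxx.
  by exists s'.
exists sg; split; first by move=> w v; rewrite -!Hsg => /perm_inj.
apply: le_trans (le_trans _ sC) _.
  by apply: ler_sum => w _; rewrite Hsg.
apply: ler_sum => w _; apply: ler_sum => v _; rewrite /M.
case: ifPn => [/eqP e|pn]; last by rewrite mulrA divfK.
rewrite e mul0r mulr0; move/eqP: (e); rewrite -Ql psumr_eq0 // => /allP.
by move=> /(_ v (mem_index_enum v)) /eqP ->; rewrite mul0r.
Qed.

(* [Q k] is the joint law of a word [l] independent of the label [k] and an
   i.i.d. word [w] independent of [k], [L k] predicting [l] from [w].  Permuting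
   [w] inside its type makes all the predictors agree with a single one. *)
Lemma block_recoding (L0 K : finType) (m : K -> R) (nu : {ffun 'I_n -> L0} -> R)
    (Q : K -> {ffun 'I_n -> L0} -> W -> R) (L : K -> W -> {ffun 'I_n -> L0}) (b : R) :
  (forall k l w, 0 <= Q k l w) ->
  (forall k l, \sum_w Q k l w = m k * nu l) ->
  (forall k w, \sum_l Q k l w = m k * pwr p w) ->
  0 < \sum_k m k -> (forall k, 0 <= m k) -> 0 <= b ->
  (forall k w w', ham R (L k w) (L k w') <= b * ham R w w') ->
  exists (k0 : K) (sg : K -> W -> 'S_n),
    (forall k, injective (fun w => wperm w (sg k w))) /\
    \sum_k m k * \sum_w pwr p w * ham R (L k w) (L k0 (wperm w (sg k w))) <=
    2 * (\sum_k \sum_l \sum_w Q k l w * ham R l (L k w)) +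
    (\sum_k m k) * (b * (t^-1 * ln #|T|%:R + n%:R * t)).
Proof.
move=> Q0 Qw Ql ms m0 b0 Lb.
set D := b * _.
pose c k := \sum_l \sum_w Q k l w * ham R l (L k w).
have c0 k : 0 <= c k.
  by apply: sumr_ge0 => l _; apply: sumr_ge0 => w _; rewrite mulr_ge0 // ham_ge0.
(* Some label has a conditional prediction cost [c k0 / m k0] at most the average one. Replacing
   each label's cost by it doubles the total, whence the factor 2 in the conclusion. *)
have [k0 [mk0 ck0]] : exists k0, 0 < m k0 /\ (\sum_k m k) * c k0 <= m k0 * \sum_k c k.
  apply: contrapT => /forallNP H.
  have [k1 mk1] : exists k, 0 < m k.
    apply: contrapT => /forallNP H'; move: ms; rewrite big1 ?ltxx // => k _.
    by apply/le_anti; rewrite m0 andbT leNgt; apply/negP.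
  have H1 k : m k * \sum_k c k <= (\sum_k m k) * c k.
    have [mk|mk] := ltrP 0 (m k).
      by rewrite leNgt; apply/negP=> lt; apply: (H k); split => //; apply: ltW.
    have -> : m k = 0 by apply/le_anti; rewrite mk m0.
    by rewrite mul0r mulr_ge0 // ltW.
  have : \sum_k (m k * \sum_k c k) < \sum_k ((\sum_k m k) * c k).
    rewrite (bigD1 k1) // [ltRHS](bigD1 k1) //=; apply: ltr_leD.
      by rewrite ltNge; apply/negP=> le; apply: (H k1).
    by apply: ler_sum.
  by rewrite -mulr_suml -mulr_sumr ltxx.
have step k : exists sg : W -> 'S_n, injective (fun w => wperm w (sg w)) /\
   m k * \sum_w pwr p w * ham R (L k w) (L k0 (wperm w (sg w))) <=
   c k + m k * (c k0 / m k0) + m k * D.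
  have [mk|mk] := eqVneq (m k) 0.
    exists (fun _ => 1%g); split.
      by move=> w v /ffunP e; apply/ffunP=> i; have := e i; rewrite !ffunE perm1.
    by rewrite mk !mul0r !addr0.
  have mkp : 0 < m k by rewrite lt_neqAle eq_sym mk m0.
  have mk0n : m k0 != 0 by rewrite gt_eqF.
  (* The law of [l] does not depend on the label, so a word [w] seen with label [k] and a word [v]
     seen with label [k0] can share the same [l]: both predictors then aim at a common target. *)
  have [|||h [h0 hl hr]] := @glue R _ _ _ (fun w l => Q k l w / m k) (fun l w => Q k0 l w / m k0).
  - by move=> w l; rewrite divr_ge0.
  - by move=> l w; rewrite divr_ge0.
  - move=> l; rewrite -!mulr_suml !Qw ![m _ * _]mulrC !mulfK //.
  have [|||h' [h'0 h'l h'r h't h'c]] :=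
      @same_type_coupling (fun w v => \sum_l h w l v).
  - by move=> w v; apply: sumr_ge0.
  - move=> w; rewrite exchange_big /=; under eq_bigr do rewrite hl.
    by rewrite -mulr_suml Ql mulrAC divff ?mul1r.
  - move=> w; rewrite exchange_big /=; under eq_bigr do rewrite hr.
    by rewrite -mulr_suml Ql mulrAC divff ?mul1r.
  have [||||sg [sgi sgc]] := @type_preserving_bijection (fun w u => \sum_v h' w v u)
     (fun w u => ham R (L k w) (L k0 u)).
  - by move=> w u; apply: sumr_ge0.
  - move=> w; rewrite exchange_big /=; under eq_bigr do rewrite h'l.
    rewrite exchange_big /=; under eq_bigr do rewrite hl.
    by rewrite -mulr_suml Ql mulrAC divff ?mul1r.
  - by move=> u; rewrite h'r.
  - move=> w u; have [v hv|hv] := pickP (fun v => h' w v u != 0).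
      by move=> _; apply: h't hv.
    by rewrite big1 ?eqxx // => v _; apply/eqP; have := hv v => /negbFE.
  exists sg; split => //.
  have -> : c k + m k * (c k0 / m k0) + m k * D = m k * (c k / m k + c k0 / m k0 + D).
    by field; rewrite ?mk ?mk0n.
  rewrite ler_pM2l //; apply: le_trans sgc _.
  apply: (@le_trans _ _ (\sum_w \sum_v \sum_u h' w v u *
     (ham R (L k w) (L k0 v) + b * ham R v u))).
    apply: ler_sum => w _; rewrite exchange_big /=; apply: ler_sum => u _.
    rewrite mulr_suml; apply: ler_sum => v _; rewrite ler_wpM2l //.
    by apply: le_trans (ham_trans _ _ (L k0 v) _) _; rewrite lerD2l.
  have -> : \sum_w \sum_v \sum_u h' w v u * (ham R (L k w) (L k0 v) + b * ham R v u) =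
    \sum_w \sum_v (\sum_l h w l v) * ham R (L k w) (L k0 v) +
    b * (\sum_w \sum_v \sum_u h' w v u * ham R v u).
    rewrite mulr_sumr -big_split; apply: eq_bigr => w _ /=.
    rewrite mulr_sumr -big_split; apply: eq_bigr => v _ /=.
    rewrite -h'l mulr_suml mulr_sumr -big_split; apply: eq_bigr => u _ /=; ring.
  apply: lerD; last by rewrite /D ler_wpM2l.
  have -> : c k / m k = \sum_w \sum_v \sum_l h w l v * ham R (L k w) l.
    rewrite /c exchange_big mulr_suml; apply: eq_bigr => w _ /=.
    rewrite exchange_big /= mulr_suml; apply: eq_bigr => l _.
    by rewrite -mulr_suml hl hamC mulrAC.
  have -> : c k0 / m k0 = \sum_w \sum_v \sum_l h w l v * ham R l (L k0 v).
    rewrite [RHS]exchange_big /c [in LHS]exchange_big mulr_suml; apply: eq_bigr => v _ /=.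
    rewrite [RHS]exchange_big /= mulr_suml; apply: eq_bigr => l _.
    by rewrite -mulr_suml hr mulrAC.
  rewrite -big_split; apply: ler_sum => w _ /=.
  rewrite -big_split; apply: ler_sum => v _ /=.
  rewrite mulr_suml -big_split; apply: ler_sum => l _ /=.
  by rewrite -mulrDr (ler_wpM2l (h0 _ _ _)) // ham_trans.
have /choice[sg Hsg] := step.
exists k0, sg; split; first by move=> k; case: (Hsg k).
apply: (@le_trans _ _ (\sum_k (c k + m k * (c k0 / m k0) + m k * D))).
  by apply: ler_sum => k _; case: (Hsg k).
rewrite !big_split /= -!mulr_suml -/c.
have : (\sum_k m k) * (c k0 / m k0) <= \sum_k c k.
  by rewrite mulrA ler_pdivrMr // [leRHS]mulrC.
by rewrite -/(\sum_k c k); set S := \sum_k c k; set S' := (X in 2 * X); have -> : S' = S by []; lra.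
Qed.

End SameType.

Local Open Scope classical_set_scope.
Local Open Scope ring_scope.

(** * Sets of a probability space up to null sets *)

Section MeasureAlgebra.
Context (R : realType) (d : measure_display) (X : measurableType d)
        (P : probability X R).
Implicit Types A B C D : set X.
Implicit Types G : set (set X).

Definition pr A : R := fine (P A).

Lemma prE A : measurable A -> P A = (pr A)%:E.
Proof. by move=> mA; rewrite /pr fineK // fin_num_measure. Qed.

Lemma pr_ge0 A : 0 <= pr A.
Proof. by rewrite /pr fine_ge0. Qed.

Lemma pr_le A B : measurable A -> measurable B -> A `<=` B -> pr A <= pr B.
Proof.
by move=> mA mB AB; rewrite -lee_fin -!prE //; apply: le_measure; rewrite ?inE.
Qed.

Lemma pr_set0 : pr set0 = 0.
Proof. by rewrite /pr measure0. Qed.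

Lemma pr_setT : pr setT = 1.
Proof. by rewrite /pr probability_setT. Qed.

Lemma pr_le1 A : measurable A -> pr A <= 1.
Proof. by move=> mA; rewrite -pr_setT pr_le. Qed.

Lemma prU A B : measurable A -> measurable B -> A `&` B = set0 ->
  pr (A `|` B) = pr A + pr B.
Proof.
move=> mA mB AB; apply: EFin_inj; rewrite EFinD -!prE ?measureU //.
exact: measurableU.
Qed.

Lemma prDI A B : measurable A -> measurable B -> pr A = pr (A `\` B) + pr (A `&` B).
Proof.
move=> mA mB; rewrite -prU; [|exact: measurableD|exact: measurableI|].
  by rewrite setUC setUIDK.
by apply/seteqP; split=> x //= [[_ nB] [_ yB]].
Qed.

Lemma prC A : measurable A -> pr (~` A) = 1 - pr A.
Proof.
move=> mA; have := prDI measurableT mA; rewrite pr_setT setTI setTD; lra.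
Qed.

Lemma prU_le A B : measurable A -> measurable B -> pr (A `|` B) <= pr A + pr B.
Proof.
move=> mA mB; have -> : A `|` B = (A `\` B) `|` B by rewrite setUDl setDv setD0.
rewrite prU //; [|exact: measurableD|by rewrite setDKI].
by rewrite lerD2r pr_le //; exact: measurableD.
Qed.

Lemma pr_partition (F : finType) (f : X -> F) A : measurable A ->
  (forall v, measurable (f @^-1` [set v])) ->
  pr A = \sum_v pr (A `&` f @^-1` [set v]).
Proof.
move=> mA mf.
have H (s : seq F) : uniq s -> measurable (A `&` [set x | f x \in s]) /\
    pr (A `&` [set x | f x \in s]) = \sum_(v <- s) pr (A `&` f @^-1` [set v]).
  elim: s => [|v s IHs] /=.
    move=> _; have -> : A `&` [set x | f x \in [::]] = set0 by apply/seteqP; split=> x [].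
    by rewrite big_nil pr_set0.
  move=> /andP[vs /IHs[ms IH]].
  have -> : A `&` [set x | f x \in v :: s] =
    (A `&` f @^-1` [set v]) `|` (A `&` [set x | f x \in s]).
    apply/seteqP; split=> x /=; rewrite in_cons.
      by move=> [Ax /orP[/eqP|]]; [left|right].
    by move=> [[Ax ->]|[Ax ->]]; rewrite ?eqxx ?orbT.
  split; first by apply: measurableU => //; apply: measurableI.
  rewrite big_cons -IH prU //; first exact: measurableI.
  apply/seteqP; split=> x //= [[_ fx] [_]]; rewrite fx => vs'.
  by rewrite vs' in vs.
have [_ E] := H _ (enum_uniq F).
rewrite -big_enum /= -E; congr pr; rewrite -[LHS]setIT; congr (_ `&` _).
by apply/seteqP; split=> x //= _; rewrite mem_enum.
Qed.

Lemma pr_fin (F : finType) (f : X -> F) (p : pred F) :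
  (forall v, measurable (f @^-1` [set v])) ->
  measurable [set x | p (f x)] /\
  pr [set x | p (f x)] = \sum_(v | p v) pr (f @^-1` [set v]).
Proof.
move=> mf.
have mp : measurable [set x | p (f x)].
  have -> : [set x | p (f x)] = \bigcup_(v in [set v | p v]) f @^-1` [set v].
    by apply/seteqP; split=> x /= => [px|[v /= pv fx]]; [exists (f x)|rewrite fx].
  apply: fin_bigcup_measurable => //; exact: finite_finset.
split=> //; rewrite (pr_partition mp mf) [RHS]big_mkcond; apply: eq_bigr => v _.
case: ifPn => pv.
  congr pr; apply/seteqP; split=> x /=; [by case|by move=> fx; rewrite fx].
rewrite (_ : _ `&` _ = set0) ?pr_set0 //; apply/seteqP; split=> x //= [px fx].
by rewrite -fx px in pv.
Qed.

Definition dist A B : R := pr (A `+` B).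

Lemma measurableY A B : measurable A -> measurable B -> measurable (A `+` B).
Proof. by move=> mA mB; apply: measurableU; apply: measurableD. Qed.

Lemma distC A B : dist A B = dist B A. Proof. by rewrite /dist setYC. Qed.

Lemma distxx A : dist A A = 0.
Proof. by rewrite /dist setYK pr_set0. Qed.

Lemma dist_le (A B C D E F : set X) :
  measurable A -> measurable B -> measurable C -> measurable D ->
  measurable E -> measurable F ->
  (A `+` B `<=` (C `+` D) `|` (E `+` F)) -> dist A B <= dist C D + dist E F.
Proof.
move=> mA mB mC mD mE mF sub.
apply: le_trans (prU_le _ _); try exact: measurableY.
by apply: pr_le => //; [exact: measurableY|apply: measurableU; exact: measurableY].
Qed.

Lemma dist_trans A B C : measurable A -> measurable B -> measurable C ->
  dist A C <= dist A B + dist B C.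
Proof.
move=> mA mB mC; apply: dist_le => // x /=.
by case: (pselect (B x)) => Bx [[]|[]] *; tauto.
Qed.

Lemma distU A B C D : measurable A -> measurable B -> measurable C -> measurable D ->
  dist (A `|` B) (C `|` D) <= dist A C + dist B D.
Proof.
move=> mA mB mC mD; apply: dist_le => //; try exact: measurableU.
by move=> x /=; tauto.
Qed.

Lemma distI A B C D : measurable A -> measurable B -> measurable C -> measurable D ->
  dist (A `&` B) (C `&` D) <= dist A C + dist B D.
Proof.
move=> mA mB mC mD; apply: dist_le => //; try exact: measurableI.
by move=> x /= [[[? ?] /not_andP[]]|[[? ?] /not_andP[]]]; tauto.
Qed.

Lemma dist_setC A B : dist (~` A) (~` B) = dist A B.
Proof.
rewrite /dist; congr pr; apply/seteqP; split=> x /=.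
  by move=> [[? /contrapT ?]|[? /contrapT ?]]; tauto.
by move=> [[? ?]|[? ?]]; tauto.
Qed.

Lemma pr_dist A B : measurable A -> measurable B -> `|pr A - pr B| <= dist A B.
Proof.
move=> mA mB.
have H C D : measurable C -> measurable D -> pr C <= dist C D + pr D.
  move=> mC mD; apply: le_trans (prU_le (measurableY mC mD) mD).
  apply: pr_le => //; first by apply: measurableU => //; exact: measurableY.
  by move=> x Cx /=; case: (pselect (D x)); tauto.
have := H _ _ mA mB; have := H _ _ mB mA; rewrite [dist B A]distC ler_norml; lra.
Qed.

Lemma dist0P A B : measurable A -> measurable B -> dist A B = 0 <-> P (A `+` B) = 0%E.
Proof.
move=> mA mB; rewrite prE; last exact: measurableY.
by rewrite /dist; split=> [->|[->]].
Qed.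

Lemma pr_bigcup_approx (F : (set X)^nat) (e : R) : 0 < e ->
  (forall i, measurable (F i)) ->
  exists n, dist (\bigcup_i F i) (\big[setU/set0]_(i < n) F i) < e.
Proof.
move=> e0 mF; pose U n := \big[setU/set0]_(i < n.+1) F i.
have mU n : measurable (U n) by apply: bigsetU_measurable.
have mC : measurable (\bigcup_n U n) by exact: bigcupT_measurable.
have ndU : nondecreasing_seq U.
  by move=> m n mn; apply/subsetPset; exact: subset_bigsetU.
have E : \bigcup_n U n = \bigcup_i F i by exact: bigcup_bigsetU_bigcup.
have : P (U n) @[n --> \oo] --> P (\bigcup_n U n) by exact: nondecreasing_cvg_mu.
rewrite (prE mC).
have -> : (fun n => P (U n)) = EFin \o (pr \o U) by apply/funext => n /=; rewrite prE.
move=> /fine_cvgP[_ /=] /cvgrPdist_lt /(_ e e0) [N _ /(_ N (leqnn N)) /= H].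
exists N.+1; rewrite -/(U N) /dist -E.
have sub : U N `<=` \bigcup_n U n by exact: bigcup_sup.
have -> : \bigcup_n U n `+` U N = \bigcup_n U n `\` U N.
  have /eqP e0' : U N `\` \bigcup_n U n == set0 by apply/eqP; rewrite setD_eq0.
  by rewrite /setY e0' setU0.
have := prDI mC (mU N); rewrite (setIidr sub) => e1.
by move: H; rewrite e1 addrK ger0_norm ?pr_ge0.
Qed.

Lemma pr_union_le (I : finType) (A : I -> set X) B : measurable B ->
  (forall i, measurable (A i)) -> (forall x, B x -> exists i, A i x) ->
  pr B <= \sum_i pr (A i).
Proof.
move=> mB mA sub.
have H (s : seq I) : measurable [set x | exists2 i, i \in s & A i x] /\
    pr [set x | exists2 i, i \in s & A i x] <= \sum_(i <- s) pr (A i).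
  elim: s => [|i s [ms IHs]].
    have -> : [set x | exists2 i, i \in [::] & A i x] = set0.
      by apply/seteqP; split=> x //= -[].
    by rewrite big_nil pr_set0.
  have -> : [set x | exists2 j, j \in i :: s & A j x] =
     A i `|` [set x | exists2 j, j \in s & A j x].
    apply/seteqP; split=> x /=.
      by move=> [j]; rewrite in_cons => /orP[/eqP-> ?|js ?]; [left|right; exists j].
    move=> [Ax|[j js Ax]]; first by exists i => //; rewrite mem_head.
    by exists j => //; rewrite in_cons js orbT.
  split; first exact: measurableU.
  by rewrite big_cons; apply: le_trans (prU_le _ _) _ => //; rewrite lerD2l.
have [ms] := H (enum I); rewrite big_enum /=; apply: le_trans.
apply: pr_le => // x /sub[i Ax]; exists i => //.
by rewrite mem_enum.
Qed.

Lemma X_inhabited : exists x : X, True.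
Proof.
apply: contrapT => /forallNP H; have : pr setT = pr set0.
  by congr pr; apply/seteqP; split=> x //; have := H x.
by rewrite pr_setT pr_set0 => /eqP; rewrite oner_eq0.
Qed.

Definition is_alg G := [/\ G `<=` measurable, G setT, (forall A, G A -> G (~` A)) &
  forall A B, G A -> G B -> G (A `|` B)].

Lemma alg_setI G A B : is_alg G -> G A -> G B -> G (A `&` B).
Proof.
move=> [_ _ GC GU] GA GB; rewrite -[A `&` B]setCK setCI.
by apply/GC/GU; apply: GC.
Qed.

Lemma alg_set0 G : is_alg G -> G set0.
Proof. by move=> [_ GT GC _]; rewrite -setCT; apply: GC. Qed.

Lemma sub_sigma_alg G : sub_sigma G -> is_alg G.
Proof.
move=> [Gm [G0 GC GU]]; split=> //.
- by rewrite -(setD0 setT); apply: GC.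
- by move=> A GA; rewrite -setTD; apply: GC.
- by move=> A B GA GB; rewrite -bigcup2E; apply: GU => -[|[|n]] /=.
Qed.

Lemma measurable_alg : is_alg measurable.
Proof.
split=> //; first by move=> A; exact: measurableC.
by move=> A B; exact: measurableU.
Qed.

Definition fmeas (F : finType) G (f : X -> F) := forall v, G (f @^-1` [set v]).

Lemma alg_fin (F : finType) G (f : X -> F) (p : pred F) : is_alg G -> fmeas G f ->
  G [set x | p (f x)].
Proof.
move=> Ga Gf; have [_ _ _ GU] := Ga.
suff H (s : seq F) : G [set x | f x \in s].
  have -> : [set x | p (f x)] = [set x | f x \in enum p]; last exact: H.
  by apply/seteqP; split=> x /=; rewrite mem_enum.
elim: s => [|v s IHs].
  have -> : [set x | f x \in [::]] = set0 by apply/seteqP; split.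
  exact: alg_set0.
have -> : [set x | f x \in v :: s] = f @^-1` [set v] `|` [set x | f x \in s].
  apply/seteqP; split=> x /=; rewrite in_cons; first by case/orP=> [/eqP|]; [left|right].
  by move=> [->|->]; rewrite ?eqxx ?orbT.
exact: GU.
Qed.

Lemma fmeas_comp (F F' : finType) G (f : X -> F) (h : F -> F') : is_alg G ->
  fmeas G f -> fmeas G (h \o f).
Proof.
move=> Ga Gf v; have := @alg_fin F G f (fun u => h u == v) Ga Gf.
by congr G; apply/seteqP; split=> x /= /eqP.
Qed.

Lemma fmeas_pair (F F' : finType) G (f : X -> F) (g : X -> F') : is_alg G ->
  fmeas G f -> fmeas G g -> fmeas G (fun x => (f x, g x)).
Proof.
move=> Ga Gf Gg [u v]; have := alg_setI Ga (Gf u) (Gg v).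
by congr G; apply/seteqP; split=> x /= => [[-> ->]|[->]].
Qed.

Lemma alg_bigI G (I : eqType) (s : seq I) (A : I -> set X) : is_alg G ->
  (forall i, i \in s -> G (A i)) -> G [set x | forall i, i \in s -> A i x].
Proof.
move=> Ga; elim: s => [|i s IHs] GA.
  have -> : [set x | forall i, i \in [::] -> A i x] = setT by apply/seteqP; split.
  by case: Ga.
have -> : [set x | forall j, j \in i :: s -> A j x] =
   A i `&` [set x | forall j, j \in s -> A j x].
  apply/seteqP; split=> x /=.
    move=> H; split; first by apply: H; rewrite mem_head.
    by move=> j js; apply: H; rewrite in_cons js orbT.
  by move=> [Ax H] j; rewrite in_cons => /orP[/eqP->|/H].
apply: alg_setI => //; first by apply: GA; rewrite mem_head.
by apply: IHs => j js; apply: GA; rewrite in_cons js orbT.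
Qed.

Lemma fmeas_ffun (F I : finType) G (f : I -> X -> F) : is_alg G ->
  (forall i, fmeas G (f i)) -> fmeas G (fun x => [ffun i => f i x]).
Proof.
move=> Ga Gf v; have := @alg_bigI G I (enum I) (fun i => f i @^-1` [set v i]) Ga.
move=> /(_ (fun i _ => Gf i (v i))); congr G; apply/seteqP; split=> x /=.
  by move=> H; apply/ffunP=> i; rewrite ffunE; apply: H; rewrite mem_enum.
by move=> <- i _; rewrite ffunE.
Qed.

Lemma fmeas_bool G (A : set X) : is_alg G -> G A -> fmeas G (fun x => `[<A x>]).
Proof.
move=> Ga GA [].
  by have := GA; congr G; apply/seteqP; split=> x /= /asboolP.
have [_ _ GC _] := Ga; have := GC _ GA; congr G; apply/seteqP; split=> x /=.
  by move/asboolPn/negbTE.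
by move/negbT/asboolPn.
Qed.

Lemma fmeas_sub (F : finType) G G' (f : X -> F) : G `<=` G' -> fmeas G f -> fmeas G' f.
Proof. by move=> GG' Gf v; apply: GG'. Qed.

Lemma fmeas_determined (F : finType) G (f : X -> F) (A : set X) : is_alg G ->
  fmeas G f -> (forall x y, f x = f y -> A x -> A y) -> G A.
Proof.
move=> Ga Gf H; have := @alg_fin F G f (fun v => `[<exists2 x, A x & f x = v>]) Ga Gf.
congr G; apply/seteqP; split=> x /=.
  by move/asboolP => [y Ay /H]; apply.
by move=> Ax; apply/asboolP; exists x.
Qed.

(** The closure of [G] for the pseudometric [dist]. For an algebra [G] it is the completion of the
    generated sigma-algebra, obtained without generating anything. *)
Definition near G : set (set X) := [set A | measurable A /\
  forall e, 0 < e -> exists B, [/\ G B, measurable B & dist A B < e]].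

Lemma near_meas G : near G `<=` measurable.
Proof. by move=> A []. Qed.

Lemma near_sub G : G `<=` measurable -> G `<=` near G.
Proof.
move=> Gm A GA; split; first exact: Gm.
by move=> e e0; exists A; split=> //; [exact: Gm|rewrite distxx].
Qed.

Lemma near_mono G G' : G `<=` G' -> near G `<=` near G'.
Proof.
move=> GG A [mA H]; split=> // e e0; have [B [GB mB AB]] := H e e0.
by exists B; split=> //; apply: GG.
Qed.

Lemma near_idem G : near (near G) `<=` near G.
Proof.
move=> A [mA H]; split=> // e e0.
have e2 : 0 < e / 2 by lra.
have [B [[mB HB] _ AB]] := H _ e2; have [C [GC mC BC]] := HB _ e2.
exists C; split=> //; have := dist_trans mA mB mC; lra.
Qed.

(** A countable union is approximated by a finite one, so closure of [G] under finite unions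
    suffices. *)
Lemma near_sigma G : is_alg G -> sub_sigma (near G).
Proof.
move=> Ga; have [Gm GT GC GU] := Ga; split; first exact: near_meas.
split.
- by apply: near_sub => //; apply: alg_set0.
- move=> A [mA H]; rewrite setTD; split; first exact: measurableC.
  move=> e e0; have [B [GB mB AB]] := H e e0.
  by exists (~` B); split; [exact: GC|exact: measurableC|rewrite dist_setC].
- move=> F HF; have mF i : measurable (F i) by case: (HF i).
  have mFi : measurable (\bigcup_k F k) by exact: bigcupT_measurable.
  split=> // e e0.
  have e2 : 0 < e / 2 by lra.
  have [n Hn] := pr_bigcup_approx e2 mF.
  have en : 0 < e / 2 / n.+1%:R by rewrite divr_gt0.
  have /choice[D HD] : forall i, exists B, [/\ G B, measurable B & dist (F i) B < e / 2 / n.+1%:R].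
    by move=> i; case: (HF i) => _; apply.
  have GD i : G (D i) by case: (HD i).
  have mD i : measurable (D i) by case: (HD i).
  have FD i : dist (F i) (D i) <= e / 2 / n.+1%:R by case: (HD i) => _ _ /ltW.
  have mU k : measurable (\big[setU/set0]_(i < k) F i) by exact: bigsetU_measurable.
  have mUD k : measurable (\big[setU/set0]_(i < k) D i) by exact: bigsetU_measurable.
  exists (\big[setU/set0]_(i < n) D i); split=> //.
    by elim/big_rec: _ => [|i B _ GB]; [exact: alg_set0|exact: GU].
  have : forall k, dist (\big[setU/set0]_(i < k) F i) (\big[setU/set0]_(i < k) D i) <=
      k%:R * (e / 2 / n.+1%:R).
    elim=> [|k IHk]; first by rewrite !big_ord0 distxx mul0r.
    rewrite !big_ord_recr /=; apply: le_trans (distU (mU k) (mF k) (mUD k) (mD k)) _.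
    by rewrite -[k.+1%:R]natr1 mulrDl mul1r lerD.
  move=> /(_ n) Hk; apply: le_lt_trans (dist_trans mFi (mU n) (mUD n)) _.
  have : n%:R * (e / 2 / n.+1%:R) <= e / 2.
    rewrite mulrA ler_pdivrMr ?ltr0n // mulrC ler_pM2l //.
    by rewrite ler_nat.
  move=> /(le_trans Hk) {}Hk; move: Hn Hk; set u := dist _ _; set v := dist _ _; lra.
Qed.

Lemma near_alg G : is_alg G -> is_alg (near G).
Proof. by move=> /near_sigma/sub_sigma_alg. Qed.

Lemma gen_sub G G' : sub_sigma G' -> G `<=` G' -> <<s G >> `<=` G'.
Proof. by move=> [_ sB] GB; apply: smallest_sub. Qed.

Lemma gen_sub_sigma G : G `<=` measurable -> sub_sigma <<s G >>.
Proof.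
move=> Gm; split; last exact: smallest_sigma_algebra.
by apply: smallest_sub => //; exact: sigma_algebra_measurable.
Qed.

Lemma borel_cantelli (F : (set X)^nat) : (forall k, measurable (F k)) ->
  (forall k, pr (F k) <= 2^-1 ^+ k) -> P (lim_sup_set F) = 0%E.
Proof.
move=> mF Fk; apply: lim_sup_set_cvg0 => //.
apply: le_lt_trans (ltry (2%:R : R)).
apply: le_trans (@epsilon_trick0 R 2%:R xpredT (ler0n R 2)).
apply: lee_nneseries => // n _.
suff : (P (F n) <= (2%:R / (2 ^ n.+1)%:R)%:E)%E by [].
rewrite prE // lee_fin; apply: le_trans (Fk n) _.
by rewrite natrX exprS exprVn invfM mulrA divff // mul1r.
Qed.

(** The limsup of approximations with summable errors stays in [B], and by Borel-Cantelli it differs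
    from [A] by a null set. *)
Lemma near_complete (B : set (set X)) A : sub_sigma B -> near B A ->
  exists A', B A' /\ P (A `+` A') = 0%E.
Proof.
move=> sB [mA H]; have [Bm [B0 BC BU]] := sB.
have /choice[D HD] : forall k : nat, exists D, [/\ B D, measurable D & dist A D < 2^-1 ^+ k].
  by move=> k; apply: H; rewrite exprn_gt0 // invr_gt0.
have BD k : B (D k) by case: (HD k).
have BsU n : B (\bigcup_(j >= n) D j).
  have -> : (\bigcup_(i in [set j | (n <= j)%N]) D i) = \bigcup_i D (n + i)%N.
    apply/seteqP; split=> x [i /= ni Dx]; last by exists (n + i)%N => //=; rewrite leq_addr.
    by exists (i - n)%N => //; rewrite subnKC.
  by apply: BU.
have BI (F : nat -> set X) : (forall n, B (F n)) -> B (\bigcap_n F n).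
  move=> BF; rewrite -[\bigcap_n F n]setCK setC_bigcap -setTD; apply: (BC).
  by apply: BU => n; rewrite -setTD; apply: BC.
have BL : B (lim_sup_set D) by exact: BI.
exists (lim_sup_set D); split=> //.
have mY k : measurable (A `+` D k) by apply: measurableY => //; apply: Bm.
have := borel_cantelli mY (fun k => ltW (let: And3 _ _ h := HD k in h)).
have mL : measurable (A `+` lim_sup_set D) by apply: measurableY => //; apply: Bm.
move=> h0; apply/eqP; rewrite -measure_le0 -h0; apply: le_measure; rewrite ?inE //.
  apply: bigcapT_measurable => n; exact: bigcup_measurable.
move=> x /= [[Ax nL]|[Lx nA]] n _.
  move/existsNP: nL => [m /not_implyP[_ nm]].
  exists (maxn n m); rewrite /= ?leq_maxl //; left; split=> // Dx.
  by apply: nm; exists (maxn n m) => //=; rewrite leq_maxr.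
by have [k nk Dk] := Lx n I; exists k => //; right.
Qed.

Lemma approx_fun (F : finType) G (f : X -> F) (e : R) : is_alg G -> 0 < e ->
  fmeas (near G) f ->
  exists g : X -> F, fmeas G g /\ pr [set x | f x != g x] < e.
Proof.
move=> Ga e0 Gf; have [x0 _] := X_inhabited; have [Gm _ _ _] := Ga.
have nF : (0 < #|F|)%N by apply/card_gt0P; exists (f x0).
have eF : 0 < e / #|F|.+1%:R by rewrite divr_gt0.
have /choice[D HD] : forall v, exists B,
    [/\ G B, measurable B & dist (f @^-1` [set v]) B < e / #|F|.+1%:R].
  by move=> v; case: (Gf v) => _; apply.
(* Decode by any value whose approximate level set contains the point. A wrong answer at [x] puts
   [x] in the symmetric difference of some level set with its approximation. *)
pose h (b : {ffun F -> bool}) := odflt (f x0) [pick v | b v].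
have Gb : fmeas G (fun x => [ffun v => `[<D v x>]]).
  by apply: fmeas_ffun => // v; apply: fmeas_bool => //; case: (HD v).
exists (fun x => h [ffun v => `[<D v x>]]); split; first exact: (fmeas_comp h Ga Gb).
have Gn : is_alg (near G) := near_alg Ga.
have mS : measurable [set x | f x != h [ffun v => `[<D v x>]]].
  apply: (@near_meas G); apply: (@alg_fin _ _ (fun x => (f x, [ffun v => `[<D v x>]]))
    (fun p => p.1 != h p.2)) => //; apply: fmeas_pair => //.
  by apply: fmeas_sub Gb; exact: near_sub.
have mf v : measurable (f @^-1` [set v]) by case: (Gf v).
have mD v : measurable (D v) by case: (HD v).
have := @pr_union_le F (fun v => f @^-1` [set v] `+` D v) _ mS (fun v => measurableY (mf v) (mD v)).
move=> /(_ _)/wrap[]; last first.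
  move=> le; apply: le_lt_trans le _.
  apply: (@le_lt_trans _ _ (\sum_(v : F) (e / #|F|.+1%:R))).
    by apply: ler_sum => v _; case: (HD v) => _ _ /ltW.
  rewrite sumr_const -[_ *+ _]mulr_natr mulrAC ltr_pdivrMr ?ltr0n // ltr_pM2l //.
  by rewrite ltr_nat.
move=> x /=; rewrite /h; case: pickP => [v|/(_ (f x))] /=; rewrite ffunE.
  by move/asboolP => Dv; move/eqP => fv; exists v; right.
by move/negbT/asboolPn => nD _; exists (f x); left.
Qed.

Definition indep (G H : set (set X)) := forall A B, G A -> H B -> pr (A `&` B) = pr A * pr B.

Lemma indep_dist A B A' B' : measurable A -> measurable B -> measurable A' ->
  measurable B' -> pr (A' `&` B') = pr A' * pr B' ->
  `|pr (A `&` B) - pr A * pr B| <= 2 * (dist A A' + dist B B').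
Proof.
move=> mA mB mA' mB' E.
have h1 := pr_dist (measurableI _ _ mA mB) (measurableI _ _ mA' mB').
have h2 := distI mA mB mA' mB'.
have hA := pr_dist mA mA'; have hB := pr_dist mB mB'.
have a0 := pr_ge0 A; have a1 := pr_le1 mA; have b0 := pr_ge0 B'; have b1 := pr_le1 mB'.
have -> : pr (A `&` B) - pr A * pr B = (pr (A `&` B) - pr (A' `&` B')) +
   ((pr A' - pr A) * pr B' + pr A * (pr B' - pr B)) by rewrite E; ring.
apply: le_trans (ler_normD _ _) _; apply: (@le_trans _ _ (dist A A' + dist B B' + (dist A A' +
  dist B B'))).
  apply: lerD; first by apply: le_trans h1 h2.
  apply: le_trans (ler_normD _ _) _; rewrite !normrM; apply: lerD.
    rewrite distrC (ger0_norm b0) -[leRHS]mulr1; apply: ler_pM => //.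
  rewrite [`|pr B' - _|]distrC (ger0_norm a0) -[leRHS]mul1r; apply: ler_pM => //.
lra.
Qed.

Lemma indep_near (G H : set (set X)) : indep G H -> indep (near G) (near H).
Proof.
move=> iGH A B [mA HA] [mB HB]; apply/eqP; rewrite -subr_eq0 -normr_le0.
apply/ler_addgt0Pr => e e0; rewrite add0r.
have e4 : 0 < e / 4 by lra.
have [A' [GA' mA' AA']] := HA _ e4; have [B' [HB' mB' BB']] := HB _ e4.
have := indep_dist mA mB mA' mB' (iGH _ _ GA' HB'); lra.
Qed.

End MeasureAlgebra.

(** * Entropy of finite-valued functions *)

Section Entropy.
Context (R : realType) (d : measure_display) (X : measurableType d)
        (P : probability X R).
Local Notation pr := (pr P).

Definition pmf (F : finType) (f : X -> F) (v : F) : R := pr (f @^-1` [set v]).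

Definition entropy (F : finType) (f : X -> F) : R := - \sum_v pmf f v * ln (pmf f v).

Local Notation mfun f := (fmeas measurable f).

Lemma pmf_ge0 (F : finType) (f : X -> F) v : 0 <= pmf f v.
Proof. exact: pr_ge0. Qed.

Lemma factor_through (F G : Type) (g : X -> G) (f : X -> F) :
  (forall x y, g x = g y -> f x = f y) -> exists h : G -> F, forall x, f x = h (g x).
Proof.
move=> fg; have [x0 _] := X_inhabited P.
have /choice[h Hh] : forall v, exists u, forall x, g x = v -> f x = u.
  move=> v; case: (pselect (exists x, g x = v)) => [[x <-]|H].
    by exists (f x) => y /fg.
  by exists (f x0) => x gx; case: H; exists x.
by exists h => x; apply: Hh.
Qed.

Lemma pmf_comp (F G : finType) (g : X -> G) (h : G -> F) u : mfun g ->
  pmf (h \o g) u = \sum_(v | h v == u) pmf g v.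
Proof.
move=> mg; have [_ <-] := pr_fin P (fun v => h v == u) mg.
by congr pr; apply/seteqP; split=> x /= /eqP.
Qed.

Lemma sum_pmf (F : finType) (f : X -> F) : mfun f -> \sum_v pmf f v = 1.
Proof.
move=> mf; rewrite -(pr_setT P) (pr_partition P measurableT mf).
by apply: eq_bigr => v _; rewrite setTI.
Qed.

(** Entropies of several functions of one [g] become sums over the law of [g], to be combined term
    by term. *)
Lemma entropy_lift (F G : finType) (g : X -> G) (h : G -> F) : mfun g ->
  entropy (h \o g) = - \sum_v pmf g v * ln (pmf (h \o g) (h v)).
Proof.
move=> mg; congr (- _).
rewrite [RHS](partition_big h xpredT) //=; apply: eq_bigr => u _.
rewrite {1}pmf_comp // mulr_suml; by apply: eq_bigr => v /eqP <-.
Qed.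

Lemma entropy_mono (F G : finType) (f : X -> F) (g : X -> G) : mfun g ->
  (forall x y, g x = g y -> f x = f y) -> entropy f <= entropy g.
Proof.
move=> mg /factor_through[h Hh]; have -> : f = h \o g by apply/funext.
rewrite entropy_lift // lerN2; apply: ler_sum => v _.
have [->|vn] := eqVneq (pmf g v) 0; first by rewrite !mul0r.
have vp : 0 < pmf g v by rewrite lt_neqAle eq_sym vn pmf_ge0.
have le : pmf g v <= pmf (h \o g) (h v).
  rewrite pmf_comp // (bigD1 v) //= lerDl; apply: sumr_ge0 => *; exact: pmf_ge0.
by rewrite ler_pM2l // ler_ln ?posrE // (lt_le_trans vp).
Qed.

Lemma entropy_eq (F G : finType) (f : X -> F) (g : X -> G) : mfun f -> mfun g ->
  (forall x y, g x = g y <-> f x = f y) -> entropy f = entropy g.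
Proof.
move=> mf mg fg; apply/le_anti/andP; split; apply: entropy_mono => // x y; by case: (fg x y).
Qed.

Lemma entropy_ge0 (F : finType) (f : X -> F) : mfun f -> 0 <= entropy f.
Proof.
move=> mf; rewrite /entropy -sumrN sumr_ge0 // => v _; rewrite -mulrN.
by rewrite mulr_ge0 ?pmf_ge0 // oppr_ge0 ln_le0 // pr_le1.
Qed.

Lemma mfun_pair (F G : finType) (f : X -> F) (g : X -> G) : mfun f -> mfun g ->
  mfun (fun x => (f x, g x)).
Proof. by move=> mf mg; apply: fmeas_pair => //; exact: measurable_alg. Qed.

Lemma entropy_kl (F G : finType) (f : X -> F) (g : X -> G) : mfun f -> mfun g ->
  let q (t : F * G) := pmf (fun x => (f x, g x)) t in
  let m (t : F * G) := pmf f t.1 * pmf g t.2 in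
  [/\ forall t, 0 <= m t, forall t, m t = 0 -> q t = 0, \sum_t m t = 1 &
    entropy f + entropy g - entropy (fun x => (f x, g x)) = \sum_t q t * ln (q t / m t)].
Proof.
move=> mf mg q m; have mfg := mfun_pair mf mg.
have qf t : q t <= pmf f t.1 by apply: (pr_le P (mfg t) (mf t.1)) => x /= <-.
have qg t : q t <= pmf g t.2 by apply: (pr_le P (mfg t) (mg t.2)) => x /= <-.
have q0 t : 0 <= q t by exact: pmf_ge0.
split.
- by move=> t; rewrite mulr_ge0 ?pmf_ge0.
- move=> t /eqP; rewrite mulf_eq0 => /orP[] /eqP h; apply/le_anti; rewrite q0 andbT -h //.
- rewrite -(pair_big xpredT xpredT (fun u v => pmf f u * pmf g v)) /=.
  under eq_bigr do rewrite -mulr_sumr sum_pmf // mulr1.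
  exact: sum_pmf.
have -> : entropy f = - \sum_t q t * ln (pmf f t.1).
  exact: (entropy_lift fst mfg).
have -> : entropy g = - \sum_t q t * ln (pmf g t.2).
  exact: (entropy_lift snd mfg).
rewrite /entropy opprK -!sumrN -!big_split; apply: eq_bigr => t _ /=; rewrite -/(q t).
have [->|qn] := eqVneq (q t) 0; first by rewrite !mul0r; ring.
have qp : 0 < q t by rewrite lt_neqAle eq_sym qn q0.
have fp : 0 < pmf f t.1 by apply: lt_le_trans (qf t).
have gp : 0 < pmf g t.2 by apply: lt_le_trans (qg t).
by rewrite /m ln_div ?posrE ?mulr_gt0 // lnM ?posrE //; ring.
Qed.

Lemma entropy_pair_le (F G : finType) (f : X -> F) (g : X -> G) : mfun f -> mfun g ->
  entropy (fun x => (f x, g x)) <= entropy f + entropy g.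
Proof.
move=> mf mg; rewrite -subr_ge0; have [m0 mq m1 ->] := entropy_kl mf mg.
have mfg := mfun_pair mf mg.
apply: (@le_trans _ _ (\sum_t (pmf (fun x => (f x, g x)) t - pmf f t.1 * pmf g t.2))).
  by rewrite sumrB sum_pmf // m1 subrr.
apply: ler_sum => t _; apply: kl_term_ge; [exact: pmf_ge0|exact: m0|exact: mq].
Qed.

Lemma entropy_indep (F G : finType) (f : X -> F) (g : X -> G) : mfun f -> mfun g ->
  (forall u v, pmf (fun x => (f x, g x)) (u, v) = pmf f u * pmf g v) ->
  entropy (fun x => (f x, g x)) = entropy f + entropy g.
Proof.
move=> mf mg ind; apply/eqP; rewrite eq_sym -subr_eq0; apply/eqP.
have [m0 mq m1 ->] := entropy_kl mf mg; apply: big1 => -[u v] _ /=; rewrite ind.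
have [->|n0] := eqVneq (pmf f u * pmf g v) 0; first by rewrite mul0r.
by rewrite divff // ln1 mulr0.
Qed.

(** The equality case of subadditivity: once the divergence is not positive, [sum_abs_le_kl] bounds
    the distance from the product law by every [t > 0]. *)
Lemma indep_of_entropy (F G : finType) (f : X -> F) (g : X -> G) : mfun f -> mfun g ->
  entropy f + entropy g <= entropy (fun x => (f x, g x)) ->
  forall u v, pmf (fun x => (f x, g x)) (u, v) = pmf f u * pmf g v.
Proof.
move=> mf mg; rewrite -subr_le0; have [m0 mq m1 ->] := entropy_kl mf mg.
set k := \sum_t _ => k0 u v; have mfg := mfun_pair mf mg.
apply/eqP; rewrite -subr_eq0 -normr_le0; apply/ler_addgt0Pr => t t0; rewrite add0r.
have := sum_abs_le_kl t0 (@pmf_ge0 _ (fun x => (f x, g x))) m0 mq (sum_pmf mfg) m1.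
rewrite -/k (bigD1 (u, v)) //= => h; apply: le_trans (le_trans _ h) _.
  by rewrite lerDl sumr_ge0.
by rewrite gerDr mulr_ge0_le0 // invr_ge0 ltW.
Qed.

(** The difference of the two sides is the divergence of the joint law from [m], the law that makes
    [f] and [k] conditionally independent given [g]. *)
Lemma entropy_submodular (F G K : finType) (f : X -> F) (g : X -> G) (k : X -> K) :
  mfun f -> mfun g -> mfun k ->
  entropy (fun x => (f x, (g x, k x))) + entropy g <=
  entropy (fun x => (f x, g x)) + entropy (fun x => (g x, k x)).
Proof.
move=> mf mg mk; have mgk := mfun_pair mg mk; have mfg := mfun_pair mf mg.
have ma := mfun_pair mf mgk.
pose q (t : F * (G * K)) := pmf (fun x => (f x, (g x, k x))) t.
pose qfg (t : F * (G * K)) := pmf (fun x => (f x, g x)) (t.1, t.2.1).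
pose qgk (t : F * (G * K)) := pmf (fun x => (g x, k x)) t.2.
pose qg (t : F * (G * K)) := pmf g t.2.1.
have q0 t : 0 <= q t by exact: pmf_ge0.
pose m t := qfg t * qgk t / qg t.
have m0 t : 0 <= m t by rewrite !mulr_ge0 ?invr_ge0 ?pmf_ge0.
have q1 t : q t <= qfg t by apply: (pr_le P (ma t) (mfg _)) => x /= <-.
have q2 t : q t <= qgk t by apply: (pr_le P (ma t) (mgk _)) => x /= <-.
have q3 t : q t <= qg t by apply: (pr_le P (ma t) (mg _)) => x /= <-.
have mq t : m t = 0 -> q t = 0.
  move/eqP; rewrite mulf_eq0 invr_eq0 mulf_eq0 => h; apply/le_anti; rewrite q0 andbT.
  by case/orP: h => [/orP[]|] /eqP <-.
have m1 : \sum_t m t = 1.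
  transitivity (\sum_v \sum_w \sum_u m (u, (v, w))).
    rewrite pair_big /= exchange_big /= pair_big /=.
    by apply: eq_bigr => -[u [v w]] _.
  rewrite -(sum_pmf mg); apply: eq_bigr => v _; rewrite /m /qfg /qgk /qg /=.
  transitivity ((\sum_u pmf (fun x => (f x, g x)) (u, v)) *
     (\sum_w pmf (fun x => (g x, k x)) (v, w)) / pmf g v).
    rewrite mulrAC mulr_sumr; apply: eq_bigr => w _.
    by rewrite !mulr_suml; apply: eq_bigr => u _; rewrite mulrAC.
  have -> : \sum_u pmf (fun x => (f x, g x)) (u, v) = pmf g v.
    rewrite {2}/pmf (pr_partition P (mg v) mf); apply: eq_bigr => u _.
    by congr pr; apply/seteqP; split=> x /= => [[-> ->]|[-> ->]].
  have -> : \sum_w pmf (fun x => (g x, k x)) (v, w) = pmf g v.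
    rewrite {2}/pmf (pr_partition P (mg v) mk); apply: eq_bigr => u _.
    by congr pr; apply/seteqP; split=> x /= => [[-> ->]|[-> ->]].
  have [->|vn] := eqVneq (pmf g v) 0; first by rewrite !mul0r.
  by rewrite mulfK.
have -> : entropy g = - \sum_t q t * ln (qg t).
  exact: (entropy_lift (fun t => t.2.1) ma).
have -> : entropy (fun x => (f x, g x)) = - \sum_t q t * ln (qfg t).
  exact: (entropy_lift (fun t => (t.1, t.2.1)) ma).
have -> : entropy (fun x => (g x, k x)) = - \sum_t q t * ln (qgk t).
  exact: (entropy_lift snd ma).
rewrite -subr_ge0.
have -> : - (\sum_t q t * ln (qfg t)) - \sum_t q t * ln (qgk t) -
   (entropy (fun x => (f x, (g x, k x))) - \sum_t q t * ln (qg t)) =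
   \sum_t q t * ln (q t / m t).
  rewrite /entropy -!sumrN opprD -!sumrN -!big_split; apply: eq_bigr => t _ /=; rewrite -/(q t).
  have [->|qn] := eqVneq (q t) 0; first by rewrite !mul0r; ring.
  have qp : 0 < q t by rewrite lt_neqAle eq_sym qn q0.
  have p1 := lt_le_trans qp (q1 t); have p2 := lt_le_trans qp (q2 t).
  have p3 := lt_le_trans qp (q3 t).
  by rewrite /m !ln_div ?posrE ?divr_gt0 ?mulr_gt0 // lnM ?posrE //; ring.
apply: (@le_trans _ _ (\sum_t (q t - m t))); first by rewrite sumrB m1 sum_pmf // subrr.
by apply: ler_sum => t _; apply: kl_term_ge => //; apply: mq.
Qed.

Lemma pmf_indep_sets (F G : finType) (f : X -> F) (g : X -> G) (p : pred F) (q : pred G) :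
  mfun f -> mfun g ->
  (forall u v, pmf (fun x => (f x, g x)) (u, v) = pmf f u * pmf g v) ->
  pr ([set x | p (f x)] `&` [set x | q (g x)]) = pr [set x | p (f x)] * pr [set x | q (g x)].
Proof.
move=> mf mg ind; have mfg := mfun_pair mf mg.
have [_ ->] := pr_fin P p mf; have [_ ->] := pr_fin P q mg.
have -> : [set x | p (f x)] `&` [set x | q (g x)] =
  [set x | (fun t : F * G => p t.1 && q t.2) (f x, g x)].
  by apply/seteqP; split=> x /= => [[-> ->]|/andP].
have [_ ->] := pr_fin P (fun t : F * G => p t.1 && q t.2) mfg.
rewrite big_distrlr /= pair_big /=.
by apply: eq_bigr => -[u v] _; rewrite -ind.
Qed.

End Entropy.

(** * Factors and words *)

Section Dynamics.
Context (R : realType) (d : measure_display) (X : measurableType d)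
        (P : probability X R) (T Tinv : X -> X).
Hypothesis hT : invertible_mp P T Tinv.
Local Notation pr := (pr P).
Local Notation mfun f := (fmeas measurable f).
Local Notation Tz := (iterz T Tinv).

Lemma TK : cancel T Tinv. Proof. by case: hT. Qed.
Lemma TVK : cancel Tinv T. Proof. by case: hT. Qed.

Lemma measurable_preT A : measurable A -> measurable (T @^-1` A).
Proof. by move=> mA; rewrite -[_ @^-1` _]setTI; case: hT => mT _ _ _ _; exact: mT. Qed.

Lemma measurable_preTV A : measurable A -> measurable (Tinv @^-1` A).
Proof. by move=> mA; rewrite -[_ @^-1` _]setTI; case: hT => _ mT _ _ _; exact: mT. Qed.

Lemma pr_preT A : measurable A -> pr (T @^-1` A) = pr A.
Proof. by move=> mA; rewrite /pr; case: hT => _ _ _ _ ->. Qed.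

Lemma preTK A : Tinv @^-1` (T @^-1` A) = A.
Proof. by apply/seteqP; split=> x /=; rewrite TVK. Qed.

Lemma preTVK A : T @^-1` (Tinv @^-1` A) = A.
Proof. by apply/seteqP; split=> x /=; rewrite TK. Qed.

Lemma pr_preTV A : measurable A -> pr (Tinv @^-1` A) = pr A.
Proof. by move=> mA; rewrite -pr_preT ?preTVK //; exact: measurable_preTV. Qed.

Lemma dist_preT A B : measurable A -> measurable B ->
  dist P (T @^-1` A) (T @^-1` B) = dist P A B.
Proof. by move=> mA mB; rewrite /dist -(pr_preT (measurableY mA mB)). Qed.

Lemma dist_preTV A B : measurable A -> measurable B ->
  dist P (Tinv @^-1` A) (Tinv @^-1` B) = dist P A B.
Proof. by move=> mA mB; rewrite /dist -(pr_preTV (measurableY mA mB)). Qed.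

(** The complete and exactly invariant version of a factor; [factor_cfactor] shows that completing a
    factor yields one. *)
Definition cfactor (B : set (set X)) := [/\ sub_sigma B, near P B `<=` B,
  (forall A, B A -> B (T @^-1` A)) & (forall A, B A -> B (Tinv @^-1` A))].

Lemma cfactor_meas B : cfactor B -> B `<=` measurable.
Proof. by case=> -[]. Qed.

Lemma cfactor_alg B : cfactor B -> is_alg B.
Proof. by case=> /sub_sigma_alg. Qed.

Lemma measurable_cfactor : cfactor measurable.
Proof.
split.
- by split=> //; exact: sigma_algebra_measurable.
- exact: near_meas.
- exact: measurable_preT.
- exact: measurable_preTV.
Qed.

(* The completion of an algebra which is invariant up to null sets is an exactly
   invariant sigma-algebra. *)
Lemma near_cfactor G : is_alg G ->
  (forall A, G A -> near P G (T @^-1` A)) -> (forall A, G A -> near P G (Tinv @^-1` A)) ->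
  cfactor (near P G).
Proof.
move=> Ga GT GTV; have [Gm _ _ _] := Ga.
split; [exact: near_sigma|exact: near_idem| |].
- move=> A [mA H]; apply: near_idem; split; first exact: measurable_preT.
  move=> e e0; have [B [GB mB AB]] := H e e0.
  by exists (T @^-1` B); split; [exact: GT|exact: measurable_preT|rewrite dist_preT].
- move=> A [mA H]; apply: near_idem; split; first exact: measurable_preTV.
  move=> e e0; have [B [GB mB AB]] := H e e0.
  by exists (Tinv @^-1` B); split; [exact: GTV|exact: measurable_preTV|rewrite dist_preTV].
Qed.

Lemma subset_mod_near (B C : set (set X)) : B `<=` measurable -> C `<=` measurable ->
  subset_mod P B C -> B `<=` near P C.
Proof.
move=> Bm Cm BC A BA; have mA := Bm _ BA; split=> // e e0.
have [A' [CA' A0]] := BC A BA; exists A'; have mA' := Cm _ CA'; split=> //.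
by rewrite (dist0P P mA mA').2.
Qed.

Lemma factor_cfactor B : Defs.factor P T B -> cfactor (near P B).
Proof.
move=> [sB [TB BT]]; have Ba := sub_sigma_alg sB; have [Bm _ _ _] := Ba.
have Tm : [set T @^-1` A | A in B] `<=` measurable.
  by move=> _ [A BA <-]; apply/measurable_preT/Bm.
apply: near_cfactor => //.
  move=> A BA; have := subset_mod_near Tm Bm TB; apply; by exists A.
move=> A BA; have mA := Bm _ BA; split; first exact: measurable_preTV.
have [_ [[C BC <-] A0]] := BT A BA; move=> e e0; exists C; split=> //; first exact: Bm.
have mC := Bm _ BC; have mTC := measurable_preT mC.
by rewrite -[C]preTK dist_preTV // (dist0P P mA mTC).2.
Qed.

Lemma TzS (z : int) x : Tz (1 + z) x = T (Tz z x).
Proof.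
case: z => [n|[|n]] //; first by rewrite /= TVK.
have -> : 1 + Negz n.+1 = Negz n by lia.
by rewrite [RHS]/= TVK.
Qed.

Lemma TzP (z : int) x : Tz (z - 1) x = Tinv (Tz z x).
Proof. by rewrite -{2}[z](subrK 1) [z - 1 + 1]addrC TzS TK. Qed.

Lemma TzD (y z : int) x : Tz (y + z) x = Tz y (Tz z x).
Proof.
elim: y x => [|n IHn|n IHn] x; first by rewrite add0r.
  by rewrite -add1n PoszD -addrA !TzS IHn.
have -> : - n.+1%:Z = - n%:Z - 1 by lia.
by rewrite addrAC !TzP IHn.
Qed.

Lemma Tz_nat n x : Tz n%:Z x = iter n T x. Proof. by []. Qed.

Lemma TzK z : cancel (Tz z) (Tz (- z)).
Proof. by move=> x; rewrite -TzD addNr. Qed.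

Lemma TzNK z : cancel (Tz (- z)) (Tz z).
Proof. by move=> x; rewrite -TzD subrr. Qed.

Lemma Tz_ind (Q : set X -> Prop) : (forall A, Q A -> Q (T @^-1` A)) ->
  (forall A, Q A -> Q (Tinv @^-1` A)) -> forall z A, Q A -> Q (Tz z @^-1` A).
Proof.
move=> QT QTV; elim=> [|n IHn|n IHn] A QA //.
  have -> : Tz n.+1 @^-1` A = T @^-1` (Tz n @^-1` A).
    by apply/seteqP; split=> x /=; rewrite -iterSr.
  by apply/QT/IHn.
have -> : Tz (- n.+1%:Z) @^-1` A = Tinv @^-1` (Tz (- n%:Z) @^-1` A).
  have E x : Tz (- n.+1%:Z) x = Tz (- n%:Z) (Tinv x).
    have -> : - n.+1%:Z = - n%:Z + -1 by lia.
    by rewrite TzD.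
  by apply/seteqP; split=> x; rewrite /preimage /mkset E.
by apply/QTV/IHn.
Qed.

Lemma measurable_preTz z A : measurable A -> measurable (Tz z @^-1` A).
Proof. apply: (Tz_ind (Q := measurable)); [exact: measurable_preT|exact: measurable_preTV]. Qed.

Lemma pr_preTz z A : measurable A -> pr (Tz z @^-1` A) = pr A.
Proof.
move=> mA; suff [] : measurable (Tz z @^-1` A) /\ pr (Tz z @^-1` A) = pr A by [].
apply: (Tz_ind (Q := fun B => measurable B /\ pr B = pr A)) => // B [mB <-].
  by split; [exact: measurable_preT|rewrite pr_preT].
by split; [exact: measurable_preTV|rewrite pr_preTV].
Qed.

Lemma cfactor_preTz B z A : cfactor B -> B A -> B (Tz z @^-1` A).
Proof. by case=> _ _ BT BTV; apply: Tz_ind. Qed.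

Lemma fmeas_Tz (F : finType) B z (f : X -> F) : cfactor B -> fmeas B f -> fmeas B (f \o Tz z).
Proof. by move=> cB Bf v; apply: (cfactor_preTz z cB (Bf v)). Qed.

Lemma mfun_Tz (F : finType) z (f : X -> F) : mfun f -> mfun (f \o Tz z).
Proof. by move=> mf; apply: fmeas_Tz => //; exact: measurable_cfactor. Qed.

Definition word (F : finType) N (f : X -> F) (x : X) : {ffun 'I_N -> F} :=
  [ffun i : 'I_N => f (iter i T x)].

Lemma fmeas_word (F : finType) B N (f : X -> F) : cfactor B -> fmeas B f -> fmeas B (word N f).
Proof.
move=> cB Bf; apply: fmeas_ffun; first exact: cfactor_alg.
by move=> i; apply: (fmeas_Tz i%:Z cB Bf).
Qed.

Lemma mfun_word (F : finType) N (f : X -> F) : mfun f -> mfun (word N f).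
Proof. by move=> mf; apply: fmeas_word => //; exact: measurable_cfactor. Qed.

Lemma word_eq (F : finType) N (f : X -> F) x y :
  word N f x = word N f y <-> forall i, (i < N)%N -> f (iter i T x) = f (iter i T y).
Proof.
split=> [/ffunP H i iN|H]; last by apply/ffunP=> i; rewrite !ffunE H.
by have := H (Ordinal iN); rewrite !ffunE.
Qed.

Lemma word_preE (F : finType) N (f : X -> F) (w : {ffun 'I_N -> F}) x :
  word N f x = w <-> forall i : 'I_N, f (iter i T x) = w i.
Proof.
split=> [<- i|H]; first by rewrite ffunE.
by apply/ffunP=> i; rewrite ffunE.
Qed.

(** Independence of the coordinates from each other and from [B] in one formula: [A = setT] gives
    the former. Words start at time 0; for an invariant [B] the other times follow by
    translation. *)
Definition iid_over (F : finType) (B : set (set X)) (a : X -> F) :=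
  forall N (w : {ffun 'I_N -> F}) A, B A ->
    pr (A `&` word N a @^-1` [set w]) = pr A * \prod_i pmf P a (w i).

Lemma pmf_Tz (F : finType) (f : X -> F) z v : mfun f -> pmf P (f \o Tz z) v = pmf P f v.
Proof. by move=> mf; rewrite /pmf -(pr_preTz z (mf v)). Qed.

Lemma entropy_Tz (F : finType) (f : X -> F) z : mfun f -> entropy P (f \o Tz z) = entropy P f.
Proof. by move=> mf; congr (- _); apply: eq_bigr => v _; rewrite pmf_Tz. Qed.

End Dynamics.

(** * Mutual information with zero entropy processes, and block entropies *)

Section ZeroEntropy.
Context (R : realType) (d : measure_display) (X : measurableType d)
        (P : probability X R) (T Tinv : X -> X).
Hypothesis hT : invertible_mp P T Tinv.
Local Notation pr := (pr P).
Local Notation mfun f := (fmeas measurable f).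
Local Notation Tz := (iterz T Tinv).
Local Notation word := (word T).
Local Notation iid_over := (iid_over P T).
Local Notation cfactor := (cfactor P T Tinv).
Local Notation H := (entropy P).
Local Notation mW := (mfun_word hT).
Local Notation mTz := (mfun_Tz hT).

Lemma cfactor_setT B : cfactor B -> B setT.
Proof. by move=> /cfactor_alg[]. Qed.

Lemma pmf_word (F : finType) B (c : X -> F) N w : cfactor B -> iid_over B c ->
  pmf P (word N c) w = \prod_i pmf P c (w i).
Proof.
move=> cB ic; have := ic N w setT (cfactor_setT cB).
by rewrite setTI pr_setT mul1r.
Qed.

Lemma pmf_word_indep (F G : finType) B (c : X -> F) (g : X -> G) N w v : cfactor B ->
  iid_over B c -> fmeas B g ->
  pmf P (fun x => (word N c x, g x)) (w, v) = pmf P (word N c) w * pmf P g v.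
Proof.
move=> cB ic Bg; rewrite (pmf_word w cB ic) mulrC -(ic N w _ (Bg v)); congr pr.
by apply/seteqP; split=> x /= => [[-> ->]|[-> ->]].
Qed.

Lemma wordD (F : finType) N M (f : X -> F) x y :
  (word N f x, word M f (Tz N x)) = (word N f y, word M f (Tz N y)) <->
  word (N + M) f x = word (N + M) f y.
Proof.
split=> [[/word_eq h1 /word_eq h2]|/word_eq h].
  apply/word_eq => i iNM; have [iN|Ni] := ltnP i N; first exact: h1.
  have := h2 (i - N)%N; rewrite ?Tz_nat -!iterD subnK //; apply.
  by rewrite ltn_subLR.
congr pair; apply/word_eq => i iN; first by apply: h; rewrite ltn_addr.
by rewrite ?Tz_nat -!iterD; apply: h; rewrite addnC ltn_add2l.
Qed.

Lemma entropy_wordD (F : finType) N M (f : X -> F) : mfun f ->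
  H (word (N + M) f) = H (fun x => (word N f x, word M f (Tz N x))).
Proof.
move=> mf; apply: entropy_eq; first exact: mW.
  by apply: mfun_pair; [exact: mW|exact: (mTz N (mW mf))].
by move=> x y; apply: wordD.
Qed.

Lemma entropy_wordD_iid (F : finType) B N M (c : X -> F) : mfun c -> cfactor B ->
  iid_over B c -> H (word (N + M) c) = H (word N c) + H (word M c).
Proof.
move=> mc cB ic; rewrite entropy_wordD // -(entropy_Tz hT N (mW (N := M) mc)).
suff key (u : {ffun 'I_N -> F}) (v : {ffun 'I_M -> F}) :
    pmf P (fun x => (word N c x, (word M c \o Tz N) x)) (u, v) =
    pmf P (word N c) u * pmf P (word M c \o Tz N) v.
  by apply: entropy_indep; [exact: mW|exact: (mTz N (mW (N := M) mc))|exact: key].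
rewrite (pmf_Tz hT N v (mW (N := M) mc)) (pmf_word _ cB ic) (pmf_word _ cB ic).
pose w : {ffun 'I_(N + M) -> F} := [ffun i : 'I_(N + M) => match fintype.split i with inl j => u j
  | inr j => v j end].
have wl (i : 'I_N) : w (lshift M i) = u i by rewrite ffunE -[lshift M i]/(unsplit (inl i))
  fintype.unsplitK.
have wr (i : 'I_M) : w (rshift N i) = v i by rewrite ffunE -[rshift N i]/(unsplit (inr i))
  fintype.unsplitK.
transitivity (pmf P (word (N + M) c) w).
  congr pr; apply/seteqP; split=> x /=.
    move=> [/word_preE h1 /word_preE h2]; apply/word_preE => i.
    rewrite -[i]fintype.splitK; case: (fintype.split i) => j /=; rewrite ?wl ?wr //.
    by rewrite -h2 ?Tz_nat -iterD addnC.
  move=> /word_preE h; congr pair; apply/word_preE => i; first by rewrite -wl -h.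
  by rewrite -wr -h ?Tz_nat -iterD addnC.
rewrite (pmf_word _ cB ic) big_split_ord /=.
by congr (_ * _); apply: eq_bigr => i _; rewrite ?wl ?wr.
Qed.

Section Info.
Variables (A G K : finType) (B : set (set X)) (al : X -> A) (be : X -> G) (c : X -> K).
Hypotheses (cB : cfactor B) (mal : mfun al) (Bbe : fmeas B be) (mc : mfun c)
  (ic : iid_over B c).
Let mbe : mfun be. Proof. by apply: fmeas_sub Bbe; exact: cfactor_meas cB. Qed.
Let dd x := (al x, be x).
Let mdd : mfun dd. Proof. exact: mfun_pair. Qed.

Definition info N := H (word N c) + H (word N dd) - H (fun x => (word N c x, word N dd x)).

(** The entropy of words of [c] is additive, [c] being i.i.d., so it is enough that the conditional
    entropy of [c] given [dd] is subadditive, which takes two submodularities. *)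
Lemma info_superadditive N M : info N + info M <= info (N + M).
Proof.
have m1 := mW (N := N) mc; have m2 := mTz N (mW (N := M) mc).
have m3 := mW (N := N) mdd; have m4 := mTz N (mW (N := M) mdd).
set cN := word N c in m1; set cM := word M c \o Tz N in m2.
set dN := word N dd in m3; set dM := word M dd \o Tz N in m4.
have E1 : H (word M dd) = H dM by rewrite entropy_Tz //; exact: mW.
have E2 : H (fun x => (word M c x, word M dd x)) = H (fun x => (cM x, dM x)).
  rewrite -(entropy_Tz hT N (mfun_pair (mW (N := M) mc) (mW (N := M) mdd))) //.
have E3 : H (word (N + M) dd) = H (fun x => (dN x, dM x)) by exact: entropy_wordD.
have E4 : H (fun x => (word (N + M) c x, word (N + M) dd x)) =
   H (fun x => (cM x, (dM x, (cN x, dN x)))).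
  apply: entropy_eq.
  - by apply: mfun_pair; exact: mW.
  - by do 3 apply: mfun_pair => //.
  move=> x y; split.
    move=> [h1 h2 h3 h4]; congr pair; apply/wordD; congr pair => //.
  by move=> [/wordD[h1 h2] /wordD[h3 h4]]; rewrite /cM /dM /cN /dN /= h1 h2 h3 h4.
rewrite /info E1 E2 E3 E4 (entropy_wordD_iid N M mc cB ic).
have s1 := entropy_submodular P m1 m3 m4.
have s2 := entropy_submodular P m2 m4 (mfun_pair m1 m3).
have e1 : H (fun x => (cN x, (dN x, dM x))) = H (fun x => (dM x, (cN x, dN x))).
  apply: entropy_eq; try by do 2 apply: mfun_pair => //.
  by move=> x y; split=> -[-> -> ->].
rewrite -/cN -/dN; move: s1 s2; rewrite e1; lra.
Qed.

(** [be] is independent of [c], so all the information about [c] comes from [al]. *)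
Lemma info_le N : info N <= H (word N al).
Proof.
have h1 : H (fun x => (word N c x, word N be x)) = H (word N c) + H (word N be).
  apply: entropy_indep; [exact: mW|exact: mW|move=> u v].
  exact: (pmf_word_indep _ _ cB ic (fmeas_word hT cB Bbe)). 
have h2 : H (fun x => (word N c x, word N be x)) <= H (fun x => (word N c x, word N dd x)).
  apply: entropy_mono; first by apply: mfun_pair; exact: mW.
  by move=> x y [-> /word_eq h]; congr pair; apply/word_eq => i /h[].
have h3 : H (word N dd) <= H (word N al) + H (word N be).
  apply: le_trans (entropy_pair_le _ (mW (N := N) mal) (mW (N := N) mbe)).
  apply: entropy_mono; first by apply: mfun_pair; exact: mW.
  by move=> x y [/word_eq h1' /word_eq h2']; apply/word_eq => i iN; rewrite /dd h1' ?h2'.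
rewrite /info; lra.
Qed.

Lemma zero_entropy_indep N :
  (forall e, 0 < e -> exists n0, forall n, (n0 <= n)%N -> H (word n al) <= e * n%:R) ->
  forall u v, pmf P (fun x => (word N c x, word N dd x)) (u, v) =
    pmf P (word N c) u * pmf P (word N dd) v.
Proof.
move=> hal; apply: indep_of_entropy; [exact: mW|exact: mW|].
rewrite -subr_le0 -/(info N); apply/ler_addgt0Pr => e e0; rewrite add0r.
have mult k : k.+1%:R * info N <= info (k.+1 * N).
  elim: k => [|k IHk]; first by rewrite mul1r mul1n.
  rewrite mulSn; apply: le_trans (info_superadditive _ _).
  by rewrite -natr1 mulrDl mul1r addrC lerD2l.
have eN : 0 < e / N.+1%:R by rewrite divr_gt0.
have [n0 Hn0] := hal _ eN.
(* For [N = 0] no multiple of [N] reaches [n0]; there the entropy of the empty word is 0. *)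
have [N0|Np] := posnP N.
  have i0 : info N <= H (word N al) := info_le N.
  have [n1 _] := hal _ eN.
  apply: le_trans i0 _; rewrite N0; have -> : H (word 0 al) = 0.
    apply/eqP; rewrite eq_le entropy_ge0 ?andbT; last exact: mW.
    rewrite /entropy oppr_le0 sumr_ge0 // => v _.
    have -> : pmf P (word 0 al) v = 1.
      by rewrite -(pr_setT P); congr pr; apply/seteqP; split=> x //= _; apply/ffunP => -[].
    by rewrite ln1 mulr0.
  exact: ltW.
have := le_trans (mult n0) (info_le _); have /Hn0 : (n0 <= n0.+1 * N)%N by nia.
set h := H _ => h1 h2.
have {h1 h2} : n0.+1%:R * info N <= e / N.+1%:R * (n0.+1 * N)%:R by apply: le_trans h1.
rewrite natrM mulrCA ler_pM2l // => h1; apply: le_trans h1 _.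
by rewrite mulrAC ler_pdivrMr // ler_pM2l // ler_nat.
Qed.

End Info.

Lemma HnE (F : finType) (xi : X -> F) n : Hn P T xi n = H (word n.+1 xi).
Proof.
congr (- _); apply: eq_bigr => w _.
have -> : cyl_prob P T xi w = pmf P (word n.+1 xi) w; last by [].
rewrite /cyl_prob /pmf /pr; congr (fine (P _)); apply/seteqP.
by split=> x /= /word_preE.
Qed.

(** Submodularity for the first letter, the [n] middle letters and the last letter: the increments
    of the block entropy decrease. *)
Lemma entropy_word_concave (F : finType) (f : X -> F) n : mfun f ->
  H (word n.+2 f) + H (word n f) <= 2 * H (word n.+1 f).
Proof.
move=> mf.
have m1 := mf; have m2 : mfun (word n f \o Tz 1) by apply: mTz; exact: mW.
have m3 : mfun (f \o Tz n.+1) by exact: mTz.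
have := entropy_submodular P m1 m2 m3.
have -> : H (word n f \o Tz 1) = H (word n f) by apply: entropy_Tz => //; exact: mW.
have -> : H (fun x => (f x, ((word n f \o Tz 1) x, (f \o Tz n.+1) x))) = H (word n.+2 f).
  apply: entropy_eq; [by do 2 apply: mfun_pair => //|exact: mW|move=> x y; split].
    move=> /word_eq h; congr (_, (_, _)); first exact: (h 0%N).
      by apply/word_eq => i iN; rewrite /= -!iterSr; apply: h; rewrite !ltnS ltnW.
    exact: (h n.+1).
  move=> [h1 /word_eq h2 h3]; apply/word_eq => -[|i] //; rewrite ltnS ltnS leq_eqVlt.
  case/orP => [/eqP ->//|iN]; by have := h2 i iN; rewrite /= -!iterSr.
have -> : H (fun x => (f x, (word n f \o Tz 1) x)) = H (word n.+1 f).
  apply: entropy_eq; [by apply: mfun_pair => //|exact: mW|move=> x y; split].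
    move=> /word_eq h; congr (_, _); first exact: (h 0%N).
    by apply/word_eq => i iN; rewrite /= -!iterSr; apply: h; rewrite ltnS.
  move=> [h1 /word_eq h2]; apply/word_eq => -[|i] // iN.
  by have := h2 i iN; rewrite /= -!iterSr.
have -> : H (fun x => ((word n f \o Tz 1) x, (f \o Tz n.+1) x)) = H (word n.+1 f).
  rewrite -(entropy_Tz hT 1 (mW (N := n.+1) mf)).
  apply: entropy_eq; [by apply: mfun_pair => //|exact/mTz/mW|move=> x y; split].
    move=> /word_eq h; congr (_, _).
      by apply/word_eq => i iN; apply: h; rewrite ltnW.
    by have := h n (leqnn _); rewrite /= -!iterSr.
  move=> [/word_eq h1 h2]; apply/word_eq => i; rewrite ltnS leq_eqVlt.
  case/orP => [/eqP ->|/h1 //]; by move: h2; rewrite /= -!iterSr.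
lra.
Qed.

Lemma entropy_word_nd (F : finType) (f : X -> F) n : mfun f -> H (word n f) <= H (word n.+1 f).
Proof.
move=> mf; apply: entropy_mono; first exact: mW.
by move=> x y /word_eq h; apply/word_eq => i iN; apply: h; rewrite ltnW.
Qed.

(** The decreasing increments [dl] converge, and their Cesaro means are block entropies per letter.
    [Hn] has one letter more than the denominator counts, whence the vanishing term
    [dl n.+1 / n.+1]. *)
Lemma entropy_proc_cvg (F : finType) (f : X -> F) : mfun f ->
  (fun n : nat => Hn P T f n / n%:R) @ \oo --> entropy_proc P T f.
Proof.
move=> mf; pose u n := H (word n f).
pose dl n := u n.+1 - u n.
have dl0 n : 0 <= dl n by rewrite subr_ge0 entropy_word_nd.
have dlS n : dl n.+1 <= dl n by have := entropy_word_concave n mf; rewrite /dl /u; lra.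
have ndl : nonincreasing_seq dl by apply/nonincreasing_seqP.
have cdl : cvgn dl.
  by apply: nonincreasing_is_cvgn => //; exists 0 => _ [n _ <-].
have /cesaro H1 := cdl.
have u0 : u 0%N = 0.
  apply/eqP; rewrite eq_le entropy_ge0 ?andbT; last exact: mW.
  rewrite /u /entropy oppr_le0 sumr_ge0 // => v _.
  have -> : pmf P (word 0 f) v = 1.
    by rewrite -(pr_setT P); congr pr; apply/seteqP; split=> x //= _; apply/ffunP => -[].
  by rewrite ln1 mulr0.
have am n : arithmetic_mean dl n = u n.+1 / n.+1%:R.
  rewrite /arithmetic_mean /= mulrC; congr (_ / _); rewrite /series /=.
  by rewrite telescope_sumr // u0 subr0.
suff : cvgn (fun n : nat => Hn P T f n / n%:R) by [].
apply/cvg_ex; exists (limn dl); rewrite -cvg_shiftS /=.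
have -> : (fun n => Hn P T f n.+1 / n.+1%:R) =
  (fun n => arithmetic_mean dl n + dl n.+1 / n.+1%:R).
  apply/funext => n; rewrite HnE am -mulrDl; congr (_ / _).
  by rewrite /dl /u; ring.
rewrite -[limn dl]addr0; apply: cvgD => //.
rewrite -[0](mulr0 (limn dl)); apply: cvgM; last exact: cvg_harmonic.
by rewrite -(cvg_shiftS dl) in cdl.
Qed.

End ZeroEntropy.

(** * Cylinders of a sequence of bits over a factor *)

Section Cylinders.
Context (R : realType) (d : measure_display) (X : measurableType d)
        (P : probability X R) (T Tinv : X -> X).
Hypothesis hT : invertible_mp P T Tinv.
Local Notation pr := (pr P).
Local Notation mfun f := (fmeas measurable f).
Local Notation Tz := (iterz T Tinv).
Local Notation word := (word T).
Local Notation iid_over := (iid_over P T).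
Local Notation cfactor := (cfactor P T Tinv).
Implicit Types (e : nat -> X -> bool) (F : set (set X)).

Definition mbits e := forall a, measurable [set x | e a x].

Definition letter e c (x : X) : {ffun 'I_c -> bool} := [ffun a : 'I_c => e a x].

Definition agree e c N (x y : X) := forall z : int, (`|z| <= N)%N ->
  forall a, (a < c)%N -> e a (Tz z x) = e a (Tz z y).

Definition window e c N (x : X) := word (2 * N).+1 (letter e c) (Tz (- N%:Z) x).

Lemma fmeas_bit e a B : is_alg B -> B [set x | e a x] -> fmeas B (e a).
Proof.
move=> Ba Be; have := fmeas_bool Ba Be; congr (fmeas B _).
by apply/funext => x; apply/asboolP/idP.
Qed.

Lemma fmeas_letter e c B : is_alg B -> (forall a, B [set x | e a x]) -> fmeas B (letter e c).
Proof. by move=> Ba Be; apply: fmeas_ffun => // i; apply: fmeas_bit. Qed.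

Lemma mfun_letter e c : mbits e -> mfun (letter e c).
Proof. by move=> me; apply: fmeas_letter => //; exact: measurable_alg. Qed.

Lemma mfun_window e c N : mbits e -> mfun (window e c N).
Proof.
move=> me; have := mfun_Tz hT (- N%:Z) (mfun_word hT (N := (2 * N).+1) (mfun_letter (c := c) me)).
exact.
Qed.

Lemma letter_eq e c x y : letter e c x = letter e c y <-> forall a, (a < c)%N -> e a x = e a y.
Proof.
split=> [/ffunP h a ac|h]; last by apply/ffunP=> a; rewrite !ffunE h.
by have := h (Ordinal ac); rewrite !ffunE.
Qed.

Lemma windowP e c N x y : window e c N x = window e c N y <-> agree e c N x y.
Proof.
split=> [/word_eq h z zN a ac|h]; last first.
  apply/word_eq => i iN; apply/letter_eq => a ac.
  by rewrite -2!(Tz_nat T Tinv) -!(TzD hT); apply: h => //; lia.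
have [i iN zi] : exists2 i : nat, (i < (2 * N).+1)%N & z = i%:Z - N%:Z.
  by exists (absz (z + N%:Z)%R); lia.
have := h i iN; rewrite -2!(Tz_nat T Tinv) -!(TzD hT) zi.
by move=> /letter_eq /(_ a ac).
Qed.

Lemma agree_sym e c N x y : agree e c N x y -> agree e c N y x.
Proof. by move=> h z zN a ac; rewrite h. Qed.

Lemma agree_le e c c' N N' x y : (c <= c')%N -> (N <= N')%N -> agree e c' N' x y ->
  agree e c N x y.
Proof. by move=> cc NN h z zN a ac; apply: h; [exact: leq_trans NN|exact: leq_trans cc]. Qed.

Lemma agree_Tz e c N z x y : agree e c (N + `|z|) x y -> agree e c N (Tz z x) (Tz z y).
Proof. by move=> h z' zN a ac; rewrite -!(TzD hT); apply: h => //; lia. Qed.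

(** The algebra generated by [F] and all translates of the bits, expressed through determination by
    finite data. One implication is enough, the relation between [x] and [y] being symmetric. *)
Definition cyl e F : set (set X) := [set S | exists c N (K : finType) (b : X -> K),
  fmeas F b /\ forall x y, agree e c N x y -> b x = b y -> S x -> S y].

Lemma cyl_alg e F : mbits e -> cfactor F -> is_alg (cyl e F).
Proof.
move=> me cF; have Fa := cfactor_alg cF; split.
- move=> S [c [N [K [b [Fb h]]]]].
  apply: (fmeas_determined (f := fun x => (window e c N x, b x))).
  + exact: measurable_alg.
  + apply: mfun_pair; first exact: mfun_window.
    by apply: fmeas_sub Fb; exact: cfactor_meas cF.
  + by move=> x y [/windowP ag bb]; apply: h.
- exists 0%N, 0%N, unit, (fun=> tt); split=> // v.
  have -> : (fun=> tt) @^-1` [set v] = [set: X] by apply/seteqP; split=> x //=; case: v.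
  by case: Fa.
- move=> S [c [N [K [b [Fb h]]]]]; exists c, N, K, b; split=> // x y ag bb nS Sy.
  by apply: nS; apply: (h y x) => //; exact: agree_sym.
- move=> S S' [c [N [K [b [Fb h]]]]] [c' [N' [K' [b' [Fb' h']]]]].
  exists (maxn c c'), (maxn N N'), (K * K')%type, (fun x => (b x, b' x)).
  split; first exact: fmeas_pair.
  move=> x y ag [bb bb'] [Sx|Sx]; [left; apply: (h x)|right; apply: (h' x)] => //.
    by apply: agree_le ag; rewrite leq_maxl.
  by apply: agree_le ag; rewrite leq_maxr.
Qed.

Lemma cyl_sub e F : is_alg F -> F `<=` cyl e F.
Proof.
move=> Fa A FA; exists 0%N, 0%N, bool, (fun x => `[<A x>]); split.
  exact: fmeas_bool.
by move=> x y _ xy /asboolP; rewrite xy => /asboolP.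
Qed.

Lemma cyl_bit e F a : is_alg F -> cyl e F [set x | e a x].
Proof.
move=> Fa; exists a.+1, 0%N, unit, (fun=> tt); split=> [v|].
  have -> : (fun=> tt) @^-1` [set v] = [set: X] by apply/seteqP; split=> x //=; case: v.
  by case: Fa.
by move=> x y /(_ 0 isT a (leqnn _)) /= -> _.
Qed.

Lemma cyl_Tz e F z S : cfactor F -> cyl e F S -> cyl e F (Tz z @^-1` S).
Proof.
move=> cF [c [N [K [b [Fb h]]]]]; exists c, (N + `|z|)%N, K, (b \o Tz z); split.
  exact: (fmeas_Tz hT).
by move=> x y ag bb; apply: h => //; apply: agree_Tz.
Qed.

Lemma cyl_cfactor e F : mbits e -> cfactor F -> cfactor (near P (cyl e F)).
Proof.
move=> me cF; have ca := cyl_alg me cF; have [cm _ _ _] := ca.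
apply: (near_cfactor hT) => // A cA; apply: near_sub => //.
  exact: (@cyl_Tz e F 1).
exact: (@cyl_Tz e F (-1)).
Qed.

(* If [A] is independent of the cylinders over [F], the cylinder part of an
   approximation of [A] can be replaced, on each atom of [F], by the more likely
   of the empty and the full set, at the cost of a factor 2. *)
Lemma rel_trivial e F A : mbits e -> cfactor F -> near P (cyl e F) A ->
  (forall (K : finType) (b : X -> K) c N k s (q : pred _), fmeas F b ->
    pr ([set x | (`[<A x>], b x) == (s, k)] `&` [set x | q (window e c N x)]) =
    pr [set x | (`[<A x>], b x) == (s, k)] * pr [set x | q (window e c N x)]) ->
  F A.
Proof.
move=> me cF [mA HA] ind; have [_ nF _ _] := cF; have Fa := cfactor_alg cF.
apply: nF; split=> // eps e0; have e2 : 0 < eps / 2 by lra.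
have [D [cD mD AD]] := HA _ e2.
have [c [N [K [b [Fb h]]]]] := cD.
have mb : mfun b by apply: fmeas_sub Fb; exact: cfactor_meas cF.
have mw := mfun_window (c := c) (N := N) me.
(* [q k] is the section of [D] over the atom [b = k], as a set of windows. By [ind] its probability
   [s k] is unchanged by conditioning on the atom and on membership in [A]. *)
pose q k w := `[<exists y, [/\ window e c N y = w, b y = k & D y]>].
pose s k := pr [set x | q k (window e c N x)].
have ms k : measurable [set x | q k (window e c N x)] by have [] := pr_fin P (q k) mw.
have Dq x : D x <-> q (b x) (window e c N x).
  split=> [Dx|/asboolP[y [wy bxy Dy]]]; first by apply/asboolP; exists x.
  by apply: (h y) => //; apply/windowP.
have s1 k : s k <= 1 by exact: (pr_le1 P (ms k)).
have s0 k : 0 <= s k by exact: pr_ge0.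
pose B := [set x | 1 / 2 <= s (b x)].
have FB : F B by exact: (alg_fin (fun k => 1 / 2 <= s k) Fa Fb).
have mB : measurable B by exact: (cfactor_meas cF FB).
have mY S S' : measurable S -> measurable S' -> measurable (S `+` S') := @measurableY _ X S S'.
have mAb : mfun (fun x => (`[<A x>], b x)).
  by apply: mfun_pair => //; apply: fmeas_bool => //; exact: measurable_alg.
pose p t k := pr [set x | (`[<A x>], b x) == (t, k)].
have p0 t k : 0 <= p t k by exact: pr_ge0.
have mp t k : measurable [set x | (`[<A x>], b x) == (t, k)].
  by have [] := pr_fin P (fun u => u == (t, k)) mAb.
have ED : dist P A D = \sum_k (p true k * (1 - s k) + p false k * s k).
  rewrite /dist (pr_partition P (mY _ _ mA mD) mb); apply: eq_bigr => k _.
  have -> : (A `+` D) `&` b @^-1` [set k] =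
    ([set x | (`[<A x>], b x) == (true, k)] `&` ~` [set x | q k (window e c N x)]) `|`
    ([set x | (`[<A x>], b x) == (false, k)] `&` [set x | q k (window e c N x)]).
    apply/seteqP; split=> x /=.
      move=> [[[Ax nD]|[Dx nA]] bx]; [left|right]; rewrite -bx; split.
      - by rewrite (asboolT Ax) eqxx.
      - by move=> /Dq.
      - by rewrite (asboolF nA) eqxx.
      - exact/Dq.
    move=> [[/eqP[Ax <-] nq]|[/eqP[Ax <-] hq]]; split=> //; [left|right]; split.
    - exact/asboolP.
    - by move=> /Dq.
    - exact/Dq.
    - by move=> /asboolP; rewrite Ax.
  rewrite prU //; [|exact/measurableI/measurableC|exact: measurableI|]; last first.
    by apply/seteqP; split=> x //= [[_ nq] [_]].
  rewrite (ind _ _ _ _ _ _ (q k)) //; congr (_ + _).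
  have := prDI P (mp true k) (ms k); rewrite (ind _ _ _ _ _ _ (q k)) //.
  by rewrite -/(s k) -/(p true k) setDE => hh; rewrite mulrBr mulr1 {1}hh addrK.
have EB : dist P A B = \sum_k (if 1 / 2 <= s k then p false k else p true k).
  rewrite /dist (pr_partition P (mY _ _ mA mB) mb); apply: eq_bigr => k _.
  case: ifP => hk; congr pr; apply/seteqP; split=> x /=.
  - move=> [[[Ax nB]|[Bx nA]] bx]; first by case: nB; rewrite /B /= bx hk.
    by rewrite (asboolF nA) bx eqxx.
  - move=> /eqP[Ax bx]; split=> //; right; rewrite /B /= bx hk; split=> //.
    by move=> /asboolP; rewrite Ax.
  - move=> [[[Ax nB]|[Bx nA]] bx]; first by rewrite (asboolT Ax) bx eqxx.
    by move: Bx; rewrite /B /= bx hk.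
  - move=> /eqP[Ax bx]; split=> //; left; rewrite /B /= bx hk; split=> //.
    exact/asboolP.
exists B; split=> //.
apply: (@le_lt_trans _ _ (2 * dist P A D)); last by lra.
rewrite EB ED mulr_sumr; apply: ler_sum => k _.
have s1' : 0 <= 1 - s k by rewrite subr_ge0.
have h1 := mulr_ge0 (p0 true k) s1'; have h2 := mulr_ge0 (p0 false k) (s0 k).
case: (lerP (1 / 2) (s k)) => hk.
  have hk' : 0 <= s k - 1 / 2 by rewrite subr_ge0.
  by have h3 := mulr_ge0 (p0 false k) hk'; lra.
have hk' : 0 <= 1 / 2 - s k by rewrite subr_ge0 ltW.
by have h3 := mulr_ge0 (p0 true k) hk'; lra.
Qed.

(** A real function becomes a sequence of bits, its comparisons with the rationals; finitely many of
    them form a finite-valued function, as entropy requires. Indices that encode no rational repeat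
    the comparison with 0. *)
Definition rv_bits (f : X -> R) (a : nat) (x : X) : bool :=
  f x < ratr (odflt (0 : rat) (unpickle a)).

Lemma sigma_rv_bit (f : X -> R) a : sigma_rv f [set x | rv_bits f a x].
Proof.
apply: sub_sigma_algebra; exists `]-oo, (ratr (odflt (0 : rat) (unpickle a)) : R)[%classic => //.
Qed.

Lemma sigma_rv_bits (f : X -> R) B : sub_sigma B -> (forall a, B [set x | rv_bits f a x]) ->
  sigma_rv f `<=` B.
Proof.
move=> sB Bf; have [_ [B0 BC BU]] := sB.
apply: gen_sub => // _ [S mS <-].
suff : (@measurable _ R) `<=` [set S | B (f @^-1` S)] by apply.
rewrite (measurable_realfun.RGenInftyO.measurableE R : (@measurable _ R) = _).
apply: smallest_sub.
  split=> /=.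
  - by rewrite preimage_set0.
  - by move=> S' BS'; exact: (BC _ BS').
  - by move=> S' BS'; rewrite preimage_bigcup; apply: BU.
move=> _ [t ->] /=.
have -> : f @^-1` `]-oo, t[ = \bigcup_a (if ratr (odflt (0 : rat) (unpickle a)) <= t
    then [set x | rv_bits f a x] else set0).
  apply/seteqP; split=> x /=; rewrite in_itv /=.
    move=> xt; have [r /itvP rP] := rat_in_itvoo xt.
    exists (pickle r) => //; rewrite pickleK /= rP /rv_bits pickleK /=.
    by rewrite rP.
  by move=> [a _]; case: ifP => // at_ /lt_le_trans; apply.
by apply: BU => a; case: ifP.
Qed.

Lemma sigma_proc_sub (f : X -> R) F : measurable_fun setT f -> cfactor F ->
  (forall a, F [set x | rv_bits f a x]) -> sigma_proc T Tinv f `<=` F.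
Proof.
move=> mf cF Ff; have [sF _ _ _] := cF.
apply: gen_sub => // S [n _]; apply: sigma_rv_bits => // a.
exact: (cfactor_preTz hT n cF (Ff a)).
Qed.

Lemma iid_over_near (F : finType) B (c : X -> F) : B `<=` measurable -> B setT -> mfun c ->
  iid_over B c -> iid_over (near P B) c.
Proof.
move=> Bm BT mc ic N w A nA.
have E : pr (word N c @^-1` [set w]) = \prod_i pmf P c (w i).
  by have := ic N w _ BT; rewrite setTI pr_setT mul1r.
rewrite -E; have mW : measurable (word N c @^-1` [set w]) by exact: (mfun_word hT mc).
apply: (@indep_near _ _ _ P B [set word N c @^-1` [set w]]) => //.
  by move=> A' _ BA' ->; rewrite E; exact: ic.
by apply: near_sub => // _ ->.
Qed.

Lemma mbits_rv (f : X -> R) : measurable_fun setT f -> mbits (rv_bits f).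
Proof.
move=> mf a; have := mf measurableT _ (measurable_itv `]-oo,
  (ratr (odflt (0 : rat) (unpickle a)) : R)[).
by congr measurable; apply/seteqP; split=> x /=; rewrite in_itv //= => -[].
Qed.

Lemma iid_over_letter (f : X -> R) B c : sub_sigma B -> iid_proc P T Tinv f ->
  indep2 P (sigma_proc T Tinv f) B -> iid_over B (letter (rv_bits f) c).
Proof.
move=> sB [mf mi _] ind N w A BA.
set W := _ @^-1` _; have me := mbits_rv mf.
pose V i := letter (rv_bits f) c @^-1` [set w i].
have sV i : sigma_rv f (V i).
  apply: (@fmeas_letter (rv_bits f) c (sigma_rv f)) => [|a].
    apply/sub_sigma_alg/gen_sub_sigma => _ [S mS <-].
    by rewrite -[_ @^-1` _]setTI; apply: mf.
  exact: sigma_rv_bit.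
have sVz i (z : int) : sigma_rv (proc T Tinv f z) (Tz z @^-1` V i).
  have : sigma_rv f `<=` [set S | sigma_rv (proc T Tinv f z) (Tz z @^-1` S)].
    apply: smallest_sub; last first.
      by move=> _ [S mS <-]; apply: sub_sigma_algebra; exists S.
    have [s0 sC sU] := smallest_sigma_algebra [set: X]
      [set proc T Tinv f z @^-1` S | S in (measurable : set (set R))].
    split=> /=.
    - by rewrite preimage_set0.
    - by move=> S hS; exact: (sC _ hS).
    - by move=> S hS; rewrite preimage_bigcup; exact: sU.
  by apply.
have hW i z : P (Tz z @^-1` V i) = (pmf P (letter (rv_bits f) c) (w i))%:E.
  rewrite prE; last exact/(measurable_preTz hT)/(mfun_letter me).
  by rewrite (pr_preTz hT) //; exact: (mfun_letter me).
have [N0|Np] := posnP N.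
  have E0 (i : 'I_N) : False by case: i => i; rewrite N0.
  have -> : W = setT by apply/seteqP; split=> x //= _; apply/ffunP => i; case: (E0 i).
  by rewrite setIT big1 ?mulr1 // => i; case: (E0 i).
pose i0 := Ordinal Np.
(* [mindep] takes families indexed by all integers, whereas the word concerns the times from 0 to
   [N - 1]; the fallback [i0] is why [N = 0] was split off. *)
pose S (z : int) := Tz z @^-1` V (insubd i0 (absz z)).
have insE (i : nat) (iN : (i < N)%N) : insubd i0 i = Ordinal iN.
  by apply: val_inj; rewrite val_insubd iN.
have WE : W = \big[setI/setT]_(z <- [seq i%:Z | i <- iota 0 N]) S z.
  apply/seteqP; split=> x; rewrite -bigcap_seq /=.
    move=> /word_preE h z /= /mapP[i]; rewrite mem_iota add0n => /andP[_ iN] ->.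
    by rewrite /S /V /= (insE _ iN) -h.
  move=> h; apply/word_preE => i.
  have /h : i%:Z \in [seq i%:Z | i <- iota 0 N].
    by apply: map_f; rewrite mem_iota add0n ltn_ord.
  rewrite /S /V /=; have -> : insubd i0 i = i by apply: val_inj; rewrite val_insubd ltn_ord.
  by [].
have PW : P W = (\prod_i pmf P (letter (rv_bits f) c) (w i))%:E.
  rewrite WE mi; last first.
  - by move=> z _; exact: sVz.
  - by rewrite map_inj_uniq ?iota_uniq // => ? ? [].
  rewrite big_map; have -> : iota 0 N = index_iota 0 N by rewrite /index_iota subn0.
  rewrite big_mkord -prodEFin.
  apply: eq_bigr => i _; rewrite /S hW; congr (pmf _ _ _)%:E; congr (w _).
  by apply: val_inj; rewrite val_insubd ltn_ord.
have sW : sigma_proc T Tinv f W.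
  have sa : is_alg (sigma_proc T Tinv f).
    apply/sub_sigma_alg/gen_sub_sigma => S' [n _].
    suff : sigma_rv (proc T Tinv f n) `<=` (@measurable d X) by apply.
    apply: gen_sub; first by case: (measurable_cfactor hT).
    move=> _ [B' mB' <-]; apply: (measurable_preTz hT n (A := f @^-1` B')).
    by rewrite -[_ @^-1` _]setTI; apply: mf.
  rewrite WE; apply: big_ind => [|S1 S2 h1 h2|z _]; first by case: sa.
    exact: (alg_setI sa h1 h2).
  by apply: sub_sigma_algebra; exists z => //; exact: sVz.
have mA : measurable A by case: sB => + _; apply.
have mW : measurable W by exact: (mfun_word hT (mfun_letter me)).
apply: EFin_inj; rewrite EFinM -PW -[X in (X * _)%E]prE // setIC muleC -ind // -prE //.
exact: measurableI.
Qed.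

End Cylinders.

(** * K-systems and Kolmogorovian filtrations *)

Section KolmogorovianK.
Context (R : realType) (d : measure_display) (X : measurableType d)
        (P : probability X R) (T Tinv : X -> X).
Hypothesis hT : invertible_mp P T Tinv.
Local Notation mfun f := (fmeas measurable f).
Local Notation Tz := (iterz T Tinv).
Local Notation word := (word T).
Local Notation iid_over := (iid_over P T).

(** The passage from the definition, with real processes and equalities mod [P], to bits and
    completed factors; all later arguments use this form. *)
Lemma rel_bernoulli_bits (F F' : set (set X)) : Defs.factor P T F -> Defs.factor P T F' ->
  rel_bernoulli P T Tinv F' F ->
  exists e : nat -> X -> bool, [/\ mbits e, forall c, iid_over (near P F') (letter e c),
    near P F `<=` near P (cyl T Tinv e (near P F')) & forall a, near P F [set x | e a x]].
Proof.
move=> fF fF' [f [iif sub ind [CB _]]].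
have [sF _] := fF; have [sF' _] := fF'.
have [mf _ _] := iif; have me := mbits_rv mf.
have cF' := factor_cfactor hT fF'.
have [Fm _] := sF; have [F'm _] := sF'; have F'a := sub_sigma_alg sF'.
have cc := cyl_cfactor hT me cF'; have ca := cyl_alg hT me cF'; have [cm _ _ _] := ca.
have F'c : F' `<=` near P (cyl T Tinv (rv_bits f) (near P F')).
  move=> A F'A; apply: near_sub => //; apply: cyl_sub; first exact: cfactor_alg cF'.
  exact: near_sub.
have sp : sigma_proc T Tinv f `<=` near P (cyl T Tinv (rv_bits f) (near P F')).
  apply: (sigma_proc_sub hT mf cc) => a; apply: near_sub => //.
  by apply: cyl_bit; exact: cfactor_alg cF'.
have spm : sigma_proc T Tinv f `<=` measurable.
  by move=> A /sp /near_meas.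
exists (rv_bits f); split=> //.
- move=> c; have [_ F'T _ _] := F'a; apply: (iid_over_near hT) => //; first exact: mfun_letter.
  by apply: (iid_over_letter hT).
- apply: subset_trans (@near_idem _ _ _ P _); apply: near_mono.
  have gs : <<s F' `|` sigma_proc T Tinv f >> `<=` near P (cyl T Tinv (rv_bits f) (near P F')).
    by apply: gen_sub; [case: cc|move=> A [/F'c|/sp]].
  have gm : <<s F' `|` sigma_proc T Tinv f >> `<=` measurable by move=> A /gs /near_meas.
  apply: subset_trans (subset_mod_near Fm gm CB) _.
  by apply: subset_trans (near_mono gs) (@near_idem _ _ _ P _).
- move=> a; apply: (subset_mod_near spm Fm sub).
  apply: sub_sigma_algebra; exists 0 => //; exact: sigma_rv_bit.
Qed.

Section Filtration.
Variable F : nat -> set (set X).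
Hypothesis wF : weak_pinsker P T Tinv F.

Lemma near_factor_dec m : near P (F m.+1) `<=` near P (F m).
Proof.
have [fac sub _ _ _] := wF; have [[Fm _] _] := fac m; have [[Fm' _] _] := fac m.+1.
apply: subset_trans (@near_idem _ _ _ P _); apply: near_mono.
exact: subset_mod_near (sub m).
Qed.

Lemma near_factor0 : @measurable d X `<=` near P (F 0%N).
Proof.
have [fac _ [_ F0] _ _] := wF; have [[Fm _] _] := fac 0%N.
exact: subset_mod_near F0.
Qed.

Definition ind (A : set X) (x : X) : bool := x \in A.

Lemma fmeas_ind B A : is_alg B -> B A -> fmeas B (ind A).
Proof. exact: fmeas_bool. Qed.

Lemma zero_entropy_word A : measurable A -> entropy_proc P T (ind A) = 0 ->
  forall e, 0 < e -> exists n0, forall n, (n0 <= n)%N -> entropy P (word n (ind A)) <= e * n%:R.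
Proof.
move=> mA h0 e e0; have mi : mfun (ind A) by apply: fmeas_ind => //; exact: measurable_alg.
have := entropy_proc_cvg hT mi; rewrite h0 => /cvgrPdist_lt /(_ e e0) [n0 _ hn].
exists n0.+1 => n n0n; apply: le_trans (entropy_word_nd hT n mi) _.
have np : 0 < n%:R :> R by rewrite ltr0n (leq_trans _ n0n).
have /= := hn n (ltnW n0n); rewrite HnE sub0r normrN => /ltW h.
by rewrite -ler_pdivrMr //; apply: le_trans h; exact: ler_norm.
Qed.

Lemma pinsker_sub_factor A m : pinsker P T A -> near P (F m) A.
Proof.
move=> [mA h0]; elim: m => [|m IHm]; first exact: near_factor0.
have [fac _ _ rb _] := wF.
have [e [me ie cy _]] := rel_bernoulli_bits (fac m) (fac m.+1) (rb m).
have cF := factor_cfactor hT (fac m.+1).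
apply: (rel_trivial hT me cF (cy _ IHm)) => K b c N k s q Fb.
have mb : mfun b by apply: fmeas_sub Fb; exact: near_meas.
have mi : mfun (ind A) by apply: fmeas_ind => //; exact: measurable_alg.
have ml := mfun_letter (c := c) me.
have mdd : mfun (fun x => (ind A x, b x)) by exact: mfun_pair.
have key := zero_entropy_indep hT cF mi Fb ml (ie c) (N := (2 * N).+1) (zero_entropy_word mA h0).
(* The windows of [rel_trivial] begin [N] steps in the past, the words of [zero_entropy_indep] at
   time 0. So [(A, b)] is read at position [N] of the word, and everything is translated by [-N]. *)
have iN : (N < (2 * N).+1)%N by lia.
have mw := mfun_word hT (N := (2 * N).+1) ml.
have mwd := mfun_word hT (N := (2 * N).+1) mdd.
have := pmf_indep_sets q (fun v : {ffun 'I_(2 * N).+1 -> bool * K} => v (Ordinal iN) == (s,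
  k)) mw mwd key.
rewrite setIC mulrC => E.
have [ms1 _] := pr_fin P q mw.
have [ms2 _] := pr_fin P (fun v : {ffun 'I_(2 * N).+1 -> bool * K} => v (Ordinal iN) == (s, k)) mwd.
have E1 : [set x | q (window T Tinv e c N x)] =
   Tz (- N%:Z) @^-1` [set x | q (word (2 * N).+1 (letter e c) x)] by [].
have E2 : [set x | (`[<A x>], b x) == (s, k)] =
   Tz (- N%:Z) @^-1` [set x | word (2 * N).+1 (fun x => (ind A x, b x)) x (Ordinal iN) == (s, k)].
  apply/seteqP; split=> x; rewrite /preimage /mkset ffunE /= -(Tz_nat T Tinv).
    by rewrite (TzNK hT).
  by rewrite (TzNK hT).
rewrite E1 E2 -preimage_setI !(pr_preTz hT) //; exact: measurableI.
Qed.

Lemma kolmogorovian_K : kolmogorovian P F -> K_system P T.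
Proof.
move=> kF A pA; have [mA _] := pA; have [fac _ _ _ _] := wF.
apply: kF => // m _ ->; have [sF _] := fac m.
exact: near_complete sF (pinsker_sub_factor m pA).
Qed.

Lemma entropy_proc_ge0 (K : finType) (f : X -> K) : mfun f -> 0 <= entropy_proc P T f.
Proof.
move=> mf; have h := entropy_proc_cvg hT mf; rewrite -(cvg_lim _ h) //.
apply: limr_ge; first by apply/cvg_ex; exists (entropy_proc P T f).
by apply: nearW => n; rewrite HnE divr_ge0 //; exact: (entropy_ge0 P (mfun_word hT mf)).
Qed.

(** A set of the tail is only almost equal to a set of each [F m]. The words of two almost equal
    sets differ on finitely many translates of a null set. *)
Lemma entropy_proc_null A A' : measurable A -> measurable A' -> dist P A A' = 0 ->
  entropy_proc P T (ind A) = entropy_proc P T (ind A').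
Proof.
move=> mA mA' AA'; suff E n : Hn P T (ind A) n = Hn P T (ind A') n.
  by rewrite /entropy_proc; congr (limn _); apply/funext => n; rewrite E.
have mi : mfun (ind A) by apply: fmeas_ind => //; exact: measurable_alg.
have mi' : mfun (ind A') by apply: fmeas_ind => //; exact: measurable_alg.
have mw := mfun_word hT (N := n.+1) mi; have mw' := mfun_word hT (N := n.+1) mi'.
rewrite !HnE; congr (- _); apply: eq_bigr => w _.
suff -> : pmf P (word n.+1 (ind A)) w = pmf P (word n.+1 (ind A')) w by [].
apply/eqP; rewrite -subr_eq0 -normr_le0; apply: le_trans (pr_dist P (mw w) (mw' w)) _.
have mY := measurableY mA mA'.
have := @pr_union_le _ _ _ P 'I_n.+1 (fun i => Tz i%:Z @^-1` (A `+` A')) _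
  (measurableY (mw w) (mw' w)) (fun i => measurable_preTz hT i%:Z mY).
rewrite big1 => [|i _]; last by rewrite (pr_preTz hT).
apply=> x; apply: contraPP => /forallNP h.
have E (i : 'I_n.+1) : ind A (iter i T x) = ind A' (iter i T x).
  apply/idP/idP; rewrite /ind !inE => hA; apply: contrapT => hA'; apply: (h i) => /=.
    by left.
  by right.
move=> [[+ h']|[+ h']]; apply: contra_not h' => /word_preE hw; apply/word_preE => i.
  by rewrite -E.
by rewrite E.
Qed.

Lemma K_kolmogorovian : K_system P T -> kolmogorovian P F.
Proof.
move=> KT A mA AF; apply: KT; split=> //.
have mi : mfun (ind A) by apply: fmeas_ind => //; exact: measurable_alg.
change (entropy_proc P T (ind A) = 0).
have [fac _ _ _ ent] := wF.
apply/eqP; rewrite eq_le entropy_proc_ge0 // andbT.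
rewrite -lee_fin; apply: (cvge_to_ge ent); apply: nearW => m.
have [sF _] := fac m; have [Fm _] := sF.
have [A' [FA' AA']] := AF m A erefl; have mA' := Fm _ FA'.
rewrite (@entropy_proc_null A A') //; last exact/(dist0P P mA mA').
apply: ereal_sup_ubound; exists bool, (ind A'); split=> //.
by apply: fmeas_ind => //; exact: sub_sigma_alg.
Qed.

End Filtration.
End KolmogorovianK.

(** * Towers *)

Section Iid.
Context (R : realType) (d : measure_display) (X : measurableType d)
        (P : probability X R) (T Tinv : X -> X).
Hypothesis hT : invertible_mp P T Tinv.
Local Notation pr := (pr P).
Local Notation mfun f := (fmeas measurable f).
Local Notation Tz := (iterz T Tinv).
Local Notation word := (word T).
Local Notation iid_over := (iid_over P T).
Local Notation cfactor := (cfactor P T Tinv).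
Local Notation mW := (mfun_word hT).
Local Notation mTz := (mfun_Tz hT).

(** The smallest complete factor: [iid_over triv] is the plain i.i.d. property, and every [cfactor]
    contains [triv]. *)
Definition triv : set (set X) := [set A | measurable A /\ (pr A = 0 \/ pr A = 1)].

Lemma triv_cfactor : cfactor triv.
Proof.
have z2 A B : measurable A -> measurable B -> A `<=` B -> pr B = 0 -> pr A = 0.
  by move=> mA mB AB B0; apply/le_anti; rewrite pr_ge0 andbT -B0 pr_le.
have o2 A B : measurable A -> measurable B -> A `<=` B -> pr A = 1 -> pr B = 1.
  by move=> mA mB AB A1; apply/le_anti; rewrite pr_le1 //= -A1 pr_le.
split.
- split; first by move=> A [].
  split.
  + by split=> //; left; exact: pr_set0.
  + move=> A [mA hA]; rewrite setTD; split; first exact: measurableC.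
    by rewrite prC //; case: hA => ->; [right|left]; rewrite ?subr0 ?subrr.
  + move=> F HF; have mF i : measurable (F i) by case: (HF i).
    have mU : measurable (\bigcup_k F k) by exact: bigcupT_measurable.
    split=> //; case: (pselect (exists i, pr (F i) = 1)) => [[i Fi]|/forallNP nF].
      by right; apply: (o2 (F i)) => //; exact: bigcup_sup.
    left; apply/eqP; rewrite eq_le pr_ge0 andbT; apply/ler_addgt0Pr => e e0; rewrite add0r.
    have [n Hn] := pr_bigcup_approx P e0 mF.
    have U0 k : pr (\big[setU/set0]_(i < k) F i) = 0.
      elim: k => [|k IHk]; first by rewrite big_ord0 pr_set0.
      rewrite big_ord_recr /=; apply/le_anti; rewrite pr_ge0 andbT.
      apply: le_trans (prU_le P _ (mF k)) _; first exact: bigsetU_measurable.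
      by rewrite IHk add0r; case: (HF k) => _ [->//|/nF].
    have mUn : measurable (\big[setU/set0]_(i < n) F i) by exact: bigsetU_measurable.
    have := pr_dist P mU mUn; rewrite U0 subr0 ger0_norm ?pr_ge0 // => h.
    exact: le_trans h (ltW Hn).
- move=> A [mA HA]; split=> //.
  case: (lerP (pr A) (1 / 2)) => h; [left|right].
    apply/eqP; rewrite eq_le pr_ge0 andbT; apply/ler_addgt0Pr => e e0; rewrite add0r.
    (* Below distance 1/4, a set of measure at most 1/2 can only be close to null sets. *)
    pose e' := Num.min e (1 / 4); have e'0 : 0 < e' by rewrite lt_min e0; lra.
    have [B [[mB [hB|hB]] _ AB]] := HA _ e'0; have := pr_dist P mA mB; move: AB.
      rewrite lt_min hB subr0 ger0_norm ?pr_ge0 // => /andP[h1 _] h2.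
      exact: le_trans h2 (ltW h1).
    rewrite lt_min hB ler_norml => /andP[h1 h2] /andP[h3 h4]; lra.
  apply/eqP; rewrite eq_le pr_le1 //=; apply/ler_addgt0Pr => e e0.
  pose e' := Num.min e (1 / 4); have e'0 : 0 < e' by rewrite lt_min e0; lra.
  have [B [[mB [hB|hB]] _ AB]] := HA _ e'0; have := pr_dist P mA mB; move: AB.
    rewrite lt_min hB ler_norml => /andP[h1 h2] /andP[h3 h4]; lra.
  rewrite lt_min hB ler_norml => /andP[h1 h2] /andP[h3 h4]; lra.
- by move=> A [mA hA]; split; [exact: (measurable_preT hT)|rewrite (pr_preT hT)].
- by move=> A [mA hA]; split; [exact: (measurable_preTV hT)|rewrite (pr_preTV hT)].
Qed.

Lemma cfactor_near_sub B G : cfactor B -> G `<=` B -> near P G `<=` B.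
Proof. by move=> [_ nB _ _] /near_mono h; apply: subset_trans nB. Qed.

Lemma cyl_min (e : nat -> X -> bool) F B : cfactor F -> cfactor B -> F `<=` B ->
  (forall a, B [set x | e a x]) -> cyl T Tinv e F `<=` B.
Proof.
move=> cF cB FB eB S [c [N [K [b [Fb h]]]]]; have Ba := cfactor_alg cB.
apply: (fmeas_determined (f := fun x => (window T Tinv e c N x, b x))) => //.
  apply: fmeas_pair => //; last exact: fmeas_sub Fb.
  apply: (fmeas_Tz hT (f := word _ (letter e c)) (- N%:Z) cB).
  by apply: (fmeas_word hT) => //; apply: fmeas_letter.
by move=> x y [/(windowP hT) ag bb]; apply: h.
Qed.

Lemma iid_over1 (F : finType) B (c : X -> F) A v : cfactor B -> iid_over B c -> B A ->
  pr (A `&` c @^-1` [set v]) = pr A * pmf P c v.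
Proof.
move=> cB ic BA; have := ic 1%N [ffun=> v] A BA; rewrite big_ord1 ffunE => <-.
congr (pr (_ `&` _)); apply/seteqP; split=> x /=.
  by move=> cx; apply/word_preE => i; rewrite ffunE (ord1 i).
by move/word_preE => /(_ ord0); rewrite ffunE.
Qed.

Lemma iid_over_sub (F : finType) B B' (c : X -> F) : B' `<=` B -> iid_over B c -> iid_over B' c.
Proof. by move=> BB ic N w A /BB; apply: ic. Qed.

Lemma iid_comp (F G : finType) B (c : X -> F) (h : F -> G) : cfactor B -> mfun c ->
  iid_over B c -> iid_over B (h \o c).
Proof.
move=> cB mc ic N w A BA; have mA := cfactor_meas cB BA.
have mw := mW (N := N) mc.
have mhw : measurable (word N (h \o c) @^-1` [set w]).
  by apply: (mW (f := h \o c)); apply: fmeas_comp => //; exact: measurable_alg.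
rewrite (pr_partition P (measurableI _ _ mA mhw) mw).
transitivity (\sum_(v : {ffun 'I_N -> F} | [forall i,
  h (v i) == w i]) pr A * \prod_i pmf P c (v i)).
  rewrite [RHS]big_mkcond; apply: eq_bigr => v _; case: ifPn => [/forallP hv|/forallPn[i hv]].
    rewrite -ic //; congr pr; apply/seteqP; split=> x /=; first by move=> [[Ax _] wx].
    move=> [Ax wx]; split=> //; split=> //; apply/word_preE => i.
    by move/word_preE: wx => /(_ i) /= ->; exact/eqP.
  rewrite (_ : _ `&` _ = set0) ?pr_set0 //; apply/seteqP; split=> x //=.
  move=> [[_ /word_preE/(_ i) /= wx] /word_preE/(_ i) vx].
  by rewrite -vx wx eqxx in hv.
rewrite -mulr_sumr; congr (_ * _).
transitivity (\prod_i \sum_(u | h u == w i) pmf P c u).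
  rewrite bigA_distr_big_dep; apply: eq_bigl => v.
  by apply/forallP/familyP => hv i; have := hv i; rewrite ?inE.
by apply: eq_bigr => i _; rewrite -pmf_comp.
Qed.

(** This stacks two levels: [b] is first absorbed into the algebra [B] over which [a] is i.i.d.,
    then split off over [B']. *)
Lemma iid_pair (F G : finType) B B' (a : X -> F) (b : X -> G) : cfactor B -> cfactor B' ->
  B' `<=` B -> fmeas B b -> iid_over B a -> iid_over B' b -> iid_over B' (fun x => (a x, b x)).
Proof.
move=> cB cB' BB Bb ia ib N w A BA.
have mb : mfun b by apply: fmeas_sub Bb; exact: cfactor_meas cB.
pose wa : {ffun 'I_N -> F} := [ffun i => (w i).1].
pose wb : {ffun 'I_N -> G} := [ffun i => (w i).2].
have E : A `&` word N (fun x => (a x, b x)) @^-1` [set w] =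
   (A `&` word N b @^-1` [set wb]) `&` word N a @^-1` [set wa].
  apply/seteqP; split=> x /=.
    move=> [Ax /word_preE h]; split; [split=> //|]; apply/word_preE => i;
      by rewrite ffunE -h.
  move=> [[Ax /word_preE h1] /word_preE h2]; split=> //; apply/word_preE => i.
  by rewrite h1 h2 !ffunE -surjective_pairing.
have BW : B (A `&` word N b @^-1` [set wb]).
  apply: alg_setI; [exact: cfactor_alg cB|exact: BB|exact: (fmeas_word hT cB Bb)].
rewrite E ia // ib // -mulrA; congr (_ * _); rewrite -big_split; apply: eq_bigr => i _ /=.
rewrite !ffunE -(iid_over1 _ cB ia (Bb _)) ; congr pr.
by apply/seteqP; split=> x /=; [move=> [-> ->]; rewrite -surjective_pairing|move=> <-].
Qed.

(** Additivity of the entropy of i.i.d. words is the equality case of subadditivity. *)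
Lemma iid_word_split (F : finType) B (c : X -> F) N M : cfactor B -> mfun c ->
  iid_over B c -> forall u v,
  pmf P (fun x => (word N c x, (word M c \o Tz N) x)) (u, v) =
    pmf P (word N c) u * pmf P (word M c \o Tz N) v.
Proof.
move=> cB mc ic; apply: indep_of_entropy; [exact: mW|exact/mTz/mW|].
rewrite (entropy_Tz hT N (mW (N := M) mc)) -(entropy_wordD_iid hT N M mc cB ic).
by rewrite (entropy_wordD hT).
Qed.

Section Tower.
Variables (U B : set (set X)) (u : set X).
Hypotheses (cU : cfactor U) (cB : cfactor B) (Uu : U u) (iu : iid_over B (ind u))
  (u0 : 0 < pr u) (u1 : pr u < 1).
Let mi : mfun (ind u).
Proof. by apply: fmeas_ind; [exact: measurable_alg|exact: (cfactor_meas cU)]. Qed.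
Let c1 L : {ffun 'I_L -> bool} := [ffun=> true].
(** The marker: a run of [L] ones, rare for large [L] and yet almost surely met. *)
Let G L : set X := word L (ind u) @^-1` [set c1 L].
Let UG L : U (G L).
Proof.
apply: (fmeas_word hT cU); apply: fmeas_ind => //; exact: cfactor_alg cU.
Qed.

Lemma pr_run L : pr (G L) = pr u ^+ L.
Proof.
rewrite -[LHS]/(pmf P _ _) (pmf_word _ cB iu).
under eq_bigr do rewrite ffunE.
rewrite big_const_ord iter_mulr_1; congr (_ ^+ _); rewrite /pmf; congr pr.
by apply/seteqP; split=> x /= h; [exact: set_mem|exact: mem_set].
Qed.

(** No run begins at the first [k] multiples of [L]; these runs use disjoint stretches of letters,
    hence are independent. *)
Let S L := fix S k := if k is k'.+1 then ~` G L `&` Tz L @^-1` (S k') else setT.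

Lemma pr_no_run L k : measurable (S L k) /\ pr (S L k) = (1 - pr u ^+ L) ^+ k.
Proof.
suff [p [Ep Hp]] : exists p : pred {ffun 'I_(k * L) -> bool},
    S L k = [set x | p (word (k * L) (ind u) x)] /\ pr (S L k) = (1 - pr u ^+ L) ^+ k.
  by split=> //; rewrite Ep; have [] := pr_fin P p (mW (N := k * L) mi).
elim: k => [|k [p [Ep Hp]]].
  exists xpredT; split; last by rewrite pr_setT.
  by apply/seteqP; split.
have mG : measurable (~` G L) by apply: measurableC; exact: (cfactor_meas cU).
pose q w := `[<exists x, word (k.+1 * L) (ind u) x = w /\ S L k.+1 x>].
have SE : S L k.+1 = [set x | word L (ind u) x != c1 L] `&`
    [set x | p ((word (k * L) (ind u) \o Tz L) x)].
  have -> : S L k.+1 = ~` G L `&` Tz L @^-1` (S L k) by [].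
  rewrite Ep; apply/seteqP; split=> x /= [h1 h2]; split=> //; first exact/eqP.
  by move/eqP: h1.
exists q; split.
  apply/seteqP; split=> x; first by move=> Sx; apply/asboolP; exists x.
  move=> /asboolP[y [h Sy]].
  have [h1 h2] := (wordD T Tinv L (k * L) (ind u) y x).2 h.
  by move: Sy; rewrite SE /= h1 h2.
rewrite SE (pmf_indep_sets (fun w => w != c1 L) p (mW (N := L) mi) (mTz L (mW (N := (k * L)%N) mi))
  (iid_word_split (N := L) (M := (k * L)%N) cB mi iu)).
rewrite exprS; congr (_ * _).
  rewrite -pr_run -prC; last exact: (cfactor_meas cU).
  by congr pr; apply/seteqP; split=> x /= /eqP.
have [mp _] := pr_fin P p (mW (N := k * L) mi).
by rewrite -Hp Ep -(pr_preTz hT L mp).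
Qed.

(* The last marker before [x] is at a time congruent to the level of [x] modulo
   [n], and no marker occurs inside the block. *)
Lemma tower n (eps : R) : (0 < n)%N -> 0 < eps -> exists E, [/\ U E,
  forall x (i j : nat), (i < n)%N -> (j < n)%N -> E (Tz (- i%:Z) x) -> E (Tz (- j%:Z) x) -> i = j &
  pr [set x | forall j : nat, (j < n)%N -> ~ E (Tz (- j%:Z) x)] < eps].
Proof.
move=> n0 e0.
have small (q dl : R) : 0 <= q -> q < 1 -> 0 < dl -> exists k, q ^+ k < dl.
  move=> q0 q1 dl0; have : (fun k => q ^+ k) @ \oo --> (0 : R).
    by apply: cvg_expr; rewrite ger0_norm.
  move=> /cvgrPdist_lt /(_ dl dl0) [k _ /(_ k (leqnn k)) /= h].
  by exists k; move: h; rewrite sub0r normrN ger0_norm // exprn_ge0.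
have nR : 0 < n%:R :> R by rewrite ltr0n.
(* [L] makes a marker inside a block unlikely; then [k] makes a past without markers unlikely. *)
have [L HL] : exists L, n%:R * pr u ^+ L < eps / 2.
  have [|L hL] := small (pr u) (eps / 2 / n%:R) (pr_ge0 P u) u1; first by rewrite !divr_gt0.
  by exists L; rewrite mulrC -ltr_pdivlMr.
have q0 : 0 < pr u ^+ L by rewrite exprn_gt0.
have q1 : pr u ^+ L <= 1 by rewrite exprn_ile1 ?pr_ge0 // ltW.
have [k Hk] : exists k, (1 - pr u ^+ L) ^+ k < eps / 2 by apply: small; lra.
have Ua := cfactor_alg cU; have [sU _ _ _] := cU; have [_ [_ UC UU]] := sU.
have UTz z A : U A -> U (Tz z @^-1` A) by exact: (cfactor_preTz hT z cU).
have mG : measurable (G L) := cfactor_meas cU (UG L).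
pose lastmark x a := G L (Tz (- a%:Z) x) /\ forall i : nat, (i < a)%N -> ~ G L (Tz (- i%:Z) x).
have lm_uniq x a b : lastmark x a -> lastmark x b -> a = b.
  move=> [Ga ha] [Gb hb]; case: (ltngtP a b) => // h; [case: (hb a h)|case: (ha b h)] => //.
pose free x := forall i : nat, (0 < i < n)%N -> ~ G L (Tz i%:Z x).
have lm_shift x a b : lastmark (Tz (- a%:Z) x) b ->
    (forall i : nat, (i < a)%N -> ~ G L (Tz (- i%:Z) x)) -> lastmark x (a + b)%N.
  move=> [Gb hb] ha; split.
    by rewrite PoszD opprD addrC (TzD hT).
  move=> i iab; have [ia|ai] := ltnP i a; first exact: ha.
  have := hb (i - a)%N; rewrite ltn_subLR // => /(_ iab); rewrite -(TzD hT).
  by have -> : - (i - a)%N%:Z - a%:Z = - i%:Z by lia.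
pose E := [set x | (exists l, lastmark x (l * n)%N) /\ free x].
have UE : U E.
  have -> : E = (\bigcup_l ([set x | G L (Tz (- (l * n)%N%:Z) x)] `&`
      [set x | forall i, i \in iota 0 (l * n) -> (~` (Tz (- i%:Z) @^-1` G L)) x])) `&`
      [set x | forall i, i \in iota 1 n.-1 -> (~` (Tz i%:Z @^-1` G L)) x].
    apply/seteqP; split=> x /=.
      move=> [[l [h1 h2]] h3]; split.
        by exists l => //; split=> // i; rewrite mem_iota add0n => /andP[_ il]; apply: h2.
      by move=> i; rewrite mem_iota => hi; apply: h3; lia.
    move=> [[l _ [h1 h2]] h3]; split.
      by exists l; split=> // i il; apply: h2; rewrite mem_iota.
    by move=> i hi; apply: h3; rewrite mem_iota; lia.
  apply: alg_setI => //.
    apply: UU => l; apply: alg_setI => //; first exact: (UTz (- (l * n)%N%:Z) _ (UG L)).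
    by apply: alg_bigI => // i _; rewrite -setTD; apply: UC; apply: UTz; exact: UG.
  by apply: alg_bigI => // i _; rewrite -setTD; apply: UC; apply: UTz; exact: UG.
exists E; split; first exact: UE.
- have main x (i j : nat) : (i < n)%N -> (j < n)%N -> (i < j)%N -> E (Tz (- i%:Z) x) ->
      E (Tz (- j%:Z) x) -> False.
    (* Climbing [j - i < n] levels without meeting a marker adds [j - i] to the age of the last
       marker, which then cannot be a multiple of [n] again. *)
    move=> iN jN ij [[l hl] fi] [[l' hl'] fj].
    have hlm : lastmark (Tz (- i%:Z) x) (j - i + l' * n)%N.
      apply: lm_shift.
        by rewrite -(TzD hT); have -> : - (j - i)%N%:Z - i%:Z = - j%:Z by lia.
      move=> s sji; have := fj (j - i - s)%N; rewrite -!(TzD hT).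
      have -> : (j - i - s)%N%:Z - j%:Z = - s%:Z - i%:Z by lia.
      by apply; lia.
    have := lm_uniq _ _ _ hl hlm.
    move=> /(congr1 (modn^~ n)); rewrite modnMl addnC modnMDl modn_small; lia.
  move=> x i j iN jN Ei Ej; case: (ltngtP i j) => // h; exfalso.
    exact: (main x i j).
  exact: (main x j i).
have mE j : measurable [set x | G L (Tz j%:Z x)] by exact: (measurable_preTz hT j mG).
pose miss := [set x | forall a : nat, ~ G L (Tz (- a%:Z) x)].
have Umiss : U miss.
  have -> : miss = ~` (\bigcup_(a : nat) (Tz (- a%:Z) @^-1` G L)).
    apply/seteqP; split=> x /=; first by move=> h [a _]; apply: h.
    by move=> h a Ga; apply: h; exists a.
  by rewrite -setTD; apply/UC/UU => a; apply: UTz; exact: UG.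
have mmiss : measurable miss := cfactor_meas cU Umiss.
have miss_small : pr miss <= (1 - pr u ^+ L) ^+ k.
  have [mS <-] := pr_no_run L k.
  rewrite -(pr_preTz hT (- (k * L)%N%:Z) mS); apply: pr_le => //.
    exact: (measurable_preTz hT).
  move=> x hx; rewrite /preimage /mkset.
  have : forall s, (s <= k)%N -> S L s (Tz (- (s * L)%N%:Z) x); last exact.
  elim=> [|s IHs] // sk; split; first exact: hx.
  suff : S L s (Tz L%:Z (Tz (- (s.+1 * L)%N%:Z) x)) by [].
  rewrite -(TzD hT).
  have -> : L%:Z - (s.+1 * L)%N%:Z = - (s * L)%N%:Z by lia.
  by apply: IHs; rewrite ltnW.
pose off := [set x | forall j : nat, (j < n)%N -> ~ E (Tz (- j%:Z) x)].
(* A point with last marker of age [a] should be at level [a %% n]. It is off the tower only if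
   there is no such marker, or if a marker among the next [n - 1] times breaks its block. *)
have cover x : off x -> miss x \/ exists i : 'I_n, (0 < i)%N /\ G L (Tz i%:Z x).
  move=> hx; case: (pselect (miss x)) => [|hm]; [by left|right].
  have [a [Ga ha]] : exists a, lastmark x a.
    have /existsNP[a0 /contrapT Ga0] := hm.
    have ex : exists a, `[<G L (Tz (- a%:Z) x)>] by exists a0; apply/asboolP.
    exists (ex_minn ex); case: ex_minnP => m /asboolP Gm hmin; split=> // i im Gi.
    have : (m <= i)%N by apply: hmin; apply/asboolP.
    by rewrite leqNgt im.
  have jn : (a %% n < n)%N by rewrite ltn_mod.
  have := hx _ jn; apply: contra_notP => /forallNP hi; split.
    exists (a %/ n)%N; split.
      by rewrite -(TzD hT); have -> : - (a %/ n * n)%N%:Z - (a %% n)%N%:Z = - a%:Z by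
        rewrite {3}(divn_eq a n); lia.
    move=> i iq; rewrite -(TzD hT); have -> : - i%:Z - (a %% n)%N%:Z = - (i + a %% n)%N%:Z by lia.
    by apply: ha; rewrite {2}(divn_eq a n) ltn_add2r.
  move=> i /andP[i0 iN]; rewrite -(TzD hT).
  have [ia|ai] := leqP i (a %% n).
    have -> : i%:Z - (a %% n)%N%:Z = - (a %% n - i)%N%:Z by lia.
    apply: ha; apply: leq_trans (leq_mod a n); lia.
  have -> : i%:Z - (a %% n)%N%:Z = (i - a %% n)%N%:Z by lia.
  move=> Gi; have ln : (i - a %% n < n)%N by lia.
  by apply: (hi (Ordinal ln)); split=> //=; lia.
have moff : measurable off.
  have -> : off = [set x | forall j, j \in iota 0 n -> (~` (Tz (- j%:Z) @^-1` E)) x].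
    apply/seteqP; split=> x /= h j; first by rewrite mem_iota; apply: h.
    by move=> jn; apply: h; rewrite mem_iota.
  apply: alg_bigI => [|j _]; first exact: measurable_alg.
  by apply/measurableC/(measurable_preTz hT)/(cfactor_meas cU).
pose A (i : option 'I_n) := if i is Some i then Tz i%:Z @^-1` G L else miss.
have mA i : measurable (A i) by case: i => [i|] //; exact: mE.
apply: le_lt_trans (pr_union_le P moff mA _) _.
  move=> x /cover[hx|[i [_ hi]]]; [by exists None|by exists (Some i)].
apply: (@le_lt_trans _ _ (pr miss + \sum_(i < n) pr u ^+ L)).
  rewrite (bigD1 None) //= lerD2l (reindex_onto Some (odflt (Ordinal n0))) /=; last by case.
  rewrite (eq_bigl xpredT) => [|i]; last by rewrite eqxx.
  by apply: ler_sum => i _; rewrite (pr_preTz hT i mG) pr_run.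
by rewrite sumr_const card_ord -mulr_natl; lra.
Qed.

End Tower.
End Iid.

(** * Recoding along a tower *)

Section Recode.
Context (R : realType) (d : measure_display) (X : measurableType d)
        (P : probability X R) (T Tinv : X -> X).
Hypothesis hT : invertible_mp P T Tinv.
Local Notation pr := (pr P).
Local Notation mfun f := (fmeas measurable f).
Local Notation Tz := (iterz T Tinv).
Local Notation word := (word T).
Local Notation iid_over := (iid_over P T).
Local Notation cfactor := (cfactor P T Tinv).
Local Notation mW := (mfun_word hT).

Variables (K A : finType) (n : nat) (E : set X) (b : X -> K).
Hypothesis disj : forall x (i j : nat), (i < n)%N -> (j < n)%N ->
  E (Tz (- i%:Z) x) -> E (Tz (- j%:Z) x) -> i = j.

Definition pos x : option 'I_n := [pick j : 'I_n | `[<E (Tz (- j%:Z) x)>]].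

Lemma posP x (j : 'I_n) : E (Tz (- j%:Z) x) -> pos x = Some j.
Proof.
move=> Ej; rewrite /pos; case: pickP => [i /asboolP Ei|/(_ j)/negP[]]; last exact/asboolP.
by congr Some; apply: val_inj; apply: (disj (ltn_ord i) (ltn_ord j) Ei Ej).
Qed.

Lemma pos_inv x j : pos x = Some j -> E (Tz (- j%:Z) x).
Proof. by rewrite /pos; case: pickP => // i /asboolP Ei [<-]. Qed.

Lemma pos_level y (i : 'I_n) : E y -> pos (Tz i%:Z y) = Some i.
Proof. by move=> Ey; apply: posP; rewrite (TzK hT). Qed.

(** A map of points rather than of words: composing with it permutes all the bits of a block
    together, including those that [al] does not see. Points off the tower are fixed. *)
Definition recode (al : X -> A) (sg : {ffun 'I_n -> K} -> {ffun 'I_n -> A} -> 'S_n) (x : X) : X :=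
  if pos x is Some j then
    let y := Tz (- j%:Z) x in Tz (sg (word n b y) (word n al y) j : nat)%:Z y
  else x.

Lemma recode_level al sg y (i : 'I_n) : E y ->
  recode al sg (Tz i%:Z y) = Tz (sg (word n b y) (word n al y) i : nat)%:Z y.
Proof. by move=> Ey; rewrite /recode pos_level // (TzK hT). Qed.

Lemma word_recode (G : finType) al sg (f : X -> G) y : E y ->
  word n (f \o recode al sg) y = wperm (word n f y) (sg (word n b y) (word n al y)).
Proof.
move=> Ey; apply/ffunP=> i; rewrite !ffunE /= -(Tz_nat T Tinv) recode_level //.
Qed.

(* Recoding is inverted by a recoding of the same form. *)
Definition sginv (sg : {ffun 'I_n -> K} -> {ffun 'I_n -> A} -> 'S_n) k (q' : {ffun 'I_n -> A}) :
    'S_n :=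
  if [pick q | wperm q (sg k q) == q'] is Some q then (sg k q)^-1%g else 1%g.

Lemma sginvE sg k q : injective (fun w => wperm w (sg k w)) ->
  sginv sg k (wperm q (sg k q)) = (sg k q)^-1%g.
Proof.
move=> sgi; rewrite /sginv; case: pickP => [q' /eqP/sgi -> //|/(_ q)].
by rewrite eqxx.
Qed.

Lemma recodeK al sg : (forall k, injective (fun w => wperm w (sg k w))) ->
  forall x, recode al sg (recode (al \o recode al sg) (sginv sg) x) = x.
Proof.
move=> sgi x; rewrite {2}/recode; case Ex: (pos x) => [j|]; last by rewrite /recode Ex.
have Ey := pos_inv Ex; set y := Tz (- j%:Z) x in Ey *; cbv zeta.
rewrite word_recode // sginvE // recode_level // permKV /y.
by rewrite (TzNK hT).
Qed.

Lemma recode_bits B (al : X -> A) sg (e : X -> bool) : cfactor B -> B E -> fmeas B b ->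
  fmeas B al -> B [set x | e x] -> B [set x | e (recode al sg x)].
Proof.
move=> cB BE Bb Bal Be; have Ba := cfactor_alg cB.
have Bf z (G : finType) (f : X -> G) : fmeas B f -> fmeas B (f \o Tz z).
  by move=> hf; exact: (fmeas_Tz hT z cB hf).
have BeE : fmeas B (fun x => `[<E x>]) by exact: fmeas_bool.
have Bee : fmeas B e.
  have := fmeas_bool Ba Be; congr (fmeas B _).
  by apply/funext => x; apply/asboolP/idP.
pose D x := ([ffun j : 'I_n => `[<E (Tz (- j%:Z) x)>]],
  ([ffun j : 'I_n => (word n b (Tz (- j%:Z) x), word n al (Tz (- j%:Z) x))],
  ([ffun j : 'I_n => [ffun i : 'I_n => e (Tz i%:Z (Tz (- j%:Z) x))]], e x))).
have BD : fmeas B D.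
  apply: fmeas_pair => //; first by apply: fmeas_ffun => // j; exact: (Bf (- j%:Z) _ _ BeE).
  apply: fmeas_pair => //.
    apply: fmeas_ffun => // j; apply: fmeas_pair => //.
      exact: (Bf (- j%:Z) _ _ (fmeas_word hT cB Bb)).
    exact: (Bf (- j%:Z) _ _ (fmeas_word hT cB Bal)).
  apply: fmeas_pair => //; apply: fmeas_ffun => // j; apply: fmeas_ffun => // i.
  exact: (Bf (- j%:Z) _ _ (Bf i%:Z _ _ Bee)).
apply: (fmeas_determined Ba BD) => x y [/ffunP h1 /ffunP h2 /ffunP h3 h4].
have pp : pos x = pos y.
  by apply: eq_pick => j; have := h1 j; rewrite !ffunE.
rewrite /mkset /recode pp; case: (pos y) => [j|]; last by rewrite h4.
have := h2 j; rewrite !ffunE => -[-> ->].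
have := h3 j; rewrite !ffunE => /ffunP h3j; cbv zeta; set i := sg _ _ j.
by have := h3j i; rewrite !ffunE => ->.
Qed.

Section RecodeIid.
Variables (F : set (set X)) (A2 : finType) (al2 : X -> A2) (h : A2 -> A)
  (sg : {ffun 'I_n -> K} -> {ffun 'I_n -> A} -> 'S_n).
Hypotheses (cF : cfactor F) (FE : F E) (Fb : fmeas F b) (mal2 : mfun al2)
  (ial2 : iid_over F al2) (sgi : forall k, injective (fun w => wperm w (sg k w))).

(** * Recoding a finite word while the tower and the [b]-names are frozen at those of [z] *)

Section Words.
Variables (m : nat) (z : X).
Local Notation W := {ffun 'I_m.+1 -> A2}.

(** Position of time [i] in its block. Blocks not wholly inside the window of [m.+1] letters are
    ignored, so that recoding maps words of the window to words of the window. *)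
Definition start (i : nat) : option 'I_n :=
  [pick j : 'I_n | [&& (j <= i)%N, (i - j + n <= m.+1)%N & `[<E (iter (i - j) T z)>]]].

Definition subw (v : W) (s : nat) : {ffun 'I_n -> A} := [ffun j : 'I_n => h (v (inord (s + j)))].

Definition bperm (v : W) s : 'S_n := sg (word n b (iter s T z)) (subw v s).

Definition bpos (v : W) (i : 'I_m.+1) : 'I_m.+1 :=
  if start i is Some j then inord (i - j + bperm v (i - j) j) else i.

Definition recodew (v : W) : W := [ffun i => v (bpos v i)].

Lemma start_level s (j : 'I_n) : (s + n <= m.+1)%N -> E (iter s T z) -> start (s + j) = Some j.
Proof.
move=> sn Es; rewrite /start; case: pickP => [i /and3P[ij _ /asboolP Ei]|/(_ j)]; last first.
  by rewrite leq_addl addnK sn /= => /asboolP.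
congr Some; apply: val_inj; apply: (@disj (iter (s + j) T z) _ _ (ltn_ord i) (ltn_ord j)).
  by rewrite -(Tz_nat T Tinv) -(TzD hT); have -> : - i%:Z + (s + j)%N%:Z = (s + j - i)%N%:Z by lia.
by rewrite -(Tz_nat T Tinv) -(TzD hT); have -> : - j%:Z + (s + j)%N%:Z = s%:Z by lia.
Qed.

Lemma start_inv i j : start i = Some j ->
  [/\ (j <= i)%N, (i - j + n <= m.+1)%N & E (iter (i - j) T z)].
Proof. by rewrite /start; case: pickP => // ? /and3P[? ? /asboolP ?] [<-]. Qed.

Lemma bpos_level v s (j : 'I_n) : (s + n <= m.+1)%N -> E (iter s T z) ->
  bpos v (inord (s + j)) = inord (s + bperm v s j).
Proof.
move=> sn Es; have sj : (s + j < m.+1)%N by have := ltn_ord j; lia.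
by rewrite /bpos inordK // start_level // addnK.
Qed.

Lemma start_bpos v (i : 'I_m.+1) (j : 'I_n) : start i = Some j ->
  start (bpos v i) = Some (bperm v (i - j) j).
Proof.
move=> ij; have [ji sn Es] := start_inv ij; rewrite /bpos ij.
have lt : (i - j + bperm v (i - j) j < m.+1)%N by have := ltn_ord (bperm v (i - j) j); lia.
by rewrite inordK // start_level.
Qed.

Lemma bpos_inj v : injective (bpos v).
Proof.
move=> i1 i2 e12.
case E1: (start i1) => [j1|]; case E2: (start i2) => [j2|].
- have := start_bpos v E1; rewrite e12 (start_bpos v E2) => -[e].
  have [j1i n1 _] := start_inv E1; have [j2i n2 _] := start_inv E2.
  move: e12; rewrite /bpos E1 E2 => /(congr1 val) /=.
  have l1 := ltn_ord (bperm v (i1 - j1) j1); have l2 := ltn_ord (bperm v (i2 - j2) j2).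
  rewrite !inordK; [|lia|lia]; rewrite e => e'.
  have es : (i1 - j1 = i2 - j2)%N by lia.
  move: e; rewrite es => /perm_inj ej; apply: val_inj => /=.
  by rewrite -(subnK j1i) -(subnK j2i) es ej.
- by have := start_bpos v E1; rewrite e12 /bpos E2 E2.
- by have := start_bpos v E2; rewrite -e12 /bpos E1 E1.
- by move: e12; rewrite /bpos E1 E2.
Qed.

Lemma pwr_recodew (p : A2 -> R) v : pwr p (recodew v) = pwr p v.
Proof.
rewrite /pwr [RHS](reindex_inj (@bpos_inj v)) /=.
by apply: eq_bigr => i _; rewrite ffunE.
Qed.

Lemma subw_recodew v s : (s + n <= m.+1)%N -> E (iter s T z) ->
  subw (recodew v) s = wperm (subw v s) (bperm v s).
Proof.
by move=> sn Es; apply/ffunP=> j; rewrite !ffunE bpos_level.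
Qed.

Lemma recodew_inj : injective recodew.
Proof.
move=> v v' vv'; apply/ffunP => i.
case E1: (start i) => [j|]; last first.
  by have := congr1 (fun w : W => w i) vv'; rewrite !ffunE /bpos E1.
have [ji sn Es] := start_inv E1.
(* Injectivity of the block map first recovers the coarse letters of the block; these determine the
   permutation, and undoing it recovers the fine letters. *)
have qq : subw v (i - j) = subw v' (i - j).
  apply: (sgi (k := word n b (iter (i - j) T z))).
  by have := subw_recodew v sn Es; rewrite vv' subw_recodew.
have bb : bperm v (i - j) = bperm v' (i - j) by rewrite /bperm qq.
pose j' := ((bperm v (i - j))^-1)%g j.
have := congr1 (fun w : W => w (inord (i - j + j'))) vv'.
rewrite !ffunE !bpos_level // -bb /j' permKV.
by rewrite subnK // inord_val.
Qed.

(** A block through a time at distance [n] from both ends lies inside the window, so there the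
    truncated recoding is the true one. *)
Lemma recodew_word x (i : 'I_m.+1) : (n <= i)%N -> (i + n <= m.+1)%N ->
  (forall s, (s < m.+1)%N -> (E (iter s T x) <-> E (iter s T z)) /\ b (iter s T x) = b (iter s T
    z)) ->
  recodew (word m.+1 al2 x) i = al2 (recode (h \o al2) sg (iter i T x)).
Proof.
move=> ni im xz; rewrite ffunE /bpos.
have back (j : 'I_n) : Tz (- j%:Z) (iter i T x) = iter (i - j) T x.
  rewrite -(Tz_nat T Tinv) -(TzD hT); have -> : - j%:Z + i%:Z = (i - j)%N%:Z by have := ltn_ord j;
    lia.
  by [].
have lts (j : 'I_n) : (i - j < m.+1)%N by have := ltn_ord i; lia.
have sp : start i = pos (iter i T x).
  apply: eq_pick => j; rewrite back; have jn := ltn_ord j.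
  have -> : (j <= i)%N by lia.
  have -> : (i - j + n <= m.+1)%N by lia.
  by apply/asboolP/asboolP => /(xz _ (lts j)).1.
rewrite /recode -sp; case Es: (start i) => [j|]; last by rewrite ffunE.
have [ji sn _] := start_inv Es; rewrite back; cbv zeta.
have wb : word n b (iter (i - j) T x) = word n b (iter (i - j) T z).
  apply/word_eq => s sl; rewrite -!iterD; apply: (xz _ _).2; lia.
have wq : subw (word m.+1 al2 x) (i - j) = word n (h \o al2) (iter (i - j) T x).
  apply/ffunP=> s; rewrite !ffunE inordK; last by have := ltn_ord s; lia.
  by rewrite addnC iterD.
rewrite /bperm wq -wb; set k := sg _ _ j; rewrite ffunE inordK; last by have := ltn_ord k; lia.
by rewrite addnC iterD.
Qed.

End Words.

(** Once the data read off [F] are fixed, recoding is a bijection of words that preserves their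
    product probability, so the letters keep their law on every event of [F]. *)
Lemma iid_recode : iid_over F (al2 \o recode (h \o al2) sg).
Proof.
have Fa := cfactor_alg cF; have Fm := cfactor_meas cF.
have mb : mfun b by exact: fmeas_sub Fb.
pose f' := al2 \o recode (h \o al2) sg.
have mf' : mfun f'.
  move=> v; have mv : measurable [set x | al2 x == v].
    by have := mal2 v; congr (measurable _); apply/seteqP; split=> x /= /eqP.
  have mhal : mfun (h \o al2) by apply: fmeas_comp => //; exact: measurable_alg.
  have := recode_bits sg (measurable_cfactor hT) (Fm _ FE) mb mhal mv.
  by congr (measurable _); apply/seteqP; split=> x /= /eqP.
(* The word is read from time [n] on, so that with [m = n + N + n] every block meeting it lies in
   the window. *)
have main N (w : {ffun 'I_N -> A2}) B : F B ->
    pr (B `&` Tz n%:Z @^-1` (word N f' @^-1` [set w])) = pr B * \prod_i pmf P al2 (w i).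
  move=> FB; have mB := Fm _ FB.
  pose m := (n + N + n)%N.
  pose V := word m.+1 al2; have mV : mfun V := mW mal2.
  pose KD x := ([ffun i : 'I_m.+1 => `[<E (iter i T x)>]], word m.+1 b x).
  have FKD : fmeas F KD.
    apply: fmeas_pair => //; last exact: (fmeas_word hT cF Fb).
    apply: fmeas_ffun => // i; apply: fmeas_bool => //.
    exact: (cfactor_preTz hT i%:Z cF FE).
  have mKD : mfun KD by exact: fmeas_sub FKD.
  pose Z0 (v : {ffun 'I_m.+1 -> A2}) := [forall i : 'I_N, v (inord (n + i)) == w i].
  have inI (i : 'I_N) : (n + i < m.+1)%N by have := ltn_ord i; rewrite /m; lia.
  (* Used twice: with [th = id] for the original letters, and with [th = recodew z] for the recoded
     ones. A bijection preserving the weights does not change the total weight of [Z0]. *)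
  have key B' (th : {ffun 'I_m.+1 -> A2} -> {ffun 'I_m.+1 -> A2}) S : F B' -> injective th ->
      (forall v, pwr (pmf P al2) (th v) = pwr (pmf P al2) v) ->
      (forall x, B' x -> S x <-> Z0 (th (V x))) -> measurable S ->
      pr (B' `&` S) = pr B' * \sum_(v | Z0 v) pwr (pmf P al2) v.
    move=> FB' thi thp hS mS; have mB' := Fm _ FB'.
    rewrite (pr_partition P (measurableI _ _ mB' mS) mV).
    rewrite [in RHS](reindex_inj thi) /= mulr_sumr [RHS]big_mkcond; apply: eq_bigr => v _.
    rewrite thp; case: ifPn => hv.
      rewrite -ial2 //; congr pr; apply/seteqP; split=> x /=; first by move=> [[]].
      by move=> [Bx Vx]; split=> //; split=> //; apply/hS => //; rewrite /V Vx.
    rewrite (_ : _ `&` _ = set0) ?pr_set0 //; apply/seteqP; split=> x //=.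
    move=> [[Bx Sx] Vx]; have := (hS x Bx).1 Sx; rewrite Vx => Zv.
    by rewrite Zv in hv.
  have mS0 : measurable (Tz n%:Z @^-1` (word N al2 @^-1` [set w])).
    exact/(measurable_preTz hT)/(mW mal2).
  have q0 : \sum_(v | Z0 v) pwr (pmf P al2) v = \prod_i pmf P al2 (w i).
    have FT : F setT by case: Fa.
    have := key setT id (Tz n%:Z @^-1` (word N al2 @^-1` [set w])) FT (fun _ _ h => h) (fun=>
      erefl).
    rewrite pr_setT mul1r setTI (pr_preTz hT) ?(pmf_word _ cF ial2); last exact: (mW mal2).
    move=> <- //; last first.
      move=> x _; split.
        move=> /word_preE hx; apply/forallP => i; rewrite ffunE inordK //.
        by rewrite -hx -(Tz_nat T Tinv) addnC PoszD (TzD hT).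
      move=> /forallP hx; apply/word_preE => i; have /eqP <- := hx i.
      by rewrite ffunE inordK // addnC iterD.
    rewrite -[RHS](pmf_word _ cF ial2) //.
  (* On each atom of [KD], the tower and the [b]-names along the window, the recoding is one fixed
     bijection. *)
  rewrite -q0 (pr_partition P mB mKD) mulr_suml.
  have mS : measurable (Tz n%:Z @^-1` (word N f' @^-1` [set w])).
    exact/(measurable_preTz hT)/(mW mf').
  rewrite (pr_partition P (measurableI _ _ mB mS) mKD); apply: eq_bigr => k _.
  rewrite setIAC; case: (pselect (exists z, KD z = k)) => [[z zk]|nz]; last first.
    have -> : B `&` KD @^-1` [set k] = set0.
      by apply/seteqP; split=> x //= [_ kx]; apply: nz; exists x.
    by rewrite set0I pr_set0 mul0r.
  apply: (key _ (recodew (m := m) z)) => //.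
  - by apply: alg_setI.
  - exact: recodew_inj.
  - exact: pwr_recodew.
  move=> x [_ kx]; have kz : KD x = KD z by rewrite zk.
  case: kz => /ffunP k1 /word_eq k2.
  have hx s : (s < m.+1)%N -> (E (iter s T x) <-> E (iter s T z)) /\ b (iter s T x) = b (iter s T
    z).
    move=> sm; split; last exact: k2.
    have := k1 (Ordinal sm); rewrite !ffunE /= => e.
    by split=> /asboolP h1; apply/asboolP; [rewrite -e|rewrite e].
  have EQ (i : 'I_N) : recodew z (V x) (inord (n + i)) = f' (iter (n + i) T x).
    have := @recodew_word m z x (inord (n + i)); rewrite inordK // => -> //; first exact: leq_addr.
    by have := ltn_ord i; rewrite /m; lia.
  split.
    move=> /word_preE hw; apply/forallP => i; rewrite EQ -hw.
    by rewrite -(Tz_nat T Tinv) addnC PoszD (TzD hT).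
  move=> /forallP hw; apply/word_preE => i; have /eqP <- := hw i.
  by rewrite EQ addnC iterD.
have pE v : pmf P f' v = pmf P al2 v.
  have FT : F setT by case: Fa.
  have := main 1%N [ffun=> v] _ FT.
  rewrite pr_setT mul1r setTI (pr_preTz hT); last exact: (mW mf').
  rewrite big_ord1 ffunE => <-; congr pr; apply/seteqP; split=> x /=.
    by move=> fx; apply/word_preE => i; rewrite ffunE (ord1 i).
  by move/word_preE => /(_ ord0); rewrite ffunE.
move=> N w B FB; have mB := Fm _ FB.
have mw : measurable (word N f' @^-1` [set w]) := mW mf' _.
rewrite -(pr_preTz hT n%:Z (measurableI _ _ mB mw)) preimage_setI main.
  rewrite (pr_preTz hT) //; congr (_ * _); apply: eq_bigr => i _.
  by rewrite -pE.
exact: (cfactor_preTz hT).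
Qed.

End RecodeIid.
End Recode.

Lemma exists_nat_gt (R : realType) (x : R) : exists N, forall n, (N <= n)%N -> x < n%:R.
Proof.
exists (Num.bound `|x|) => n hn; apply: le_lt_trans (ler_norm x) _.
by apply: lt_le_trans (archi_boundP _) _; rewrite ?ler_nat.
Qed.

Lemma ln_nat_small (R : realType) (dl : R) : 0 < dl ->
  exists N, forall n, (N <= n)%N -> ln n.+1%:R <= dl * n%:R.
Proof.
(* As [n >= 1], half of [dl * n] pays for [n.+1 * eta], the other half for [- ln eta]. *)
move=> dl0; pose eta := dl / 4; have eta0 : 0 < eta by rewrite /eta; lra.
have [N HN] := exists_nat_gt (2 * `|ln eta| / dl).
exists N.+1 => n hn.
have n0 : 1 <= n%:R :> R by rewrite (ler_nat R 1); lia.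
have h1 : ln (n.+1%:R * eta) < n.+1%:R * eta by apply: ln_sublinear; rewrite mulr_gt0.
rewrite lnM ?posrE // in h1.
have h2 : 2 * `|ln eta| <= dl * n%:R.
  by have := HN n (ltnW hn); rewrite ltr_pdivrMr // [_ * dl]mulrC => /ltW.
have h3 : - ln eta <= `|ln eta| by rewrite -normrN ler_norm.
have h4 : n.+1%:R * eta <= dl * n%:R / 2.
  by rewrite -natr1 /eta; have := mulr_ge0 (ltW dl0) (_ : 0 <= n%:R - 1); lra.
lra.
Qed.

(** * Predicting the labels of a block from its letters *)

Section BlockPredictor.
Variables (R : realType) (A L1 L2 K : finType) (n r : nat)
  (f : {ffun 'I_(2 * r).+1 -> A} -> K -> L1) (rs : A -> L2) (l0 : L1).

Definition interior (i : nat) := (r <= i)%N && (i + r < n)%N.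

(* Near the ends of the block the window is not available, and the default
   prediction [l0] is used. *)
Definition predict (k : {ffun 'I_n -> K}) (w : {ffun 'I_n -> A}) : {ffun 'I_n -> L1 * L2} :=
  [ffun i : 'I_n => (if interior i then
      f [ffun j : 'I_(2 * r).+1 => w (insubd i (i - r + j)%N)] (k i) else l0, rs (w i))].

(** A letter enters only the at most [2 * r + 1] predictions at distance at most [r]. *)
Lemma predict_lipschitz k w w' :
  ham R (predict k w) (predict k w') <= (2 * r).+1%:R * ham R w w'.
Proof.
pose close (i i' : 'I_n) := (i' <= i + r)%N && (i <= i' + r)%N.
have h1 i : (predict k w i != predict k w' i)%:R <=
    \sum_i' (close i i' && (w i' != w' i'))%:R :> R.
  case: eqP => [_|]; first by apply: sumr_ge0.
  have [/existsP[i' hi']|/existsPn hn] := boolP [exists i', close i i' && (w i' != w' i')].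
    by move=> _; rewrite (bigD1 i') //= hi' lerDl sumr_ge0.
  have e i' : close i i' -> w i' = w' i'.
    by move=> ci; have := hn i'; rewrite ci /= negbK => /eqP.
  case; rewrite !ffunE e /close ?leq_addr //; congr pair; case: ifP => // /andP[ri irn].
  congr f; apply/ffunP=> j; rewrite !ffunE; apply: e; have := ltn_ord j => hj.
  rewrite /close val_insubd; case: ifP => _ /=; lia.
apply: le_trans (ler_sum _ (fun i _ => h1 i)) _.
rewrite exchange_big /= mulr_sumr; apply: ler_sum => i' _.
case: (eqVneq (w i') (w' i')) => [_|_]; first by rewrite mulr0 big1 // => i _; rewrite andbF.
under eq_bigr do rewrite andbT.
rewrite mulr1 -natr_sum ler_nat -big_mkcond /= sum1_card -[leqRHS]card_ord.
apply: (@leq_card_in _ _ (fun i : 'I_n => inord (i + r - i') : 'I_(2 * r).+1)).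
move=> i j; rewrite -!topredE /= => /andP[c1 c2] /andP[c3 c4] /(congr1 val) /=.
by rewrite !inordK; [move=> e; apply: val_inj => /=; lia|lia|lia].
Qed.

End BlockPredictor.

(** * Sequences of bits recoded along a tower *)

Section RecodeStep.
Context (R : realType) (d : measure_display) (X : measurableType d)
        (P : probability X R) (T Tinv : X -> X).
Hypothesis hT : invertible_mp P T Tinv.
Local Notation pr := (pr P).
Local Notation mfun f := (fmeas measurable f).
Local Notation Tz := (iterz T Tinv).
Local Notation iid_over := (iid_over P T).
Local Notation cfactor := (cfactor P T Tinv).
Local Notation cyl := (cyl T Tinv).

Lemma cyl_fun (e : nat -> X -> bool) F (L : finType) (g : X -> L) : cfactor F ->
  fmeas (cyl e F) g ->
  exists c N (K : finType) (b : X -> K), fmeas F b /\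
    forall x y, agree T Tinv e c N x y -> b x = b y -> g x = g y.
Proof.
move=> cF mg; have Fa := cfactor_alg cF.
suff H (s : seq L) : exists c N (K : finType) (b : X -> K), fmeas F b /\
    forall x y, agree T Tinv e c N x y -> b x = b y -> forall v, v \in s -> g x = v -> g y = v.
  have [c [N [K [b [Fb h]]]]] := H (enum L); exists c, N, K, b; split=> // x y ag bb.
  by rewrite (h x y ag bb (g x)) // mem_enum.
elim: s => [|v s [c [N [K [b [Fb h]]]]]].
  exists 0%N, 0%N, unit, (fun=> tt); split=> // v.
  have -> : (fun=> tt) @^-1` [set v] = [set: X] by apply/seteqP; split=> x //=; case: v.
  by case: Fa.
have [c' [N' [K' [b' [Fb' h']]]]] := mg v.
exists (maxn c c'), (maxn N N'), (K * K')%type, (fun x => (b x, b' x)).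
split; first exact: fmeas_pair.
move=> x y ag [bb bb'] u; rewrite in_cons => /orP[/eqP->|us]; last first.
  by apply: h us => //; apply: agree_le ag; rewrite leq_maxl.
by apply: h' => //; apply: agree_le ag; rewrite leq_maxr.
Qed.

Lemma pr_part (L : finType) (f : X -> L) S (p : pred L) : measurable S -> mfun f ->
  pr (S `&` [set x | p (f x)]) = \sum_(v | p v) pr (S `&` f @^-1` [set v]).
Proof.
move=> mS mf; have [mp _] := pr_fin P p mf.
rewrite (pr_partition P (measurableI _ _ mS mp) mf) [RHS]big_mkcond; apply: eq_bigr => v _.
case: ifPn => pv.
  congr pr; apply/seteqP; split=> x /=; first by move=> [[]].
  by move=> [Sx fx]; rewrite fx.
rewrite (_ : _ `&` _ = set0) ?pr_set0 //; apply/seteqP; split=> x //= [[_ px] fx].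
by rewrite fx (negPf pv) in px.
Qed.

Section Tower.
Variables (n : nat) (E : set X).
Hypotheses (mE : measurable E) (disj : forall x (i j : nat), (i < n)%N -> (j < n)%N ->
  E (Tz (- i%:Z) x) -> E (Tz (- j%:Z) x) -> i = j).

Lemma sum_levels_le S : measurable S ->
  \sum_(j < n) pr (Tz (- j%:Z) @^-1` E `&` S) <= pr S.
Proof.
move=> mS.
have mTE (j : 'I_n) : measurable (Tz (- j%:Z) @^-1` E) by exact: (measurable_preTz hT).
pose D x := [ffun j : 'I_n => `[<E (Tz (- j%:Z) x)>]].
have mD : mfun D.
  apply: fmeas_ffun => [|j]; first exact: measurable_alg.
  exact: (fmeas_bool (measurable_alg X) (mTE j)).
pose h (D : {ffun 'I_n -> bool}) := [pick j : 'I_n | D j].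
have mpos : mfun (h \o D) by apply: fmeas_comp => //; exact: measurable_alg.
have hpos x (j : 'I_n) : E (Tz (- j%:Z) x) <-> (h \o D) x = Some j.
  rewrite /= /h; case: pickP => [i|hn]; rewrite ?ffunE.
    move=> /asboolP Ei; split=> [Ej|[<-] //]; congr Some; apply: val_inj.
    exact: (disj (ltn_ord i) (ltn_ord j) Ei Ej).
  by split=> // Ej; have := hn j; rewrite ffunE => /asboolP.
rewrite (pr_partition P mS mpos) (bigD1 None) //=.
rewrite -[leLHS]add0r lerD ?pr_ge0 //.
rewrite [leRHS](reindex_omap Some id) /=; last by case.
rewrite le_eqVlt; apply/orP; left; apply/eqP; apply: eq_big => [j|j _]; first by rewrite eqxx.
rewrite setIC; congr (pr (_ `&` _)); apply/seteqP; split=> x; first by move/hpos.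
by move=> /hpos.
Qed.

End Tower.

Section RecodedBits.
Variables (K : finType) (n c : nat) (E : set X) (b : X -> K) (F : set (set X))
  (e : nat -> X -> bool)
  (sg : {ffun 'I_n -> K} -> {ffun 'I_n -> {ffun 'I_c -> bool}} -> 'S_n).
Hypotheses (disj : forall x (i j : nat), (i < n)%N -> (j < n)%N ->
    E (Tz (- i%:Z) x) -> E (Tz (- j%:Z) x) -> i = j)
  (cF : cfactor F) (FE : F E) (Fb : fmeas F b) (me : mbits e)
  (ie : forall c, iid_over F (letter e c)) (ge : (@measurable d X) `<=` near P (cyl e F))
  (sgi : forall k, injective (fun w => wperm w (sg k w))).
Let al := letter e c.
Definition recoded_bits a x := e a (recode T Tinv E b al sg x).

Lemma letter_recoded c' : letter recoded_bits c' = letter e c' \o recode T Tinv E b al sg.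
Proof. by apply/funext => x; apply/ffunP => a; rewrite !ffunE. Qed.

Lemma recoded_bits_in B : cfactor B -> B E -> fmeas B b -> (forall a, B [set x | e a x]) ->
  forall a, B [set x | recoded_bits a x].
Proof.
move=> cB BE Bb Be a.
exact: (recode_bits hT sg cB BE Bb (fmeas_letter (cfactor_alg cB) Be) (Be a)).
Qed.

Lemma mbits_recoded : mbits recoded_bits.
Proof.
have Fm := cfactor_meas cF.
exact: (recoded_bits_in (measurable_cfactor hT) (Fm _ FE) (fmeas_sub Fm Fb) me).
Qed.

(** The permutation reads [c] bits but moves all of them, so [iid_recode] is applied with the finer
    alphabet of [maxn c c'] bits. *)
Lemma iid_recoded c' : iid_over F (letter recoded_bits c').
Proof.
pose c2 := maxn c c'; have cc2 : (c <= c2)%N by rewrite leq_maxl.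
have cc2' : (c' <= c2)%N by rewrite leq_maxr.
pose h (w : {ffun 'I_c2 -> bool}) : {ffun 'I_c -> bool} := [ffun a => w (widen_ord cc2 a)].
pose h' (w : {ffun 'I_c2 -> bool}) : {ffun 'I_c' -> bool} := [ffun a => w (widen_ord cc2' a)].
have hE : h \o letter e c2 = al.
  by apply/funext => x; apply/ffunP => a; rewrite !ffunE.
have h'E : h' \o letter recoded_bits c2 = letter recoded_bits c'.
  by apply/funext => x; apply/ffunP => a; rewrite !ffunE.
have := iid_recode hT disj h cF FE Fb (mfun_letter me) (@ie c2) sgi.
rewrite hE -letter_recoded => i2; rewrite -h'E; apply: (iid_comp hT) => //.
exact/mfun_letter/mbits_recoded.
Qed.

(** The inverse recoding reads only the new letters and data of [F], so the old bits are recovered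
    from the new ones together with [F]. *)
Lemma gen_recoded : (@measurable d X) `<=` near P (cyl recoded_bits F).
Proof.
have me' := mbits_recoded; have cc := cyl_cfactor hT me' cF.
have cm : cyl recoded_bits F `<=` measurable by case: (cyl_alg hT me' cF).
have Fc : F `<=` near P (cyl recoded_bits F).
  by apply: subset_trans (cyl_sub T Tinv _ (cfactor_alg cF)) _; exact: near_sub.
apply: subset_trans ge _; apply: (cfactor_near_sub cc); apply: (cyl_min hT) => // a.
have ec a' : near P (cyl recoded_bits F) [set x | recoded_bits a' x].
  by apply: near_sub => //; apply: cyl_bit; exact: cfactor_alg cF.
have lc : fmeas (near P (cyl recoded_bits F)) (letter recoded_bits c).
  by apply: fmeas_letter => //; exact: cfactor_alg cc.
have := recode_bits hT (sginv sg) cc (Fc _ FE) (fmeas_sub Fc Fb) lc (ec a).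
congr (near P _ _); apply/seteqP; split=> x; rewrite /mkset /recoded_bits.
  by rewrite letter_recoded (recodeK hT).
by rewrite letter_recoded (recodeK hT).
Qed.

End RecodedBits.

End RecodeStep.

(** * One recoding step and its error estimates *)

Section RecodeStep2.
Context (R : realType) (d : measure_display) (X : measurableType d)
        (P : probability X R) (T Tinv : X -> X).
Hypothesis hT : invertible_mp P T Tinv.
Local Notation pr := (pr P).
Local Notation mfun f := (fmeas measurable f).
Local Notation Tz := (iterz T Tinv).
Local Notation word := (word T).
Local Notation iid_over := (iid_over P T).
Local Notation cfactor := (cfactor P T Tinv).
Local Notation mW := (mfun_word hT).
Local Notation cyl := (cyl T Tinv).

Lemma window_word e c r n y (j : 'I_n) : interior n r j ->
  [ffun i : 'I_(2 * r).+1 => word n (letter e c) y (insubd j (j - r + i)%N)] =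
    window T Tinv e c r (iter j T y).
Proof.
move=> /andP[rj jrn]; apply/ffunP=> i; rewrite !ffunE val_insubd.
have hi := ltn_ord i; have -> : (j - r + i < n)%N by lia.
rewrite -!(Tz_nat T Tinv) -!(TzD hT); congr (letter _ _ (Tz _ _)); lia.
Qed.

Lemma card_not_interior (n r : nat) :
  (#|[pred j : 'I_n | ~~ interior n r j]| <= 2 * r)%N.
Proof.
have [r0|rp] := posnP r.
  rewrite r0 muln0 leqn0; apply/eqP/eq_card0 => j; rewrite -topredE /= /interior addn0.
  by rewrite ltn_ord.
have cd : (0 < 2 * r)%N by lia.
rewrite -[leqRHS]card_ord.
apply: (@leq_card_in _ _ (fun j : 'I_n => if (j < r)%N then insubd (Ordinal cd) (val j) else
   insubd (Ordinal cd) (j - (n - r) + r)%N)).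
move=> i j; rewrite -!topredE /= /interior => hi hj /(congr1 val) /=.
have li := ltn_ord i; have lj := ltn_ord j.
case: ifP => ir; case: ifP => jr; rewrite !val_insubd; do ?case: ifP; move=> *;
  apply: val_inj => /=; lia.
Qed.

Section Estimate.
Variables (F U Dd : set (set X)) (e : nat -> X -> bool) (c0 : nat) (Lam : finType)
  (lam : X -> Lam) (h : Lam -> {ffun 'I_c0 -> bool}) (eps : R).
Hypotheses (cF : cfactor F) (cU : cfactor U) (cD : cfactor Dd) (UF : U `<=` F)
  (me : mbits e) (ie : forall c, iid_over F (letter e c))
  (ge : (@measurable d X) `<=` near P (cyl e F))
  (indD : indep P Dd F)
  (tow : forall n (dl : R), (0 < n)%N -> 0 < dl -> exists E, [/\ U E,
    forall x (i j : nat), (i < n)%N -> (j < n)%N ->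
      E (Tz (- i%:Z) x) -> E (Tz (- j%:Z) x) -> i = j &
    pr [set x | forall j : nat, (j < n)%N -> ~ E (Tz (- j%:Z) x)] < dl])
  (Dlam : fmeas Dd lam) (eps0 : 0 < eps)
  (hlam : pr [set x | letter e c0 x != h (lam x)] < eps).

(** The gain is that [Phi] depends on [U] in place of [F]. The clause on constant bits keeps masked
    bits masked. *)
Lemma recode_step : exists2 e' : nat -> X -> bool,
  forall a v, (forall x, e a x = v) -> forall x, e' a x = v & [/\ mbits e',
  forall c, iid_over F (letter e' c), (@measurable d X) `<=` near P (cyl e' F),
  pr [set x | letter e' c0 x != letter e c0 x] < 10 * eps &
  exists Phi : X -> Lam, fmeas (near P (cyl e' U)) Phi /\
    pr [set x | Phi x != lam x] < 10 * eps].
Proof.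
have Fa := cfactor_alg cF; have Fm := cfactor_meas cF.
have mea := measurable_alg X; have Dm := cfactor_meas cD.
have mlam : mfun lam by exact: fmeas_sub Dlam.
have nlam : fmeas (near P (cyl e F)) lam by move=> v; apply: ge; exact: mlam.
have [g [gc gl]] := approx_fun (cyl_alg hT me cF) eps0 nlam.
have [c1 [r [K [b [Fb gd]]]]] := cyl_fun cF gc.
have mg : mfun g by apply: fmeas_sub gc; case: (cyl_alg hT me cF).
have mb : mfun b by exact: fmeas_sub Fb.
pose c := maxn c0 c1; have c0c : (c0 <= c)%N by rewrite leq_maxl.
pose al := letter e c; have mal : mfun al := mfun_letter me.
pose rs (w : {ffun 'I_c -> bool}) : {ffun 'I_c0 -> bool} := [ffun a => w (widen_ord c0c a)].
have rsE e' x : letter e' c0 x = rs (letter e' c x) by apply/ffunP=> a; rewrite !ffunE.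
have [fL fLE] : exists fL, forall x, g x = fL (window T Tinv e c r x, b x).
  apply: (factor_through P) => x y [/(windowP hT) ag bb]; apply: gd => //.
  by apply: agree_le ag; rewrite ?leq_maxr.
have [x0 _] := X_inhabited P; pose l0 := lam x0.
pose Lb n := @predict _ _ _ K n r (fun w k => fL (w, k)) rs l0.
pose bb : R := (2 * r).+1%:R; have bb0 : 0 < bb by rewrite ltr0n.
(* This makes the transport slack [n * t], amplified by the Lipschitz constant [bb] of the
   predictors, equal to [eps * n]. *)
pose t := eps / bb; have t0 : 0 < t by rewrite divr_gt0.
pose aa := #|{: {ffun 'I_c -> bool}}|.
(* [6 * r] is three times the bound [2 * r] on the positions near the ends of a block; the last
   condition absorbs the logarithmic cost of the types. *)
have [n [np nr nln]] : exists n, [/\ (0 < n)%N, 6 * r%:R <= eps * n%:R :> R &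
    bb * (t^-1 * (aa%:R * ln n.+1%:R)) <= eps * n%:R].
  have [N1 HN1] := exists_nat_gt (6 * r%:R / eps).
  pose dl := eps / (bb * t^-1 * (aa%:R + 1)).
  have q0 : 0 < bb * t^-1 * (aa%:R + 1) by rewrite !mulr_gt0 ?invr_gt0 // ltr_wpDl.
  have dl0 : 0 < dl by rewrite divr_gt0.
  have [N2 HN2] := ln_nat_small dl0.
  exists (N1 + N2).+1; split=> //.
    have := HN1 (N1 + N2).+1; rewrite ltr_pdivrMr // [_ * eps]mulrC => hh.
    by apply/ltW/hh; lia.
  have {}HN2 := HN2 (N1 + N2).+1 ltac:(lia); set nn := (N1 + N2).+1 in HN2 *.
  have ln0 : 0 <= ln (nn.+1%:R : R) by rewrite ln_ge0 // (ler_nat R 1).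
  apply: (@le_trans _ _ (bb * t^-1 * (aa%:R + 1) * (dl * nn%:R))).
    rewrite [leLHS]mulrA -(mulrA (bb / t)); apply: ler_wpM2l; first by rewrite ltW // divr_gt0.
    by apply: ler_pM => //; rewrite lerDl.
  by rewrite mulrA /dl [_ * (eps / _)]mulrC divfK // gt_eqF.
(* The bound 1/2 gives the base [E] positive measure, which [block_recoding] needs. *)
pose dl := Num.min eps (1 / 2); have dl0 : 0 < dl by rewrite lt_min eps0; lra.
have [E [UE disj offE']] := tow np dl0.
move: offE'; rewrite lt_min => /andP[offE offE2].
have FE : F E := UF UE; have mE : measurable E := Fm _ FE.
(* The label also carries the guess of the first [c0] bits. Since the predictors copy these bits
   from the letters, matching predictions forces the recoding to change them little. *)
pose lam2 x := (lam x, h (lam x)).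
have Dlam2 : fmeas Dd lam2.
  by apply: (fmeas_comp (fun l => (l, h l)) (cfactor_alg cD) Dlam).
have mlam2 : mfun lam2 by exact: fmeas_sub Dlam2.
(* The masses are not normalised: everything is restricted to the base [E], so they add up to
   [pr E]. *)
pose m (k : {ffun 'I_n -> K}) := pr (E `&` word n b @^-1` [set k]).
pose nu (l : {ffun 'I_n -> Lam * {ffun 'I_c0 -> bool}}) := pmf P (word n lam2) l.
pose Q k l w := pr ((E `&` word n b @^-1` [set k]) `&`
   (word n lam2 @^-1` [set l] `&` word n al @^-1` [set w])).
pose p := pmf P al.
have mwb := mW (N := n) mb; have mwl := mW (N := n) mlam2; have mwa := mW (N := n) mal.
have FEb k : F (E `&` word n b @^-1` [set k]).
  by apply: alg_setI => //; exact: (fmeas_word hT cF Fb).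
have mEb k := Fm _ (FEb k).
have Q0 k l w : 0 <= Q k l w by exact: pr_ge0.
have Qw k l : \sum_w Q k l w = m k * nu l.
  rewrite mulrC /nu /pmf -indD //; last exact: (fmeas_word hT cD Dlam2).
  rewrite [X in _ = pr X]setIC (pr_partition P (measurableI _ _ (mEb k) (mwl l)) mwa).
  by apply: eq_bigr => w _; rewrite /Q setIA.
have Ql k w : \sum_l Q k l w = m k * pwr p w.
  rewrite /m -ie // (pr_partition P (measurableI _ _ (mEb k) (mwa w)) mwl).
  by apply: eq_bigr => l _; rewrite /Q [word n lam2 @^-1` _ `&` _]setIC setIA.
have m0 k : 0 <= m k by exact: pr_ge0.
have sm : \sum_k m k = pr E by rewrite -(pr_partition P mE mwb).
have nE : n%:R * pr E <= 1.
  have := sum_levels_le hT mE disj measurableT; rewrite pr_setT; apply: le_trans.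
  rewrite (eq_bigr (fun=> pr E)) ?sumr_const ?card_ord ?mulr_natl // => j _.
  by rewrite setIT (pr_preTz hT).
have moff : measurable [set x | forall j : nat, (j < n)%N -> ~ E (Tz (- j%:Z) x)].
  have -> : [set x | forall j : nat, (j < n)%N -> ~ E (Tz (- j%:Z) x)] =
      [set x | forall j, j \in iota 0 n -> (~` (Tz (- j%:Z) @^-1` E)) x].
    apply/seteqP; split=> x /= hh j; first by rewrite mem_iota; apply: hh.
    by move=> jn; apply: hh; rewrite mem_iota.
  by apply: alg_bigI => // j _; apply/measurableC/(measurable_preTz hT).
set off := [set x | forall j : nat, _] in moff offE offE2.
have cover (S : set X) (G : 'I_n -> set X) : measurable S -> (forall j, measurable (G j)) ->
    (forall x, S x -> off x \/ exists j : 'I_n, E (Tz (- j%:Z) x) /\ G j (Tz (- j%:Z) x)) ->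
    pr S <= pr off + \sum_j pr (E `&` G j).
  move=> mS mG hS; pose A (o : option 'I_n) :=
    if o is Some j then Tz (- j%:Z) @^-1` (E `&` G j) else off.
  have mA o : measurable (A o).
    by case: o => [j|] //; apply: (measurable_preTz hT); exact: measurableI.
  apply: le_trans (pr_union_le P mS mA _) _.
    by move=> x /hS[hx|[j [Ej Gj]]]; [exists None|exists (Some j)].
  rewrite (bigD1 None) //= lerD2l (reindex_omap Some id) /=; last by case.
  rewrite le_eqVlt; apply/orP; left; apply/eqP; apply: eq_big => [j|j _]; first by rewrite eqxx.
  by rewrite (pr_preTz hT) //; exact: measurableI.
have E0 : 0 < pr E.
  rewrite lt_neqAle pr_ge0 andbT eq_sym; apply/eqP => pE0.
  have := cover setT (fun=> setT) measurableT (fun=> measurableT).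
  rewrite pr_setT big1 ?addr0 => [hh|j _]; last by rewrite setIT.
  have : 1 <= pr off; last by lra.
  apply: hh => x _; case: (pselect (off x)) => [|/existsNP[j /not_implyP[jn /contrapT Ej]]];
    first by left.
  by right; exists (Ordinal jn).
have p1 : \sum_a p a = 1 by exact: sum_pmf.
have p0 a : 0 <= p a by exact: pmf_ge0.
have lip k w w' : ham R (Lb n k w) (Lb n k w') <= bb * ham R w w' by exact: predict_lipschitz.
have [|k0 [sg [sgi cost]]] := block_recoding t0 p0 p1 Q0 Qw Ql _ m0 (ltW bb0) lip.
  by rewrite sm.
(* Over the base, [Y j] is a wrong prediction of the label at level [j], and [Z j] a disagreement
   there between the predictor of the block's own [b]-word before recoding and that of [k0] after
   it. *)
pose Y j := [set y | word n lam2 y j != Lb n (word n b y) (word n al y) j].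
pose Z j := [set y | Lb n (word n b y) (word n al y) j !=
   Lb n k0 (wperm (word n al y) (sg (word n b y) (word n al y))) j].
have mY j : measurable (Y j).
  by have [] := pr_fin P (fun v : {ffun 'I_n -> Lam * {ffun 'I_c0 -> bool}} *
      ({ffun 'I_n -> K} * {ffun 'I_n -> {ffun 'I_c -> bool}}) => v.1 j != Lb n v.2.1 v.2.2 j)
    (mfun_pair mwl (mfun_pair mwb mwa)).
have mZ j : measurable (Z j).
  by have [] := pr_fin P (fun v : {ffun 'I_n -> K} * {ffun 'I_n -> {ffun 'I_c -> bool}} =>
       Lb n v.1 v.2 j != Lb n k0 (wperm v.2 (sg v.1 v.2)) j) (mfun_pair mwb mwa).
pose y_ (j : 'I_n) := pr (E `&` Y j); pose z_ (j : 'I_n) := pr (E `&` Z j).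
have sumy : \sum_k \sum_l \sum_w Q k l w * ham R l (Lb n k w) = \sum_j y_ j.
  have mf := mfun_pair mwb (mfun_pair mwl mwa).
  rewrite /y_; under [RHS]eq_bigr => j _.
    rewrite (pr_part P (fun v : {ffun 'I_n -> K} * ({ffun 'I_n -> Lam * {ffun 'I_c0 -> bool}} *
       {ffun 'I_n -> {ffun 'I_c -> bool}}) => v.2.1 j != Lb n v.1 v.2.2 j) mE mf) big_mkcond /=.
  over.
  rewrite [RHS]exchange_big /=; under [LHS]eq_bigr do rewrite pair_big /=.
  rewrite [LHS]pair_big /=; apply: eq_bigr => -[k [l w]] _ /=.
  rewrite mulr_sumr; apply: eq_bigr => j _; case: ifP => _; rewrite ?mulr0 // mulr1.
  congr pr; apply/seteqP; split=> x /=; first by move=> [[Ex ->] [-> ->]].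
  by move=> [Ex [-> -> ->]].
have sumz : \sum_k m k * \sum_w pwr p w * ham R (Lb n k w) (Lb n k0 (wperm w (sg k w))) =
    \sum_j z_ j.
  have mf := mfun_pair mwb mwa.
  rewrite /z_; under [RHS]eq_bigr => j _.
    rewrite (pr_part P (fun v : {ffun 'I_n -> K} * {ffun 'I_n -> {ffun 'I_c -> bool}} =>
       Lb n v.1 v.2 j != Lb n k0 (wperm v.2 (sg v.1 v.2)) j) mE mf) big_mkcond /=.
  over.
  rewrite [RHS]exchange_big /=; under [LHS]eq_bigr do rewrite mulr_sumr.
  rewrite [LHS]pair_big /=; apply: eq_bigr => -[k w] _ /=.
  rewrite mulrA /m -ie // mulr_sumr; apply: eq_bigr => j _; case: ifP => _; rewrite ?mulr0 // mulr1.
  congr pr; apply/seteqP; split=> x /=; first by move=> [[Ex ->] ->].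
  by move=> [Ex [-> ->]].
rewrite sumy sumz sm in cost.
have snd_pred k w j : (Lb n k w j).2 = rs (w j) by rewrite /Lb ffunE.
have int_pred y (j : 'I_n) : interior n r j ->
    Lb n (word n b y) (word n al y) j = (g (iter j T y), letter e c0 (iter j T y)).
  move=> ij; rewrite /Lb ffunE ij; congr pair; last by rewrite !ffunE -rsE.
  move/andP: ij => [rj jrn]; rewrite fLE; congr (fL (_, _)); last by rewrite ffunE.
  by apply: window_word; rewrite /interior rj.
pose Bad := [set x | lam2 x != (g x, letter e c0 x)].
have mc0 : mfun (letter e c0) := mfun_letter me.
have mBad : measurable Bad.
  by have [] := pr_fin P (fun v => v.1 != v.2) (mfun_pair mlam2 (mfun_pair mg mc0)).
have Bad2 : pr Bad <= 2 * eps.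
  have [m1 _] := pr_fin P (fun v => v.1 != v.2) (mfun_pair mlam mg).
  have [m2 _] := pr_fin P (fun v => v.1 != h v.2) (mfun_pair mc0 mlam).
  have hU : pr ([set x | lam x != g x] `|` [set x | letter e c0 x != h (lam x)]) <=
      pr [set x | lam x != g x] + pr [set x | letter e c0 x != h (lam x)] := prU_le P m1 m2.
  have : pr Bad <= pr ([set x | lam x != g x] `|` [set x | letter e c0 x != h (lam x)]).
    apply: pr_le => //; first exact: measurableU.
    move=> x; rewrite /Bad /= /lam2 xpair_eqE negb_and => /orP[?|?]; [by left|right].
    by rewrite eq_sym.
  move=> h1; apply: le_trans h1 (le_trans hU _).
  by rewrite mulr_natl mulr2n; apply: lerD; exact: ltW.
(* At interior positions a wrong prediction means a point of [Bad]; the at most [2 * r] other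
   positions are charged [pr E] each. *)
have sy : \sum_j y_ j <= 2 * eps + 2 * r%:R * pr E.
  apply: (@le_trans _ _ (\sum_(j < n) (pr (Tz (- j%:Z) @^-1` E `&` Bad) +
      (~~ interior n r j)%:R * pr E))).
    apply: ler_sum => j _; rewrite /y_.
    have mYj := measurableI _ _ mE (mY j).
    have mTE := measurable_preTz hT (- j%:Z) mE.
    case: (boolP (interior n r j)) => ij; last first.
      rewrite mul1r -[leLHS]add0r lerD ?pr_ge0 // pr_le //; exact: subIsetl.
    rewrite mul0r addr0 -(pr_preTz hT j%:Z (measurableI _ _ mTE mBad)).
    apply: pr_le => //; first exact/(measurable_preTz hT)/measurableI.
    move=> y [Ey]; rewrite /Y /= int_pred // ffunE => hne; split=> //=.
    by rewrite -(Tz_nat T Tinv) (TzK hT).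
  rewrite big_split /= -mulr_suml; apply: lerD.
    by apply: le_trans Bad2; apply: (sum_levels_le hT mE disj).
  rewrite ler_wpM2r ?pr_ge0 // -natr_sum -natrM ler_nat -big_mkcond /= sum1_card.
  exact: card_not_interior.
have nEr : 3 * (2 * r%:R * pr E) <= eps.
  have : 6 * r%:R * pr E <= eps * n%:R * pr E by rewrite ler_wpM2r ?pr_ge0.
  rewrite -mulrA; have : eps * (n%:R * pr E) <= eps * 1 by rewrite ler_pM2l.
  lra.
(* There are [n.+1 ^ aa] types. Since [n * pr E <= 1], the types and the slack [n * t] cost at most
   [eps] each. *)
have Dsmall : pr E * (bb * (t^-1 * ln #|{ffun {ffun 'I_c -> bool} -> 'I_n.+1}|%:R + n%:R * t)) <=
  2 * eps.
  rewrite card_ffun card_ord natrX lnXn ?ltr0n // -/aa.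
  have -> : bb * (t^-1 * (ln n.+1%:R *+ aa) + n%:R * t) =
     bb * (t^-1 * (aa%:R * ln n.+1%:R)) + eps * n%:R.
    by rewrite -[_ *+ aa]mulr_natl /t; field; rewrite gt_eqF // gt_eqF.
  apply: (@le_trans _ _ (pr E * (eps * n%:R + eps * n%:R))).
    by rewrite ler_wpM2l ?pr_ge0 // lerD2r.
  have : eps * (n%:R * pr E) <= eps * 1 by rewrite ler_pM2l.
  lra.
have sz : \sum_j z_ j <= 4 * eps + 2 * (2 * r%:R * pr E) + 2 * eps by lra.
set e' := recoded_bits T Tinv E b e sg.
have me' : mbits e' by exact: (mbits_recoded hT sg cF FE Fb me).
have wE (y : X) (k : 'I_n) : E y -> word n (letter e' c) y =
    wperm (word n al y) (sg (word n b y) (word n al y)).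
  by move=> Ey; rewrite letter_recoded (word_recode hT b disj).
have cover2 (S : set X) (G : 'I_n -> set X) : measurable S -> (forall j, measurable (G j)) ->
    (forall y (j : 'I_n), E y -> S (Tz j%:Z y) -> G j y) ->
    pr S <= pr off + \sum_j pr (E `&` G j).
  move=> mS mG hS; apply: cover => // x Sx.
  case: (pselect (off x)) => [|/existsNP[j /not_implyP[jn /contrapT Ej]]]; first by left.
  right; exists (Ordinal jn); split; first exact: Ej.
  by apply: hS; [exact: Ej|rewrite (TzNK hT)].
have sY j y : ~ Y j y -> lam (Tz j%:Z y) = (Lb n (word n b y) (word n al y) j).1.
  by move=> /negP; rewrite negbK => /eqP <-; rewrite ffunE /= -(Tz_nat T Tinv).
have sZ j y : ~ Z j y -> Lb n (word n b y) (word n al y) j = Lb n k0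
    (wperm (word n al y) (sg (word n b y) (word n al y))) j.
  by move=> /negP; rewrite negbK => /eqP.
exists e' => [a v ea x|]; first by rewrite /e' /recoded_bits ea.
split=> // [c'|||].
- exact: (iid_recoded hT disj cF FE Fb me ie sgi).
- exact: (gen_recoded hT disj cF FE Fb me ge sgi).
- pose S := [set x | letter e' c0 x != letter e c0 x].
  have mS : measurable S.
    by have [] := pr_fin P (fun v => v.1 != v.2) (mfun_pair (mfun_letter (c := c0) me') mc0).
  have : pr S <= pr off + \sum_j z_ j.
    apply: cover2 => // y j Ey; rewrite /S /mkset !rsE => hne; apply: contrapT => /sZ.
    move=> /(congr1 snd); rewrite !snd_pred -wE // !ffunE -!(Tz_nat T Tinv) => hh.
    by rewrite hh eqxx in hne.
  move=> hS; apply: (le_lt_trans hS); apply: (lt_le_trans (ltr_leD offE sz)).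
  by have := ltW eps0; lra.
(* The single predictor of [k0], applied to the recoded letters, sees [F] only through the base [E],
   which lies in [U]. *)
pose Phi x := if pos T Tinv n E x is Some j
  then (Lb n k0 (word n (letter e' c) (Tz (- j%:Z) x)) j).1 else l0.
have cB := cyl_cfactor hT me' cU; set B := near P (cyl e' U) in cB.
have Ba := cfactor_alg cB.
have cm : cyl e' U `<=` measurable by case: (cyl_alg hT me' cU).
have BU : U `<=` B by apply: subset_trans (cyl_sub T Tinv _ (cfactor_alg cU)) _; exact: near_sub.
have Be a : B [set x | e' a x] by apply: near_sub => //; apply: cyl_bit; exact: cfactor_alg cU.
pose D x := ([ffun j : 'I_n => `[<E (Tz (- j%:Z) x)>]],
  [ffun j : 'I_n => word n (letter e' c) (Tz (- j%:Z) x)]).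
have BD : fmeas B D.
  apply: fmeas_pair => //; apply: fmeas_ffun => // j.
    by have := fmeas_Tz hT (- j%:Z) cB (fmeas_bool Ba (BU _ UE)).
  exact: (fmeas_Tz hT (- j%:Z) cB (fmeas_word hT cB (fmeas_letter Ba Be))).
have BPhi : fmeas B Phi.
  move=> v; apply: (fmeas_determined Ba BD) => x y [/ffunP h1 /ffunP h2].
  have pp : pos T Tinv n E x = pos T Tinv n E y.
    by apply: eq_pick => j; have := h1 j; rewrite !ffunE.
  rewrite /Phi /= pp; case: (pos T Tinv n E y) => // j; have := h2 j; rewrite !ffunE.
  by move=> ->.
exists Phi; split=> //; pose S := [set x | Phi x != lam x].
have mPhi : mfun Phi := fmeas_sub (cfactor_meas cB) BPhi.
have mS : measurable S by have [] := pr_fin P (fun v => v.1 != v.2) (mfun_pair mPhi mlam).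
have hS : pr S <= pr off + \sum_j pr (E `&` (Y j `|` Z j)).
  apply: cover2 => // [j|y j Ey]; first exact: measurableU.
  rewrite /S /mkset /Phi (pos_level hT disj) // (TzK hT) wE // => hne.
  apply: contrapT => /not_orP[/sY h1 /sZ h2].
  by rewrite h1 h2 eqxx in hne.
have yz : \sum_j pr (E `&` (Y j `|` Z j)) <= \sum_j y_ j + \sum_j z_ j.
  rewrite -big_split; apply: ler_sum => j _; rewrite setIUr.
  apply: prU_le; exact: measurableI.
(* [10 = 1 + 2 + 6 + 1]: the complement of the tower, the main terms of [sy] and [sz], and three
   times [2 * r * pr E] for the ends of blocks. *)
apply: (le_lt_trans hS); apply: (lt_le_trans (ltr_leD offE (le_trans yz (lerD sy sz)))).
by have := ltW eps0; lra.
Qed.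

End Estimate.
End RecodeStep2.

(** * Algebras generated by independent factors *)

Section ProductAlgebra.
Context (R : realType) (d : measure_display) (X : measurableType d)
        (P : probability X R).
Local Notation pr := (pr P).
Local Notation mfun f := (fmeas measurable f).

Lemma big_setI_seq (I : eqType) (s : seq I) (A : I -> set X) :
  \big[setI/setT]_(i <- s) A i = [set x | forall i, i \in s -> A i x].
Proof.
elim: s => [|i s IHs]; first by rewrite big_nil; apply/seteqP; split.
rewrite big_cons IHs; apply/seteqP; split=> x /=.
  by move=> [Ai As] j; rewrite in_cons => /orP[/eqP->|/As].
by move=> h; split=> [|j js]; apply: h; rewrite in_cons ?eqxx // js orbT.
Qed.

Lemma prod_prE (I : eqType) (s : seq I) (A : I -> set X) :
  (forall i, i \in s -> measurable (A i)) ->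
  (\prod_(i <- s) P (A i))%E = (\prod_(i <- s) pr (A i))%:E.
Proof.
elim: s => [|i s IHs] mA; first by rewrite !big_nil.
rewrite !big_cons EFinM IHs => [|j js]; last by apply: mA; rewrite in_cons js orbT.
by rewrite prE //; apply: mA; rewrite mem_head.
Qed.

Section Gen.
Variable C : nat -> set (set X).
Hypothesis Ca : forall j, is_alg (C j).

(** The algebra generated by the [C j] with [J j], encoded like [cyl] by finite data; a single
    finite range [K] serves all coordinates. *)
Definition prodalg (J : pred nat) : set (set X) := [set A | exists n (K : finType) (b : nat -> X
  -> K),
  (forall j, fmeas (C j) (b j)) /\
  forall x y, (forall j, (j < n)%N -> J j -> b j x = b j y) -> A x -> A y].

Definition coord (J : pred nat) n (K : finType) (b : nat -> X -> K) (x : X) :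
    {ffun 'I_n -> option K} := [ffun j : 'I_n => if J j then Some (b j x) else None].

Lemma coordP J n (K : finType) (b : nat -> X -> K) x y : coord J n b x = coord J n b y <->
  forall j, (j < n)%N -> J j -> b j x = b j y.
Proof.
split=> [/ffunP h j jn Jj|h]; first by have := h (Ordinal jn); rewrite !ffunE /= Jj => -[].
by apply/ffunP => j; rewrite !ffunE; case: ifP => // Jj; rewrite h.
Qed.

Lemma preimage_cst (K : eqType) (k v : K) :
  (fun=> k) @^-1` [set v] = if k == v then setT else set0 :> set X.
Proof.
case: eqVneq => [<-|kv]; first by apply/seteqP; split.
by apply/seteqP; split=> x //= kv'; rewrite kv' eqxx in kv.
Qed.

Lemma fmeas_const (K : finType) (B : set (set X)) (k : K) : is_alg B -> fmeas B (fun=> k).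
Proof.
move=> Ba v; have [_ BT _ _] := Ba; rewrite preimage_cst; case: eqP => // _.
exact: alg_set0.
Qed.

Lemma fmeas_coord1 J (K : finType) (b : nat -> X -> K) j : fmeas (C j) (b j) ->
  fmeas (C j) (fun x => if J j then Some (b j x) else None).
Proof.
move=> Cb; case: (J j); last exact: fmeas_const.
exact: (fmeas_comp (fun k => Some k) (Ca j) Cb).
Qed.

Lemma fmeas_coord (J : pred nat) n (K : finType) (b : nat -> X -> K) (B : set (set X)) : is_alg B ->
  (forall j, J j -> C j `<=` B) -> (forall j, fmeas (C j) (b j)) -> fmeas B (coord J n b).
Proof.
move=> Ba CB Cb; apply: fmeas_ffun => // j; case: (boolP (J j)) => Jj; last exact: fmeas_const.
by apply: (fmeas_comp (fun k => Some k) Ba); apply: fmeas_sub (CB j Jj) (Cb j).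
Qed.

Lemma prodalg_alg J : is_alg (prodalg J).
Proof.
split.
- move=> A [n [K [b [Cb h]]]].
  apply: (fmeas_determined (measurable_alg X) (f := coord J n b)).
    by apply: fmeas_coord => //; [exact: measurable_alg|move=> j _; case: (Ca j)].
  by move=> x y /coordP; exact: h.
- exists 0%N, unit, (fun _ _ => tt); split=> // j; exact: fmeas_const.
- move=> A [n [K [b [Cb h]]]]; exists n, K, b; split=> // x y xy nA Ay; apply: nA.
  by apply: h Ay => j jn Jj; rewrite xy.
move=> A A' [n [K [b [Cb h]]]] [n' [K' [b' [Cb' h']]]].
exists (maxn n n'), (K * K')%type, (fun j x => (b j x, b' j x)); split.
  by move=> j; apply: fmeas_pair.
move=> x y xy [Ax|Ax]; [left; apply: h Ax|right; apply: h' Ax] => j jn Jj.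
  by have [] := xy j (leq_trans jn (leq_maxl _ _)) Jj.
by have [] := xy j (leq_trans jn (leq_maxr _ _)) Jj.
Qed.

Lemma prodalg_sub (J : pred nat) j : J j -> C j `<=` prodalg J.
Proof.
move=> Jj A CA; exists j.+1, bool, (fun i x => if i == j then `[<A x>] else true); split.
  move=> i; case: (eqVneq i j) => [->|_]; last exact: fmeas_const.
  exact: fmeas_bool.
by move=> x y /(_ j (leqnn _) Jj); rewrite eqxx => e /asboolP; rewrite e => /asboolP.
Qed.

Lemma prodalg_mono (J J' : pred nat) : (forall j, J j -> J' j) -> prodalg J `<=` prodalg J'.
Proof.
move=> JJ A [n [K [b [Cb h]]]]; exists n, K, b; split=> // x y xy; apply: h => j jn Jj.
by apply: xy => //; exact: JJ.
Qed.

(* Each coordinate of [coord J] or of [coord J'] is constant, hence the hypothesis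
   [J] and [J'] disjoint makes every single coordinate event factor. *)
Lemma prodalg_indep (J J' : pred nat) : mindep P C -> (forall j, ~~ (J j && J' j)) ->
  indep P (prodalg J) (prodalg J').
Proof.
move=> iC JJ A A' [n [K [b [Cb h]]]] [n' [K' [b' [Cb' h']]]].
pose m := maxn n n'; pose f := coord J m b; pose g := coord J' m b'.
have Cm j : C j `<=` measurable by case: (Ca j).
have mf : mfun f by apply: fmeas_coord => //; exact: measurable_alg.
have mg : mfun g by apply: fmeas_coord => //; exact: measurable_alg.
pose p v := `[<exists2 x, A x & f x = v>]; pose q v := `[<exists2 x, A' x & g x = v>].
have EA : A = [set x | p (f x)].
  apply/seteqP; split=> x /=; first by move=> Ax; apply/asboolP; exists x.
  move=> /asboolP[y Ay /coordP yx]; apply: h Ay => j jn; apply: yx.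
  by rewrite /m leq_max jn.
have EA' : A' = [set x | q (g x)].
  apply/seteqP; split=> x /=; first by move=> Ax; apply/asboolP; exists x.
  move=> /asboolP[y Ay /coordP yx]; apply: h' Ay => j jn; apply: yx.
  by rewrite /m leq_max jn orbT.
rewrite EA EA'; apply: pmf_indep_sets => // u v.
have prI (B : nat -> set X) : (forall j, C j (B j)) ->
    pr [set x | forall j : 'I_m, B j x] = \prod_(j < m) pr (B j).
  move=> CB; have := iC (iota 0 m) B (iota_uniq _ _) (fun j _ => CB j).
  rewrite prod_prE => [|j _]; last exact/Cm/CB.
  rewrite big_setI_seq.
  have -> : [set x | forall i, i \in iota 0 m -> B i x] = [set x | forall j : 'I_m, B j x].
    apply/seteqP; split=> x /= hx j; first by apply: hx; rewrite mem_iota ltn_ord.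
    by rewrite mem_iota => /= jm; have := hx (Ordinal jm).
  have -> : \prod_(i <- iota 0 m) pr (B i) = \prod_(j < m) pr (B j).
    by rewrite -(big_mkord xpredT (fun j => pr (B j))) /index_iota subn0.
  by move/(congr1 fine).
pose U j := (fun x => if J j then Some (b j x) else None) @^-1` [set if insub j is Some i then u i
  else None].
pose V j := (fun x => if J' j then Some (b' j x) else None) @^-1` [set if insub j is Some i then v
  i else None].
have CU j : C j (U j) by exact: fmeas_coord1.
have CV j : C j (V j) by exact: fmeas_coord1.
have EU : f @^-1` [set u] = [set x | forall j : 'I_m, U j x].
  apply/seteqP; split=> x /=; first by move=> fu j; rewrite /U /= valK -fu ffunE.
  by move=> hx; apply/ffunP => j; have := hx j; rewrite /U /= valK ffunE.
have EV : g @^-1` [set v] = [set x | forall j : 'I_m, V j x].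
  apply/seteqP; split=> x /=; first by move=> gv j; rewrite /V /= valK -gv ffunE.
  by move=> hx; apply/ffunP => j; have := hx j; rewrite /V /= valK ffunE.
have EUV : (fun x => (f x, g x)) @^-1` [set (u, v)] = [set x | forall j : 'I_m, (U j `&` V j) x].
  apply/seteqP; split=> x /=.
    move=> [fu gv] j; split; [have : (f @^-1` [set u]) x by [] | have : (g @^-1` [set v]) x by []].
      by rewrite EU; apply.
    by rewrite EV; apply.
  move=> hx; congr pair; [suff : (f @^-1` [set u]) x by []|suff : (g @^-1` [set v]) x by []].
    by rewrite EU => j; case: (hx j).
  by rewrite EV => j; case: (hx j).
rewrite /pmf EU EV EUV (prI U CU) (prI V CV) (prI (fun j => U j `&` V j)); last by move=> j;
  exact: alg_setI.
rewrite -big_split; apply: eq_bigr => j _; have := JJ j; rewrite /U /V.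
case: (J j) => /= [/negPf->|_]; rewrite preimage_cst; case: eqP => _.
- by rewrite setIT pr_setT mulr1.
- by rewrite setI0 pr_set0 mulr0.
- by rewrite setTI pr_setT mul1r.
- by rewrite set0I pr_set0 mul0r.
Qed.

End Gen.
End ProductAlgebra.

(** * Changing the generator along the filtration *)

Section Filtration.
Context (R : realType) (d : measure_display) (X : measurableType d)
        (P : probability X R) (T Tinv : X -> X).
Hypothesis hT : invertible_mp P T Tinv.
Local Notation pr := (pr P).
Local Notation mfun f := (fmeas measurable f).
Local Notation Tz := (iterz T Tinv).
Local Notation iid_over := (iid_over P T).
Local Notation cfactor := (cfactor P T Tinv).
Local Notation cyl := (cyl T Tinv).
Local Notation triv := (triv P).

Lemma iid_const (K : finType) (B : set (set X)) (k : K) : iid_over B (fun=> k).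
Proof.
move=> N w A BA; rewrite /pmf; under eq_bigr do rewrite preimage_cst.
case: (pselect (exists i, k != w i)) => [[i kw]|kw].
  rewrite [X in _ * X](bigD1 i) //= (negPf kw) pr_set0 mul0r mulr0.
  rewrite (_ : _ `&` _ = set0) ?pr_set0 //; apply/seteqP; split=> x //= [_ /word_preE/(_ i)] e.
  by rewrite e eqxx in kw.
have kE i : k = w i by apply: contrapT => /eqP h; apply: kw; exists i.
rewrite big1 => [|i _]; last by rewrite -kE eqxx pr_setT.
rewrite mulr1; congr pr; apply/seteqP; split=> x /=; first by case.
by move=> Ax; split=> //; apply/word_preE.
Qed.

Lemma triv_sub B : cfactor B -> triv `<=` B.
Proof.
move=> cB A [mA hA]; have [sB nB _ _] := cB; have Ba := cfactor_alg cB.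
have [_ BT _ _] := Ba; have B0 := alg_set0 Ba.
case: hA => hA; apply: nB; split=> // e e0.
  by exists set0; split=> //; rewrite /dist setY0 hA.
by exists setT; split=> //; rewrite /dist setYTC prC // hA subrr.
Qed.

Variables (G : nat -> set (set X)) (xi : nat -> nat -> X -> bool).
Hypotheses (cG : forall m, cfactor (G m)) (Gdec : forall m, G m.+1 `<=` G m)
  (G0 : (@measurable d X) `<=` G 0)
  (ixi : forall m c, iid_over (G m.+1) (letter (xi m) c))
  (gxi : forall m, G m `<=` near P (cyl (xi m) (G m.+1)))
  (Gxi : forall m a, G m [set x | xi m a x]).

Lemma G_le m m' : (m <= m')%N -> G m' `<=` G m.
Proof.
move=> /subnK <-; elim: (m' - m)%N => [|k IHk] //.
by rewrite addSn; apply: subset_trans IHk => A; exact: Gdec.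
Qed.

Let mxi m a : measurable [set x | xi m a x].
Proof. by have Gm := cfactor_meas (cG m); apply: Gm; exact: Gxi. Qed.

(* The bits of all the processes [xi m] are arranged in one sequence, bit [a]
   being bit [(bit_index a).2] of the process at level [bit_level a]. *)
Definition bit_index (a : nat) : nat * nat := odflt (0%N, 0%N) (unpickle a).
Definition bit_level a := (bit_index a).1.
Definition initial_bits a := xi (bit_level a) (bit_index a).2.
(** Bits of level at least [M] are blanked rather than dropped, so that the numbering of the bits
    does not depend on [M]. *)
Definition mask M (e : nat -> X -> bool) a x := (bit_level a < M)%N && e a x.

(** The invariant of the iteration. Levels from [M] on are still the initial ones, which allows [M]
    to be raised without changing [e]. *)
Definition generating M e := [/\ mbits e, forall a, (M <= bit_level a)%N -> e a = initial_bits a,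
  forall c, iid_over (G M) (letter (mask M e) c) &
  (@measurable d X) `<=` near P (cyl (mask M e) (G M))].

Lemma bit_index_pickle p : bit_index (pickle p) = p.
Proof. by rewrite /bit_index pickleK. Qed.

Lemma mask_in (B : set (set X)) M (e : nat -> X -> bool) a : is_alg B -> ((bit_level a < M)%N -> B
  [set x | e a x]) ->
  B [set x | mask M e a x].
Proof.
move=> Ba; rewrite /mask; case: (bit_level a < M)%N => [/(_ isT) //|_].
by have := alg_set0 Ba; congr B; apply/seteqP; split.
Qed.

Lemma mbits_mask M e : mbits e -> mbits (mask M e).
Proof. by move=> me a; apply: mask_in => //; exact: measurable_alg. Qed.

Lemma generating_initial : generating 0 initial_bits.
Proof.
split=> // [a|c|]; first exact: mxi.
  have -> : letter (mask 0 initial_bits) c = fun=> [ffun=> false].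
    by apply/funext => x; apply/ffunP => a; rewrite !ffunE.
  exact: iid_const.
apply: subset_trans G0 _; apply: subset_trans (cyl_sub T Tinv _ (cfactor_alg (cG 0))) _.
apply: near_sub; have me : mbits (mask 0 initial_bits) by apply: mbits_mask => a; exact: mxi.
by case: (cyl_alg hT me (cG 0)).
Qed.

Lemma cyl_in (e : nat -> X -> bool) F : mbits e -> cfactor F -> F `<=` near P (cyl e F).
Proof.
move=> me cF; apply: subset_trans (cyl_sub T Tinv _ (cfactor_alg cF)) _; apply: near_sub.
by case: (cyl_alg hT me cF).
Qed.

Lemma cyl_bit_in (e : nat -> X -> bool) F a : mbits e -> cfactor F -> near P (cyl e F) [set x | e
  a x].
Proof.
move=> me cF; apply: near_sub; first by case: (cyl_alg hT me cF).
exact: (cyl_bit T Tinv e a (cfactor_alg cF)).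
Qed.

Lemma cyl_near_min (e : nat -> X -> bool) F B : cfactor F -> cfactor B -> F `<=` B ->
  (forall a, B [set x | e a x]) -> near P (cyl e F) `<=` B.
Proof. by move=> cF cB FB eB; apply: (cfactor_near_sub cB); exact: (cyl_min hT). Qed.

(** The bits of level [M] are still those of [xi M]: i.i.d. over [G M.+1], and together with it they
    recover [G M]. *)
Lemma generating_succ M e : generating M e -> generating M.+1 e.
Proof.
move=> [me eM ie ge]; have mm := mbits_mask M.+1 me.
split=> // [a Ma|c|]; first by apply: eM; exact: ltnW.
  pose k := \max_(a < c) (bit_index a).2.
  pose h (uv : {ffun 'I_c -> bool} * {ffun 'I_k.+1 -> bool}) : {ffun 'I_c -> bool} :=
    [ffun a : 'I_c => if bit_level a == M then uv.2 (inord (bit_index a).2) else uv.1 a].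
  have -> : letter (mask M.+1 e) c =
      h \o (fun x => (letter (mask M e) c x, letter (xi M) k.+1 x)).
    apply/funext => x; apply/ffunP => a; rewrite !ffunE /mask ltnS leq_eqVlt.
    case: eqP => [aM|_] /=; last by rewrite ?ffunE.
    rewrite ?ffunE inordK; last by rewrite ltnS /k (leq_bigmax a).
    by rewrite eM ?aM // /initial_bits aM.
  have Gl : fmeas (G M) (letter (xi M) k.+1).
    by apply: fmeas_letter => //; exact: cfactor_alg.
  apply: (iid_comp hT) => //.
    by apply: mfun_pair; apply: mfun_letter => //; exact: mbits_mask.
  exact: (iid_pair hT (cG M) (cG M.+1) (@Gdec M) Gl (@ie c) (@ixi M k.+1)).
have cB := cyl_cfactor hT mm (cG M.+1); set B := near P (cyl _ _) in cB *.
have Bbit a : B [set x | mask M.+1 e a x] by exact: cyl_bit_in.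
have BG : G M `<=` B.
  apply: subset_trans (@gxi M) _; apply: cyl_near_min => // [|a]; first exact: cyl_in.
  have := Bbit (pickle (M, a)); congr B; apply/seteqP.
  have eE : e (pickle (M, a)) = xi M a by rewrite eM /initial_bits /bit_level bit_index_pickle.
  by split=> x; rewrite /mkset /mask /bit_level bit_index_pickle ltnSn eE.
apply: subset_trans ge _; apply: cyl_near_min => // a.
apply: mask_in => [|aM]; first exact: (cfactor_alg cB).
by have := Bbit a; congr B; apply/seteqP; split=> x; rewrite /mkset /mask ltnS ltnW.
Qed.

Lemma generating_le M M' e : (M <= M')%N -> generating M e -> generating M' e.
Proof.
move=> /subnK <-; elim: (M' - M)%N => [|k IHk] // /IHk; rewrite addSn.
exact: generating_succ.
Qed.

Lemma mask_letter M e c x : (forall a, (a < c)%N -> (bit_level a < M)%N) ->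
  letter (mask M e) c x = letter e c x.
Proof. by move=> h; apply/ffunP => a; rewrite !ffunE /mask h. Qed.

(** Cylinders of the bits alone; one width bounds both the times and the indices. *)
Definition wcyl e w : set (set X) := [set Z | forall x y, agree T Tinv e w w x y -> Z x -> Z y].
Definition wcyls e : set (set X) := [set Z | exists w, wcyl e w Z].

Lemma wcyl_le e w w' : (w <= w')%N -> wcyl e w `<=` wcyl e w'.
Proof. by move=> ww Z h x y ag; apply: h; apply: agree_le ag. Qed.

Lemma wcyls_alg e : mbits e -> is_alg (wcyls e).
Proof.
move=> me; split.
- move=> Z [w h]; apply: (fmeas_determined (f := window T Tinv e w w)) => [||x y /(windowP hT)].
  + exact: measurable_alg.
  + exact: (mfun_window hT).
  + exact: h.
- by exists 0%N.
- by move=> Z [w h]; exists w => x y /agree_sym ag nZ Zy; apply: nZ; apply: h ag Zy.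
move=> Z Z' [w h] [w' h']; exists (maxn w w') => x y ag [Zx|Zx]; [left|right].
  by apply: (h _ _ _ Zx); apply: agree_le ag; rewrite leq_maxl.
by apply: (h' _ _ _ Zx); apply: agree_le ag; rewrite leq_maxr.
Qed.

Lemma wcyls_Tz e z Z : wcyls e Z -> wcyls e (Tz z @^-1` Z).
Proof.
move=> [w h]; exists (w + `|z|)%N => x y ag; apply: h; apply: (agree_Tz hT).
by apply: agree_le ag; rewrite ?leq_addr.
Qed.

Lemma wcyls_bit e a : wcyls e [set x | e a x].
Proof. by exists a.+1 => x y /(_ 0 isT a (leqnn _)) /= ->. Qed.

Lemma wcyls_cfactor e : mbits e -> cfactor (near P (wcyls e)).
Proof.
move=> me; have wa := wcyls_alg me; have [wm _ _ _] := wa.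
apply: (near_cfactor hT) => // Z cZ; apply: near_sub => //.
  exact: (@wcyls_Tz e 1).
exact: (@wcyls_Tz e (-1)).
Qed.

Lemma wcyls_bit_in e a : mbits e -> near P (wcyls e) [set x | e a x].
Proof.
move=> me; apply: near_sub; last exact: wcyls_bit.
by case: (wcyls_alg me).
Qed.

Section Step.
Variable D : nat -> set (set X).
Hypotheses (cD : forall M, cfactor (D M)) (indD : forall M, indep P (D M) (G M))
  (Dgen : forall (K : finType) (f : X -> K) (eps : R), mfun f -> 0 < eps ->
    exists M0 (g : X -> K), pr [set x | f x != g x] < eps /\
      forall M, (M0 <= M)%N -> fmeas (D M) g)
  (rich : forall M, exists m i, [/\ (M <= m)%N, 0 < pr [set x | xi m i x] &
    pr [set x | xi m i x] < 1]).

Lemma recode_generator M e c0 A (eps : R) : generating M e -> measurable A -> 0 < eps ->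
  exists M' e', [/\ (M < M')%N, generating M' e',
    forall a, (a < c0)%N -> pr [set x | e' a x != e a x] < eps &
    exists Z, wcyls e' Z /\ dist P A Z < eps].
Proof.
(* [12 = 1 + 10 + 1]: from [f] to [lam], from [lam] to [Phi], and from the set given by [Phi] to a
   cylinder. *)
move=> iM mA eps0; pose ep := eps / 12; have ep0 : 0 < ep by rewrite divr_gt0.
have me : mbits e by case: iM.
(* The bits to be preserved are part of the target, so [lam] guesses them too; the [h] of
   [recode_step] is the second projection. *)
pose f x := (`[<A x>], letter e c0 x).
have mf : mfun f.
  by apply: mfun_pair; [exact: fmeas_bool (measurable_alg X) mA|exact: mfun_letter].
have [M0 [lam [flam Dlam]]] := Dgen mf ep0.
pose Ml := \max_(a < c0) (bit_level a).+1.
(* From [M0] on [lam] is measurable for the factor independent of [G M1]; from [Ml] on the first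
   [c0] bits are unmasked. *)
pose M1 := maxn M (maxn M0 Ml).
have MM1 : (M <= M1)%N by rewrite leq_maxl.
have Ml1 a : (a < c0)%N -> (bit_level a < M1)%N.
  move=> ac; rewrite /M1 !leq_max; apply/orP; right; apply/orP; right.
  exact: (leq_bigmax (Ordinal ac)).
have {}Dlam : fmeas (D M1) lam by apply: Dlam; rewrite /M1 !leq_max leqnn !orbT.
have [_ eM1 ie ge] := generating_le MM1 iM.
have mlam : mfun lam by apply: fmeas_sub Dlam; exact: cfactor_meas.
have [m [i [M1m u0 u1]]] := rich M1.
pose u := [set x | xi m i x].
pose me1 : mbits (mask M1 e) := mbits_mask M1 me.
(* One bit repeated: [U] is the factor generated by the marker bit alone. *)
pose eu (a : nat) := xi m i.
have meu : mbits eu by move=> a; exact: mxi.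
pose U := near P (cyl eu triv).
have ctr : cfactor triv := triv_cfactor hT.
have cU : cfactor U := cyl_cfactor hT meu ctr.
have UG : U `<=` G M1.
  apply: cyl_near_min => //; first exact: triv_sub.
  by move=> a; apply: (G_le M1m); exact: Gxi.
have iu : iid_over (G m.+1) (ind u).
  have -> : ind u = (fun w : {ffun 'I_i.+1 -> bool} => w ord_max) \o letter (xi m) i.+1.
    apply/funext => x; rewrite /= ffunE /ind; apply/idP/idP => [/set_mem //|h].
    exact: mem_set.
  by apply: (iid_comp hT) => //; apply: mfun_letter => a; exact: mxi.
have Uu : U u := cyl_bit_in 0 meu ctr.
have tow n (dl : R) : (0 < n)%N -> 0 < dl -> _ := fun n0 dl0 =>
  tower hT cU (cG m.+1) Uu iu u0 u1 (n := n) (eps := dl) n0 dl0.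
have hlam : pr [set x | letter (mask M1 e) c0 x != (lam x).2] < ep.
  apply: le_lt_trans flam; apply: pr_le.
  - have [] // := pr_fin P (fun v => v.1 != v.2.2)
      (mfun_pair (mfun_letter (c := c0) me1) mlam).
  - by have [] // := pr_fin P (fun v => v.1 != v.2) (mfun_pair mf mlam).
  move=> x /=; rewrite mask_letter // /f; apply: contraNneq => <-.
  by rewrite eqxx.
have [e1 e1c [me1' ie1 ge1 e1e [Phi [mPhi Phil]]]] :=
  recode_step hT (cG M1) cU (cD M1) UG me1 ie ge (@indD M1) tow Dlam ep0 hlam.
(* The bits of level at least [M1], among them the marker bit, are put back unchanged; hence [U] is
   generated by bits of [e']. *)
pose e' a x := if (bit_level a < M1)%N then e1 a x else e a x.
have e1F a : (M1 <= bit_level a)%N -> forall x, e1 a x = false.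
  by move=> Ma; apply: e1c => x; rewrite /mask ltnNge Ma.
have me' : mbits e'.
  by move=> a; rewrite /e'; case: (bit_level a < M1)%N; [exact: me1'|exact: me].
have maskE : mask M1 e' = e1.
  apply/funext => a; apply/funext => x; rewrite /mask /e'.
  by case: ltnP => // Ma; rewrite e1F.
have iM1 : generating M1 e'.
  split=> // [a Ma|c|]; last by rewrite maskE.
    by apply/funext => x; rewrite /e' ltnNge Ma /= eM1.
  by rewrite maskE.
have Mm : (M1 <= m.+1)%N by exact: leqW.
(* [m.+1] exceeds [M] strictly, so the stages tend to infinity along the iteration. *)
exists m.+1, e'; split.
- by rewrite ltnS (leq_trans MM1).
- exact: generating_le Mm iM1.
- move=> a ac; apply: (@le_lt_trans _ _ (10 * ep)); last first.
    by rewrite /ep; lra.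
  apply/ltW; apply: le_lt_trans e1e; apply: pr_le.
  + have [] // := pr_fin P (fun v => v.1 != v.2)
      (mfun_pair (fmeas_bit (measurable_alg X) (me' a)) (fmeas_bit (measurable_alg X) (me a))).
  + have [] // := pr_fin P (fun v => v.1 != v.2)
      (mfun_pair (mfun_letter (c := c0) me1') (mfun_letter (c := c0) me1)).
  move=> x /=; rewrite /e' Ml1 //; apply: contraNneq => /ffunP/(_ (Ordinal ac)).
  by rewrite !ffunE /= /mask Ml1 // => ->.
have cW := wcyls_cfactor me'; set W := near P (wcyls e') in cW.
have Wbit a : W [set x | e' a x] by exact: wcyls_bit_in.
have UW : U `<=` W.
  apply: cyl_near_min => //; first exact: triv_sub.
  move=> a; have := Wbit (pickle (m, i)); congr W; apply/seteqP.
  have eE : e' (pickle (m, i)) = xi m i.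
    by apply/funext => x; rewrite /e' /bit_level bit_index_pickle ltnNge M1m /= eM1 ?/initial_bits
      /bit_level bit_index_pickle.
  by split=> x; rewrite /mkset eE.
have WPhi : fmeas W Phi.
  apply: fmeas_sub mPhi; apply: cyl_near_min => // a; rewrite -maskE.
  by apply: mask_in => //; exact: (cfactor_alg cW).
have WS : W [set x | (Phi x).1] := alg_fin fst (cfactor_alg cW) WPhi.
have mS := cfactor_meas cW WS; have [_ HS] := WS; have [Z [wZ mZ SZ]] := HS _ ep0.
exists Z; split=> //; apply: le_lt_trans (dist_trans P mA mS mZ) _.
have h1 : dist P A [set x | (Phi x).1] <= pr ([set x | f x != lam x] `|` [set x | Phi x != lam x]).
  have mfl : measurable [set x | f x != lam x].
    by have [] // := pr_fin P (fun v => v.1 != v.2) (mfun_pair mf mlam).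
  have mPl : measurable [set x | Phi x != lam x].
    have mPhi' : mfun Phi := fmeas_sub (cfactor_meas cW) WPhi.
    by have [] // := pr_fin P (fun v => v.1 != v.2) (mfun_pair mPhi' mlam).
  apply: pr_le; [exact: measurableY|exact: measurableU|move=> x hx].
  case: (eqVneq (f x) (lam x)) => [fl|]; last by left.
  right; apply/negP => /eqP pl; move: hx; rewrite /setY /= pl -fl /f /=.
  by case=> -[h1 h2]; apply: h2; apply/asboolP.
have h2 : pr ([set x | f x != lam x] `|` [set x | Phi x != lam x]) <=
    pr [set x | f x != lam x] + pr [set x | Phi x != lam x].
  apply: prU_le; first by have [] // := pr_fin P (fun v => v.1 != v.2) (mfun_pair mf mlam).
  have mPhi' : mfun Phi := fmeas_sub (cfactor_meas cW) WPhi.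
  by have [] // := pr_fin P (fun v => v.1 != v.2) (mfun_pair mPhi' mlam).
have -> : eps = (ep + 10 * ep) + ep by rewrite /ep; lra.
apply: ltrD => //; apply: le_lt_trans h1 _; apply: le_lt_trans h2 _; exact: ltrD.
Qed.

End Step.
End Filtration.

(** * Limit of the generators *)

Lemma half_small (R : realType) (e : R) : 0 < e ->
  exists K, forall k, (K <= k)%N -> 2^-1 ^+ k < e.
Proof.
move=> e0; have [K HK] := exists_nat_gt e^-1; exists K => k /HK ek.
rewrite -[ltRHS]invrK exprVn ltf_pV2 ?posrE ?exprn_gt0 ?invr_gt0 //.
by apply: lt_trans ek _; rewrite -natrX ltr_nat ltn_expl.
Qed.

Lemma prod_lipschitz (R : realType) (I : finType) (a b : I -> R) :
  (forall i, 0 <= a i <= 1) -> (forall i, 0 <= b i <= 1) ->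
  `|\prod_i a i - \prod_i b i| <= \sum_i `|a i - b i|.
Proof.
move=> ha hb.
suff [_ _ //] : [/\ 0 <= \prod_i a i <= 1, 0 <= \prod_i b i <= 1 &
  `|\prod_i a i - \prod_i b i| <= \sum_i `|a i - b i|].
elim/big_rec3: _ => [|i x z y _ [/andP[y0 y1] /andP[z0 z1] h]].
  by rewrite subrr normr0 lexx ler01 lexx.
have /andP[a0 a1] := ha i; have /andP[b0 b1] := hb i; split.
- by rewrite mulr_ge0 // mulr_ile1.
- by rewrite mulr_ge0 // mulr_ile1.
have -> : a i * y - b i * z = (a i - b i) * y + b i * (y - z) by ring.
apply: le_trans (ler_normD _ _) _; rewrite !normrM (ger0_norm y0) (ger0_norm b0).
by apply: lerD; [rewrite ler_piMr|apply: le_trans h; rewrite ler_piMl].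
Qed.

Section Limit.
Context (R : realType) (d : measure_display) (X : measurableType d)
        (P : probability X R) (T Tinv : X -> X).
Hypothesis hT : invertible_mp P T Tinv.
Local Notation pr := (pr P).
Local Notation mfun f := (fmeas measurable f).
Local Notation Tz := (iterz T Tinv).
Local Notation word := (word T).
Local Notation iid_over := (iid_over P T).
Local Notation triv := (triv P).
Local Notation window := (window T Tinv).

Lemma iid_triv (K : finType) (f : X -> K) : mfun f ->
  (forall N w, pr (word N f @^-1` [set w]) = \prod_i pmf P f (w i)) -> iid_over triv f.
Proof.
move=> mf h N w A [mA hA]; rewrite -h; have mS := mfun_word hT mf w; set S := _ @^-1` _ in mS *.
have mAS := measurableI _ _ mA mS.
case: hA => hA; rewrite hA ?mul0r ?mul1r.
  apply/le_anti; rewrite pr_ge0 andbT -hA; apply: pr_le => //; exact: subIsetl.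
rewrite [RHS](prDI P mS mA) setIC; suff -> : pr (S `\` A) = 0 by rewrite add0r.
have mC := measurableC mA.
apply/le_anti; rewrite pr_ge0 andbT; apply: (@le_trans _ _ (pr (~` A))).
  by apply: pr_le; [exact: measurableD|exact: mC|move=> x []].
by rewrite prC // hA subrr.
Qed.

Lemma window_eq2 (e e' : nat -> X -> bool) c N x : window e c N x = window e' c N x <->
  forall z : int, (`|z| <= N)%N -> forall a, (a < c)%N -> e a (Tz z x) = e' a (Tz z x).
Proof.
split=> [/ffunP h z zN a ac|h]; last first.
  apply/ffunP => i; rewrite !ffunE; apply/ffunP => a; rewrite !ffunE.
  by rewrite -!(Tz_nat T Tinv) -!(TzD hT); apply: h => //; have := ltn_ord i; lia.
have [i iN zi] : exists2 i : nat, (i < (2 * N).+1)%N & z = i%:Z - N%:Z.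
  by exists (absz (z + N%:Z)%R); lia.
have := h (Ordinal iN); rewrite !ffunE => /ffunP/(_ (Ordinal ac)).
by rewrite !ffunE /= -!(Tz_nat T Tinv) -!(TzD hT) zi.
Qed.

Lemma measurable_window_neq (e e' : nat -> X -> bool) c N : mbits e -> mbits e' ->
  measurable [set x | window e c N x != window e' c N x].
Proof.
move=> me me'; have [] // := pr_fin P (fun v => v.1 != v.2)
  (mfun_pair (mfun_window (c := c) (N := N) hT me) (mfun_window (c := c) (N := N) hT me')).
Qed.

Lemma window_neq_le (e e' : nat -> X -> bool) w (eps : R) : mbits e -> mbits e' ->
  (forall a, (a < w)%N -> pr [set x | e a x != e' a x] <= eps) ->
  pr [set x | window e w w x != window e' w w x] <= ((2 * w).+1 * w)%:R * eps.
Proof.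
move=> me me' h; pose D (a : 'I_w) := [set x | e a x != e' a x].
have mD a : measurable (D a).
  have [] // := pr_fin P (fun v => v.1 != v.2)
    (mfun_pair (fmeas_bit (measurable_alg X) (me a)) (fmeas_bit (measurable_alg X) (me' a))).
pose B (ia : 'I_(2 * w).+1 * 'I_w) := Tz (ia.1%:Z - w%:Z) @^-1` D ia.2.
have mB ia : measurable (B ia) by exact: (measurable_preTz hT).
apply: le_trans (pr_union_le P (measurable_window_neq w w me me') mB _) _.
  move=> x /eqP; apply: contra_notP => nB; apply/window_eq2 => z zw a aw.
  have iN : (absz (z + w%:Z)%R < (2 * w).+1)%N by lia.
  apply/eqP/negPn/negP => ne; apply: nB; exists (Ordinal iN, Ordinal aw).
  rewrite /B /D /preimage /mkset; have -> : (Ordinal iN : nat)%:Z - w%:Z = z by rewrite /=; lia.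
  exact: ne.
apply: (@le_trans _ _ (\sum_(ia : 'I_(2 * w).+1 * 'I_w) eps)).
  by apply: ler_sum => ia _; rewrite /B (pr_preTz hT) //; apply: h.
by rewrite sumr_const card_prod !card_ord mulr_natl.
Qed.

Section Seq.
Variables (e_ : nat -> nat -> X -> bool) (w_ : nat -> nat).
Hypotheses (me : forall k, mbits (e_ k)) (wS : forall k, (w_ k < w_ k.+1)%N)
  (close : forall k, pr [set x | window (e_ k.+1) (w_ k) (w_ k) x !=
     window (e_ k) (w_ k) (w_ k) x] <= 2^-1 ^+ k)
  (iide : forall c, exists K, forall k, (K <= k)%N -> iid_over triv (letter (e_ k) c)).

(** Eventual truth is defined and measurable everywhere, and it is the limit wherever the bits
    stabilise. *)
Definition lim_bits a x := `[<exists L, forall l, (L <= l)%N -> e_ l a x>].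

Lemma w_le k l : (k <= l)%N -> (w_ k <= w_ l)%N.
Proof.
move=> /subnK <-; elim: (l - k)%N => [|n IHn] //; rewrite addSn.
exact: leq_trans IHn (ltnW (wS _)).
Qed.

Lemma w_ge k : (k <= w_ k)%N.
Proof. by elim: k => // k IHk; exact: leq_ltn_trans IHk (wS k). Qed.

Lemma mbits_lim : mbits lim_bits.
Proof.
move=> a; have -> : [set x | lim_bits a x] =
    \bigcup_L \bigcap_(l in [set l | (L <= l)%N]) [set x | e_ l a x].
  apply/seteqP; split=> x /=; first by move=> /asboolP[L hL]; exists L.
  by move=> [L _ hL]; apply/asboolP; exists L.
apply: bigcup_measurable => L _; apply: bigcap_measurable => [|l _]; last exact: me.
by exists L => /=.
Qed.

(** Outside all the changes made from step [k] on, the bits of the window stay constant; these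
    changes have total probability at most [2 * 2^-k]. *)
Lemma lim_close k : pr [set x | window lim_bits (w_ k) (w_ k) x !=
  window (e_ k) (w_ k) (w_ k) x] <= 2 * 2^-1 ^+ k.
Proof.
pose B l := [set x | window (e_ l.+1) (w_ l) (w_ l) x != window (e_ l) (w_ l) (w_ l) x].
have mB l : measurable (B l) by exact: measurable_window_neq.
have ml := mbits_lim.
have sub : [set x | window lim_bits (w_ k) (w_ k) x != window (e_ k) (w_ k) (w_ k) x] `<=`
    \bigcup_i B (k + i)%N.
  move=> x /eqP; apply: contra_notP => nB; apply/window_eq2 => z zw a aw.
  have st i : e_ (k + i)%N a (Tz z x) = e_ k a (Tz z x).
    elim: i => [|i <-]; first by rewrite addn0.
    rewrite addnS; have : window (e_ (k + i).+1) (w_ (k + i)) (w_ (k + i)) x =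
        window (e_ (k + i)) (w_ (k + i)) (w_ (k + i)) x.
      by apply/eqP/negPn/negP => h; apply: nB; exists i.
    move/window_eq2 => h; apply: h.
      exact: leq_trans zw (w_le (leq_addr i k)).
    exact: leq_trans aw (w_le (leq_addr i k)).
  apply/asboolP/idP => [[L hL]|ek].
    by rewrite -(st L); apply: hL; rewrite leq_addl.
  by exists k => l /subnKC <-; rewrite st.
have mU : measurable (\bigcup_i B (k + i)%N) by apply: bigcup_measurable.
apply: le_trans (pr_le P _ mU sub) _; first exact: measurable_window_neq.
apply/ler_addgt0Pr => dl dl0.
have [n hn] := pr_bigcup_approx P dl0 (fun i => mB (k + i)%N).
have mUn : measurable (\big[setU/set0]_(i < n) B (k + i)%N) by apply: bigsetU_measurable.
have := pr_dist P mU mUn; rewrite ler_norml => /andP[_ h1].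
(* The bound is the exact geometric sum, so that the induction closes. *)
suff : pr (\big[setU/set0]_(i < n) B (k + i)%N) <= 2 * 2^-1 ^+ k - 2 * 2^-1 ^+ (k + n).
  have : 0 <= 2^-1 ^+ (k + n) :> R by rewrite exprn_ge0 // invr_ge0.
  move=> q0 q1; have h2 := le_trans h1 (ltW hn); rewrite lerBlDr in h2.
  apply: le_trans h2 _; rewrite addrC lerD2r; apply: le_trans q1 _; lra.
clear hn h1 mUn; elim: n => [|n IHn]; first by rewrite big_ord0 pr_set0 addn0 subrr.
rewrite big_ord_recr /=; apply: le_trans (prU_le P _ _) _ => //.
  by apply: bigsetU_measurable.
apply: le_trans (lerD IHn (close (k + n))) _.
rewrite addnS exprS; lra.
Qed.

Lemma pr_close (K : finType) (f g : X -> K) v : mfun f -> mfun g ->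
  `|pr (f @^-1` [set v]) - pr (g @^-1` [set v])| <= pr [set x | f x != g x].
Proof.
move=> mf mg; apply: le_trans (pr_dist P (mf v) (mg v)) _; apply: pr_le.
- exact: measurableY.
- by have [] // := pr_fin P (fun v => v.1 != v.2) (mfun_pair mf mg).
by move=> x; rewrite /setY /mkset => -[[fx gx]|[fx gx]]; apply/eqP => e; apply: gx;
  rewrite /preimage /= -?e // e.
Qed.

Lemma lim_iid c : iid_over triv (letter lim_bits c).
Proof.
have ml := mbits_lim; have mle := mfun_letter (c := c) ml.
apply: iid_triv => // N w; apply/eqP; rewrite -subr_eq0 -normr_le0.
apply/ler_addgt0Pr => eps eps0; rewrite add0r.
have [K1 HK1] := iide c.
have e0 : 0 < eps / (2 * N.+1%:R) by rewrite divr_gt0 // mulr_gt0.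
have [K2 HK2] := half_small e0.
(* As [w_ k >= k], the window contains [c] bits and [N] times. The accuracy [eps / (2 * N.+1)] pays
   for the word and for the [N] factors of the product. *)
pose k := maxn (maxn K1 K2) (maxn c N).
have ik : iid_over triv (letter (e_ k) c) by apply: HK1; rewrite /k !leq_max leqnn.
have kN : (N <= w_ k)%N by apply: leq_trans (w_ge k); rewrite /k !leq_max leqnn !orbT.
have kc : (c <= w_ k)%N by apply: leq_trans (w_ge k); rewrite /k !leq_max leqnn !orbT.
have qk : 2 * 2^-1 ^+ k <= eps / N.+1%:R.
  have : 2^-1 ^+ k < eps / (2 * N.+1%:R) by apply: HK2; rewrite /k !leq_max leqnn !orbT.
  rewrite ltr_pdivlMr ?mulr_gt0 // => hh; rewrite ler_pdivlMr //; apply: le_trans (ltW hh).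
  by rewrite mulrCA mulrA.
have mlk := mfun_letter (c := c) (me k).
have neq (J : finType) (f g : X -> J) : mfun f -> mfun g -> (forall x,
    window lim_bits (w_ k) (w_ k) x = window (e_ k) (w_ k) (w_ k) x -> f x = g x) ->
    pr [set x | f x != g x] <= 2 * 2^-1 ^+ k.
  move=> mf mg h; apply: le_trans (lim_close k); apply: pr_le.
  - by have [] // := pr_fin P (fun v => v.1 != v.2) (mfun_pair mf mg).
  - exact: measurable_window_neq.
  by move=> x /=; apply: contraNneq => /h ->.
have pE v : `|pmf P (letter lim_bits c) v - pmf P (letter (e_ k) c) v| <= 2 * 2^-1 ^+ k.
  apply: le_trans (pr_close v mle mlk) _; apply: neq => // x /window_eq2 h.
  apply/ffunP => a; rewrite !ffunE; apply: (h 0) => //.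
  exact: leq_trans (ltn_ord a) kc.
have sE : `|pr (word N (letter lim_bits c) @^-1` [set w]) -
    pr (word N (letter (e_ k) c) @^-1` [set w])| <= 2 * 2^-1 ^+ k.
  apply: le_trans (pr_close w (mfun_word hT mle) (mfun_word hT mlk)) _.
  apply: neq => [||x /window_eq2 h]; [exact: (mfun_word hT)|exact: (mfun_word hT)|].
  apply/ffunP => i; rewrite !ffunE; apply/ffunP => a; rewrite !ffunE.
  rewrite -!(Tz_nat T Tinv); apply: h; last exact: leq_trans (ltn_ord a) kc.
  by apply: leq_trans kN; rewrite absz_nat; exact: ltnW (ltn_ord i).
have ET : pr (word N (letter (e_ k) c) @^-1` [set w]) = \prod_i pmf P (letter (e_ k) c) (w i).
  have := ik N w setT; rewrite setTI pr_setT mul1r; apply; split=> //.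
  by right; exact: pr_setT.
rewrite ET in sE; set p1 := \prod_i pmf P (letter (e_ k) c) (w i) in sE.
rewrite -(subrKA p1); apply: le_trans (ler_normD _ _) _.
have pmf01 (J : finType) (f : X -> J) v : mfun f -> 0 <= pmf P f v <= 1.
  by move=> mf; rewrite pr_ge0 pr_le1.
apply: (@le_trans _ _ (2 * 2^-1 ^+ k + N%:R * (2 * 2^-1 ^+ k))).
  apply: lerD => //; rewrite distrC; apply: le_trans (prod_lipschitz _ _) _.
  - by move=> i; exact: pmf01.
  - by move=> i; exact: pmf01.
  apply: (@le_trans _ _ (\sum_(i < N) 2 * 2^-1 ^+ k)); first by apply: ler_sum => i _; exact: pE.
  by rewrite sumr_const card_ord -[leLHS]mulr_natl.
rewrite -[X in X + _]mul1r -mulrDl nat1r.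
by rewrite mulrC -ler_pdivlMr.
Qed.

Lemma lim_gen k Z : wcyl T Tinv (e_ k) (w_ k) Z ->
  exists Z', wcyls T Tinv lim_bits Z' /\ dist P Z Z' <= 2 * 2^-1 ^+ k.
Proof.
move=> wZ; pose W e := window e (w_ k) (w_ k).
pose q v := `[<exists2 y, Z y & W (e_ k) y = v>].
have qZ x : Z x <-> q (W (e_ k) x).
  split=> [Zx|/asboolP[y Zy /(windowP hT) yx]]; first by apply/asboolP; exists x.
  exact: wZ yx Zy.
have ml := mbits_lim.
exists [set x | q (W lim_bits x)]; split.
  by exists (w_ k) => x y /(windowP hT); rewrite /W /= => ->.
have mW' : mfun (W lim_bits) by exact: (mfun_window hT).
have mW : mfun (W (e_ k)) by exact: (mfun_window hT).
have ZE : Z = [set x | q (W (e_ k) x)] by apply/seteqP; split=> x; have := qZ x; tauto.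
have [mq' _] := pr_fin P q mW'; have [mq _] := pr_fin P q mW.
apply: le_trans (lim_close k); apply: pr_le.
- by rewrite ZE; exact: measurableY.
- exact: measurable_window_neq.
move=> x h; apply/eqP => e; have {}e : W lim_bits x = W (e_ k) x := e.
by move: h; rewrite ZE => -[[h1 h2]|[h1 h2]]; apply: h2; [rewrite /mkset e|rewrite /mkset -e].
Qed.

End Seq.
End Limit.

(** * Iteration over a dense sequence of sets *)

Section Iterate.
Context (R : realType) (d : measure_display) (X : measurableType d)
        (P : probability X R) (T Tinv : X -> X).
Hypothesis hT : invertible_mp P T Tinv.
Local Notation pr := (pr P).
Local Notation mfun f := (fmeas measurable f).
Local Notation iid_over := (iid_over P T).
Local Notation cfactor := (cfactor P T Tinv).
Local Notation triv := (triv P).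
Local Notation window := (window T Tinv).
Local Notation wcyl := (wcyl T Tinv).
Local Notation wcyls := (wcyls T Tinv).
Local Notation cyl := (cyl T Tinv).

Variables (G : nat -> set (set X)) (xi : nat -> nat -> X -> bool).
Hypotheses (cG : forall m, cfactor (G m)) (Gdec : forall m, G m.+1 `<=` G m)
  (G0 : (@measurable d X) `<=` G 0)
  (ixi : forall m c, iid_over (G m.+1) (letter (xi m) c))
  (gxi : forall m, G m `<=` near P (cyl (xi m) (G m.+1)))
  (Gxi : forall m a, G m [set x | xi m a x]).
Variable D : nat -> set (set X).
Hypotheses (cD : forall M, cfactor (D M)) (indD : forall M, indep P (D M) (G M))
  (Dgen : forall (K : finType) (f : X -> K) (eps : R), mfun f -> 0 < eps ->
    exists M0 (g : X -> K), pr [set x | f x != g x] < eps /\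
      forall M, (M0 <= M)%N -> fmeas (D M) g).
Local Notation generating := (generating P T Tinv G xi).

(* Kolmogorov's zero-one law: [G M] is then independent of every [D M']. *)
Lemma tail_trivial M :
  (forall m i, (M <= m)%N -> triv [set x | xi m i x]) -> G M `<=` triv.
Proof.
move=> tr.
(* Trivial bits add nothing to [G m.+1], so the filtration is constant from [M] on. *)
have GM m : (M <= m)%N -> G M `<=` G m.
  move=> /subnK <-; elim: (m - M)%N => [|k IHk] //; apply: subset_trans IHk _.
  rewrite addSn => A hA; have Mk : (M <= k + M)%N by rewrite leq_addl.
  have tr_sub : triv `<=` G (k + M).+1 by exact: (triv_sub (cG _)).
  apply: (cyl_near_min hT (cG (k + M).+1) (cG (k + M).+1) _ _ (gxi hA)) => // a.
  by apply: tr_sub; exact: tr.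
move=> A GA; have mA : measurable A by have Gm := cfactor_meas (cG M); exact: Gm.
split=> //; suff /eqP : pr A - pr A * pr A = 0.
  by rewrite -{1}[pr A]mulr1 -mulrBr mulf_eq0 subr_eq0 => /orP[/eqP ->|/eqP <-]; [left|right].
apply/eqP; rewrite -normr_le0; apply/ler_addgt0Pr => eps eps0; rewrite add0r.
have e2 : 0 < eps / 2 by rewrite divr_gt0.
have [M0 [g [fg Dg]]] := Dgen (fmeas_bool (measurable_alg X) mA) e2.
pose M' := maxn M M0; pose B := [set x | g x].
have DB : D M' B.
  exact: (alg_fin id (cfactor_alg (cD M')) (Dg M' (leq_maxr _ _))).
have mB : measurable B by have Dm := cfactor_meas (cD M'); exact: Dm.
have := indep_dist mA mA mB mA (indD DB (GM M' (leq_maxl _ _) _ GA)).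
rewrite setIid distxx addr0 => h; apply: le_trans h _.
suff -> : dist P A B = pr [set x | `[<A x>] != g x].
  by rewrite mulrC -ler_pdivlMr // ltW.
congr pr; apply/seteqP; split=> x; rewrite /setY /mkset.
  move=> [[Ax Bx]|[Bx Ax]]; first by rewrite asboolT //; apply/eqP => e; apply: Bx;
    rewrite /B /= -e.
  by rewrite asboolF //; apply/eqP => e; move: Bx; rewrite /B /= -e.
case: (pselect (A x)) => Ax; [rewrite asboolT //|rewrite asboolF //] => /eqP gx; [left|right].
  by split=> // Bx; apply: gx; rewrite Bx.
by split=> //; rewrite /B /=; case: (g x) gx.
Qed.

Variable f : X -> R.
Hypotheses (mf : measurable_fun setT f) (gf : (@measurable d X) `<=` near P (sigma_rv f)).

Lemma bits_of_trivial M : G M `<=` triv ->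
  exists e, [/\ mbits e, forall c, iid_over triv (letter e c) & (@measurable d X) `<=` near P
    (wcyls e)].
Proof.
move=> GT; have iv : generating M (initial_bits xi) := generating_le hT cG Gdec ixi gxi Gxi (leq0n
  M) (generating_initial hT cG G0 Gxi).
have [me _ ie ge] := iv; exists (mask M (initial_bits xi)); have mm := mbits_mask M me;
  split=> // [c|].
  exact: (iid_over_sub (triv_sub (cG M)) (@ie c)).
have cW := wcyls_cfactor hT mm.
apply: subset_trans ge _; apply: (cyl_near_min hT (cG M) cW) => [|a].
  by apply: subset_trans GT _; exact: (triv_sub cW).
exact: wcyls_bit_in.
Qed.

Hypothesis rich : forall M, exists m i, [/\ (M <= m)%N, 0 < pr [set x | xi m i x] &
    pr [set x | xi m i x] < 1].

Local Notation state := (nat * (nat -> X -> bool) * nat)%type.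

(** The 2-adic valuation of [k.+1] takes every value infinitely often, so each bit of [f] is
    approximated with errors tending to 0. *)
Definition target k := [set x | rv_bits f (logn 2 k.+1) x].

Definition good_step k (s s' : state) := [/\ (s.1.1 < s'.1.1)%N, generating s'.1.1 s'.1.2,
  (s.2 < s'.2)%N,
  pr [set x | window s'.1.2 s.2 s.2 x != window s.1.2 s.2 s.2 x] <= 2^-1 ^+ k &
  exists2 Z, wcyl s'.1.2 s'.2 Z & dist P (target k) Z < 2^-1 ^+ k].

Lemma next_state : exists nxt : nat * state -> state,
  forall ks, generating ks.2.1.1 ks.2.1.2 -> good_step ks.1 ks.2 (nxt ks).
Proof.
have [|nxt h] := @choice _ _ (fun (ks : nat * state) (s' : state) =>
  generating ks.2.1.1 ks.2.1.2 -> good_step ks.1 ks.2 s'); last by exists nxt.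
move=> -[k [[M e] w]].
case: (pselect (generating M e)) => [iv|niv]; last by exists (M, e, w).
(* [c] counts the pairs of a time and a bit in the window; the successor avoids dividing by 0 when
   [w = 0]. *)
pose c := ((2 * w).+1 * w)%N; pose eps : R := 2^-1 ^+ k / c.+1%:R.
have hk : 0 < 2^-1 ^+ k :> R by rewrite exprn_gt0 // invr_gt0.
have eps0 : 0 < eps by rewrite divr_gt0.
have mt : measurable (target k) by exact: mbits_rv.
have [M' [e' [MM iv' close [Z [[w1 wZ] tZ]]]]] :=
  recode_generator hT cG Gdec ixi gxi Gxi cD indD Dgen rich w iv mt eps0.
have cle : eps * c.+1%:R = 2^-1 ^+ k by rewrite /eps divfK // pnatr_eq0.
exists (M', e', maxn w1 w.+1) => _; split=> //=; first by rewrite leq_max ltnSn orbT.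
  have [me _ _ _] := iv; have [me' _ _ _] := iv'.
  apply: le_trans (window_neq_le hT me' me (fun a aw => ltW (close a aw))) _.
  by rewrite -cle mulrC ler_pM2l // ler_nat.
exists Z; first by apply: wcyl_le wZ; exact: leq_maxl.
apply: lt_le_trans tZ _; rewrite -cle; apply: ler_peMr; [exact: ltW|by rewrite (ler_nat R 1)].
Qed.

Lemma bits_of_rich :
  exists e, [/\ mbits e, forall c, iid_over triv (letter e c) & (@measurable d X) `<=` near P
    (wcyls e)].
Proof.
have [nxt hn] := next_state.
pose s_ := fix s_ k : state := if k is k'.+1 then nxt (k', s_ k') else (0%N, initial_bits xi, 0%N).
have iv k : generating (s_ k).1.1 (s_ k).1.2.
  by elim: k => [|k IHk]; [exact: (generating_initial hT cG G0 Gxi)|have [] := hn (k, s_ k) IHk].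
have gd k : good_step k (s_ k) (s_ k.+1) by exact: (hn (k, s_ k) (iv k)).
pose e_ k := (s_ k).1.2; pose w_ k := (s_ k).2.
have me k : mbits (e_ k) by have [] := iv k.
have wS k : (w_ k < w_ k.+1)%N by have [] := gd k.
have close k : pr [set x | window (e_ k.+1) (w_ k) (w_ k) x != window (e_ k) (w_ k) (w_ k) x] <=
    2^-1 ^+ k by have [] := gd k.
have Mk k : (k <= (s_ k).1.1)%N.
  by elim: k => // k IHk; have [h _ _ _ _] := gd k; exact: leq_ltn_trans IHk h.
have iide c : exists K, forall k, (K <= k)%N -> iid_over triv (letter (e_ k) c).
  (* From this step on, the first [c] bits have a level below the stage and escape the mask. *)
  exists (\max_(a < c) (bit_level a).+1)%N => k hk.
  have [_ _ ie _] := iv k; have -> : letter (e_ k) c = letter (mask (s_ k).1.1 (e_ k)) c.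
    apply/funext => x; rewrite mask_letter // => a ac; apply: leq_trans (Mk k).
    apply: leq_trans hk; exact: (leq_bigmax (Ordinal ac)).
  exact: (iid_over_sub (triv_sub (cG _)) (@ie c)).
have ml := mbits_lim me.
exists (lim_bits e_); split=> // [c|]; first exact: (lim_iid hT me wS close iide).
have [sW nW _ _] := wcyls_cfactor hT ml; set W := near P (wcyls _) in sW nW *.
suff fW : sigma_rv f `<=` W by apply: subset_trans gf _; apply: subset_trans nW; exact: near_mono.
apply: sigma_rv_bits => // j; have mj : measurable [set x | rv_bits f j x] by exact: mbits_rv.
split=> // eps eps0; have e2 : 0 < eps / 2 by rewrite divr_gt0.
have [K HK] := half_small e2.
(* A late step whose target is bit [j]: the valuation of [k.+1] is [j], and [k >= K]. *)
pose k := (2 ^ j * (2 * K).+1).-1.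
have kE : k.+1 = (2 ^ j * (2 * K).+1)%N by rewrite /k prednK // muln_gt0 expn_gt0.
have tE : target k = [set x | rv_bits f j x].
  rewrite /target kE lognM ?expn_gt0 // pfactorK // logn_coprime ?addn0 //.
  by rewrite coprime2n /= mul2n odd_double.
have kK : (K <= k)%N.
  have : (1 * (2 * K).+1 <= k.+1)%N by rewrite kE leq_mul2r expn_gt0 orbT.
  by rewrite mul1n; lia.
have [_ _ _ _ [Z wZ tZ]] := gd k.
have [Z' [wZ' ZZ']] := lim_gen hT me wS close wZ.
have mZ : measurable Z by have [+ _ _ _] := wcyls_alg (T := T) (Tinv := Tinv) hT (me k.+1); apply;
  exists (w_ k.+1).
have mZ' : measurable Z' by have [+ _ _ _] := wcyls_alg hT ml; apply.
exists Z'; split=> //; rewrite -tE; have mt : measurable (target k) by rewrite tE.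
apply: le_lt_trans (dist_trans P mt mZ mZ') _.
have := HK k kK; rewrite ltr_pdivlMr // => hh.
apply: le_lt_trans (lerD (ltW tZ) ZZ') _; rewrite exprS mulrA divff // mul1r.
by rewrite -mulr2n -[ltLHS]mulr_natr.
Qed.

End Iterate.

(** * Coding independent bits by a real function *)

Section CantorCode.
Context (R : realType) (X : Type).
Variable e : nat -> X -> bool.
Local Notation q := (3^-1 : R).

(** Digits 0 and 2 in base 3: the gap left by the missing digit makes each bit a threshold condition
    on the code, and two codes with different bits never coincide. *)
Definition code_sum n x : R := \sum_(a < n) (e a x)%:R * (2 * q ^+ a.+1).
Definition code x : R := sup (range (code_sum^~ x)).

Lemma code_sumS n x : code_sum n.+1 x = code_sum n x + (e n x)%:R * (2 * q ^+ n.+1).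
Proof. by rewrite /code_sum big_ord_recr. Qed.

Lemma q_gt0 n : 0 < q ^+ n.
Proof. by rewrite exprn_gt0 // invr_gt0. Qed.

Lemma code_sum_le n m x : (n <= m)%N ->
  code_sum n x <= code_sum m x /\ code_sum m x + q ^+ m <= code_sum n x + q ^+ n.
Proof.
move=> /subnK <-; elim: (m - n)%N => [|k [IH1 IH2]] //; rewrite addSn code_sumS.
have h := q_gt0 (k + n).+1; have -> : q ^+ (k + n).+1 = q ^+ (k + n) / 3 by rewrite exprSr.
rewrite exprSr in h; case: (e _ x); rewrite ?mul1r ?mul0r; split; lra.
Qed.

Lemma code_bounds n x : code_sum n x <= code x <= code_sum n x + q ^+ n.
Proof.
have ub m : code_sum m x <= code_sum n x + q ^+ n.
  case: (leqP n m) => [nm|/ltnW mn].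
    have [_ h] := code_sum_le x nm; have := q_gt0 m; lra.
  have [h _] := code_sum_le x mn; have := q_gt0 n; lra.
have hs : has_sup (range (code_sum^~ x)).
  split; first by exists (code_sum 0 x); exists 0%N.
  by exists (code_sum n x + q ^+ n) => _ [m _ <-].
apply/andP; split; first by apply: sup_upper_bound => //; exists n.
by apply: ge_sup => [|_ [m _ <-]] //; case: hs.
Qed.

Lemma code_bit n x : e n x = (code_sum n x + 2 * q ^+ n.+1 <= code x).
Proof.
have /andP[h1 h2] := code_bounds n.+1 x; move: h1 h2; rewrite code_sumS.
have h := q_gt0 n.+1; case: (e n x); rewrite ?mul1r ?mul0r => h1 h2; first by rewrite h1.
by apply/esym/negbTE; rewrite -ltNge; lra.
Qed.

Lemma code_lt r x : code x < r <-> exists n, code_sum n x + q ^+ n < r.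
Proof.
split=> [cr|[n]]; last by apply: le_lt_trans; have /andP[] := code_bounds n x.
have rc : 0 < r - code x by lra.
have [K HK] := half_small rc; exists K; have /andP[h _] := code_bounds K x.
have h2 : q ^+ K <= 2^-1 ^+ K.
  by apply: lerXn2r; rewrite ?nnegrE ?invr_ge0 // lef_pV2 ?posrE // ler_nat.
have := HK K (leqnn K); lra.
Qed.

End CantorCode.

(** * From i.i.d. generating bits to a Bernoulli system *)

Section Bernoulli.
Context (R : realType) (d : measure_display) (X : measurableType d)
        (P : probability X R) (T Tinv : X -> X).
Hypothesis hT : invertible_mp P T Tinv.
Local Notation pr := (pr P).
Local Notation mfun f := (fmeas measurable f).
Local Notation Tz := (iterz T Tinv).
Local Notation word := (word T).
Local Notation iid_over := (iid_over P T).
Local Notation code e := (code R e).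

Lemma code_sum_letter (e : nat -> X -> bool) n x y : letter e n x = letter e n y ->
  code_sum R e n x = code_sum R e n y.
Proof.
move=> /letter_eq h; apply: eq_bigr => a _; by rewrite h.
Qed.

Lemma sigma_code_sub (e : nat -> X -> bool) B : sub_sigma B -> (forall a, B [set x | e a x]) ->
  sigma_rv (code e) `<=` B.
Proof.
move=> sB Be; have Ba := sub_sigma_alg sB; have [_ [_ _ BU]] := sB.
apply: sigma_rv_bits => // a; rewrite /rv_bits; set r := ratr _.
have -> : [set x | code e x < r] = \bigcup_n [set x | code_sum R e n x + 3^-1 ^+ n < r].
  apply/seteqP; split=> x /=; first by move/code_lt => [n hn]; exists n.
  by move=> [n _ hn]; apply/code_lt; exists n.
apply: BU => n; apply: (fmeas_determined (f := letter e n)) => //; first exact: fmeas_letter.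
by move=> x y /code_sum_letter; rewrite /mkset => ->.
Qed.

Lemma sub_sigma_measurable : sub_sigma (@measurable d X).
Proof. by split=> //; exact: sigma_algebra_measurable. Qed.

Lemma measurable_code (e : nat -> X -> bool) : mbits e -> measurable_fun setT (code e).
Proof.
move=> me _ Y mY; rewrite setTI; apply: (sigma_code_sub sub_sigma_measurable me).
by apply: sub_sigma_algebra; exists Y.
Qed.

Lemma sub_sigma_rv (f : X -> R) : measurable_fun setT f -> sub_sigma (sigma_rv f).
Proof.
move=> mf; apply: gen_sub_sigma => _ [Y mY <-]; have := mf measurableT _ mY.
by rewrite setTI.
Qed.

Lemma bit_sigma_code (e : nat -> X -> bool) a : mbits e -> sigma_rv (code e) [set x | e a x].
Proof.
move=> me; have Ba := sub_sigma_alg (sub_sigma_rv (measurable_code me)).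
elim/ltn_ind: a => a IHa.
have Bl : fmeas (sigma_rv (code e)) (letter e a).
  apply: fmeas_ffun => // i; apply: fmeas_bit => //; exact: IHa.
(* [s w] is the threshold of [code_bit] for bit [a] when the earlier bits are [w]; comparing the
   code with all these thresholds keeps the data finite. *)
pose s (w : {ffun 'I_a -> bool}) : R := \sum_i (w i)%:R * (2 * 3^-1 ^+ i.+1) + 2 * 3^-1 ^+ a.+1.
have Bs : fmeas (sigma_rv (code e)) (fun x => [ffun w => s w <= code e x]).
  apply: fmeas_ffun => // w; have Bw : sigma_rv (code e) [set x | s w <= code e x].
    apply: sub_sigma_algebra; exists `[s w, +oo[%classic => //.
    by apply/seteqP; split=> x /=; rewrite in_itv /= andbT.
  by have := fmeas_bool Ba Bw; congr (fmeas _ _); apply/funext => x; apply/asboolP/idP.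
apply: (fmeas_determined Ba (fmeas_pair Ba Bl Bs)) => x y [hl /ffunP/(_ (letter e a x)) hs].
rewrite !ffunE in hs.
have sE z : letter e a z = letter e a x -> s (letter e a x) = code_sum R e a z + 2 * 3^-1 ^+ a.+1.
  by move=> <-; congr (_ + _); apply: eq_bigr => i _; rewrite ffunE.
by rewrite /mkset !(code_bit R) -(sE x erefl) -(sE y (esym hl)) hs.
Qed.

Section Iid.
Variable e : nat -> X -> bool.
Hypotheses (me : mbits e) (ie : forall c, iid_over (triv P) (letter e c))
  (ge : (@measurable d X) `<=` near P (wcyls T Tinv e)).

Definition instant (z : int) : set (set X) := [set A | exists c, forall x y,
  letter e c (Tz z x) = letter e c (Tz z y) -> A x -> A y].

Definition future (z : int) : set (set X) := [set A | exists c M, forall x y,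
  word M (letter e c) (Tz z x) = word M (letter e c) (Tz z y) -> A x -> A y].

Lemma letter_le c c' x y : (c <= c')%N -> letter e c' x = letter e c' y ->
  letter e c x = letter e c y.
Proof. by move=> cc /letter_eq h; apply/letter_eq => a ac; apply: h; exact: leq_trans cc. Qed.

Lemma future_alg z : is_alg (future z).
Proof.
split.
- move=> A [c [M h]]; apply: (fmeas_determined (measurable_alg X) _ h).
  exact: (mfun_Tz hT z (mfun_word hT (mfun_letter me))).
- by exists 0%N, 0%N.
- by move=> A [c [M h]]; exists c, M => x y xy nA Ay; apply: nA; apply: h Ay.
move=> A B [c [M h]] [c' [M' h']]; exists (maxn c c'), (maxn M M') => x y /word_eq xy.
case=> [Ax|Bx]; [left; apply: h Ax|right; apply: h' Bx]; apply/word_eq => i iM.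
  by apply: letter_le (xy i _); rewrite ?leq_maxl // leq_max iM.
by apply: letter_le (xy i _); rewrite ?leq_maxr // leq_max iM orbT.
Qed.

Lemma instant_alg z : is_alg (instant z).
Proof.
split.
- move=> A [c h]; apply: (fmeas_determined (measurable_alg X) _ h).
  exact: (mfun_Tz hT z (mfun_letter me)).
- by exists 0%N.
- by move=> A [c h]; exists c => x y xy nA Ay; apply: nA; apply: h Ay.
move=> A B [c h] [c' h']; exists (maxn c c') => x y xy.
case=> [Ax|Bx]; [left; apply: h Ax|right; apply: h' Bx].
  by apply: letter_le xy; exact: leq_maxl.
by apply: letter_le xy; exact: leq_maxr.
Qed.

Lemma instant_future z y : z <= y -> instant y `<=` future z.
Proof.
move=> zy A [c h]; exists c, (absz (y - z)%R).+1 => u v /word_eq uv; apply: h.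
have := uv (absz (y - z)%R) (leqnn _); rewrite -!(Tz_nat T Tinv) -!(TzD hT).
by have -> : (absz (y - z)%R)%:Z + z = y by lia.
Qed.

Lemma instant_indep z : indep P (instant z) (future (z + 1)).
Proof.
move=> A B [c h] [c' [M h']]; pose m := maxn c c'.
pose f := word 1 (letter e m); pose g := word M (letter e m) \o Tz 1%:Z.
have ml : mfun (letter e m) := mfun_letter me.
have mf : mfun f := mfun_word hT ml.
have mg : mfun g := mfun_Tz hT 1%:Z (mfun_word hT ml).
pose p v := `[<exists2 x, A x & f (Tz z x) = v>]; pose q v := `[<exists2 x, B x & g (Tz z x) = v>].
have EA : A = [set x | p ((f \o Tz z) x)].
  apply/seteqP; split=> x; rewrite /mkset; first by move=> Ax; apply/asboolP; exists x.
  move=> /asboolP[y Ay /word_eq/(_ 0%N isT) yx]; apply: h Ay.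
  by apply: letter_le yx; exact: leq_maxl.
have EB : B = [set x | q ((g \o Tz z) x)].
  apply/seteqP; split=> x; rewrite /mkset; first by move=> Bx; apply/asboolP; exists x.
  move=> /asboolP[y By /word_eq yx]; apply: h' By; apply/word_eq => i iM.
  have := yx i iM; rewrite addrC !(TzD hT) => yx'.
  by apply: letter_le yx'; exact: leq_maxr.
rewrite EA EB; apply: pmf_indep_sets => [||u v]; [exact: (mfun_Tz hT)|exact: (mfun_Tz hT)|].
have mfg := mfun_pair mf mg.
rewrite -[LHS]/(pmf P ((fun x => (f x, g x)) \o Tz z) (u, v)).
rewrite (pmf_Tz hT z (u, v) mfg) (pmf_Tz hT z u mf) (pmf_Tz hT z v mg).
exact: (iid_word_split hT (triv_cfactor hT) ml (@ie m)).
Qed.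

(** In increasing order of times, the earliest event is independent of all the others, which lie in
    the closure of a single [future]. *)
Lemma pr_instant (s : seq int) (A : int -> set X) : sorted <%R s ->
  (forall z, z \in s -> near P (instant z) (A z)) ->
  pr [set x | forall z, z \in s -> A z x] = \prod_(z <- s) pr (A z).
Proof.
elim: s => [|z s IHs] ss nA.
  by rewrite big_nil -(pr_setT P); congr pr; apply/seteqP; split.
have nAs y : y \in s -> near P (instant y) (A y) by move=> ys; apply: nA; rewrite in_cons ys orbT.
rewrite big_cons -IHs //; last exact: path_sorted ss.
have -> : [set x | forall y, y \in z :: s -> A y x] = A z `&` [set x | forall y, y \in s -> A y x].
  apply/seteqP; split=> x; rewrite /mkset.
    by move=> h; split=> [|y ys]; apply: h; rewrite in_cons ?eqxx // ys orbT.
  by move=> [Az h] y; rewrite in_cons => /orP[/eqP ->|/h].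
apply: (indep_near (@instant_indep z)); first by apply: nA; exact: mem_head.
apply: alg_bigI => [|y ys]; first exact/near_alg/future_alg.
have zy : z + 1 <= y by rewrite lezD1; exact: (allP (order_path_min lt_trans ss)).
by apply: near_mono (nAs y ys); exact: instant_future.
Qed.

Lemma proc_code n : proc T Tinv (code e) n = code (fun a => e a \o Tz n).
Proof. by []. Qed.

Lemma sigma_proc_code n : sigma_rv (proc T Tinv (code e) n) `<=` near P (instant n).
Proof.
rewrite proc_code; apply: sigma_code_sub => [|a]; first exact/near_sigma/instant_alg.
apply: near_sub; first by case: (instant_alg n).
by exists a.+1 => x y /letter_eq/(_ a (leqnn _)) /= ->.
Qed.

Lemma mindep_code : mindep P (fun n : int => sigma_rv (proc T Tinv (code e) n)).
Proof.
move=> s A us sA.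
have nA z : z \in s -> near P (instant z) (A z) by move=> zs; apply: sigma_proc_code; exact: sA.
have mA z : z \in s -> measurable (A z) by move=> /nA [].
rewrite big_setI_seq (prod_prE P mA) -(perm_big _ (permEl (perm_sort <=%R s))) /=.
rewrite -pr_instant => [||z]; last by rewrite mem_sort; exact: nA.
  rewrite prE.
    by congr (pr _)%:E; apply/seteqP; split=> x h z; have := h z; rewrite mem_sort.
  exact: (alg_bigI (measurable_alg X)).
by rewrite lt_sorted_uniq_le sort_uniq us /= sort_le_sorted.
Qed.

Lemma bernoulli_of_bits : bernoulli_sys P T Tinv.
Proof.
have mc := measurable_code me; exists (code e); split.
  split=> //; first exact: mindep_code.
  move=> n B mB; have mB' : measurable (code e @^-1` B) by rewrite -[_ @^-1` _]setTI; exact: mc.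
  by rewrite !prE //; [congr EFin; exact: (pr_preTz hT n mB')|exact: (measurable_preTz hT n mB')].
have sP : sub_sigma (sigma_proc T Tinv (code e)).
  apply: gen_sub_sigma => A [n _ /sigma_proc_code]; exact: near_meas.
have Pa := sub_sigma_alg sP.
have bP z a : sigma_proc T Tinv (code e) [set x | e a (Tz z x)].
  apply: sub_sigma_algebra; exists z => //; rewrite proc_code.
  have me' : mbits (fun a => e a \o Tz z) by move=> b; exact: (measurable_preTz hT z (me b)).
  exact: (bit_sigma_code a me').
split=> [A mA|A PA]; last first.
  exists A; split; first by case: sP => Pm _; exact: Pm.
  by rewrite setDv setU0 measure0.
have wP : wcyls T Tinv e `<=` sigma_proc T Tinv (code e).
  move=> Z [w h]; apply: (fmeas_determined (f := window T Tinv e w w)) => //; last first.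
    by move=> x y /(windowP hT); exact: h.
  apply: fmeas_ffun => // i; apply: fmeas_ffun => // a.
  have := fmeas_bool Pa (bP (i%:Z - w%:Z) a); congr (fmeas _ _); apply/funext => x.
  by rewrite -(Tz_nat T Tinv) -(TzD hT); apply/asboolP/idP.
have [A' [PA' AA']] := near_complete sP (near_mono wP (ge mA)).
by exists A'.
Qed.

End Iid.
End Bernoulli.

(** * Filtrations of product type *)

Section ProductType.
Context (R : realType) (d : measure_display) (X : measurableType d)
        (P : probability X R) (T Tinv : X -> X).
Hypothesis hT : invertible_mp P T Tinv.
Local Notation pr := (pr P).
Local Notation cfactor := (cfactor P T Tinv).

Lemma prodalg_cfactor (C : nat -> set (set X)) J : (forall j, Defs.factor P T (C j)) ->
  cfactor (near P (prodalg C J)).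
Proof.
move=> fC; have sC j : sub_sigma (C j) by case: (fC j).
have Ca j : is_alg (C j) := sub_sigma_alg (sC j).
have pa := prodalg_alg Ca J; have na := near_alg P pa.
have nC j : cfactor (near P (C j)) := factor_cfactor hT (fC j).
have inv (S : X -> X) : (forall j A, near P (C j) A -> near P (C j) (S @^-1` A)) ->
    forall A, prodalg C J A -> near P (prodalg C J) (S @^-1` A).
  move=> hS A [n [K [b [Cb h]]]].
  (* [C j] is invariant only up to null sets, so [b j \o S] is measurable only for its
     completion. *)
  apply: (fmeas_determined na (f := coord J n (fun j => b j \o S))); last first.
    by move=> x y /coordP xy; exact: h.
  apply: (fmeas_coord (C := fun j => near P (C j))) => // [j Jj|j v].
  - by apply: near_mono; exact: prodalg_sub.
  - apply: (hS j (b j @^-1` [set v])); apply: near_sub; first by case: (sC j).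
    exact: (Cb j v).
apply: (near_cfactor hT) => //; apply: inv => j A nA; have [_ _ h1 h2] := nC j.
  exact: (h1 A nA).
exact: (h2 A nA).
Qed.

Lemma product_type_bernoulli (F : nat -> set (set X)) : lebesgue_space P ->
  weak_pinsker P T Tinv F -> product_type P T F -> bernoulli_sys P T Tinv.
Proof.
move=> [f [mf [gf _]]] wF [C [fC iC FC]]; have [fac sub F0 rb _] := wF.
pose G m := near P (F m); have cG m : cfactor (G m) := factor_cfactor hT (fac m).
have Fm m : F m `<=` measurable by case: (fac m) => -[].
have [xi hxi] := choice (fun m => rel_bernoulli_bits hT (fac m) (fac m.+1) (rb m)).
have Gdec m : G m.+1 `<=` G m by exact: near_factor_dec wF m.
have G0 : (@measurable d X) `<=` G 0 by exact: near_factor0 wF.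
have ixi m c : iid_over P T (G m.+1) (letter (xi m) c) by have [_ h _ _] := hxi m; exact: h.
have gxi m : G m `<=` near P (cyl T Tinv (xi m) (G m.+1)) by have [_ _ h _] := hxi m.
have Gxi m a : G m [set x | xi m a x] by have [_ _ _ h] := hxi m; exact: h.
have sC j : sub_sigma (C j) by case: (fC j).
have Ca j : is_alg (C j) := sub_sigma_alg (sC j).
have Cm j : C j `<=` measurable by case: (sC j).
have Gtail m : G m `<=` near P (prodalg C [pred j | (m <= j)%N]).
  have [FCm _] := FC m; have na := near_sigma P (prodalg_alg Ca [pred j | (m <= j)%N]).
  apply: subset_trans (@near_idem _ _ _ P _); apply: near_mono.
  apply: subset_trans (@near_idem _ _ _ P _).
  have gm : <<s \bigcup_(j in [set j | (m <= j)%N]) C j >> `<=` (@measurable d X).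
    by case: (gen_sub_sigma (G := \bigcup_(j in [set j | (m <= j)%N]) C j)) => // A [j _];
      exact: Cm.
  apply: subset_trans (subset_mod_near (@Fm m) gm FCm) _; apply: near_mono.
  apply: gen_sub => // A [j mj CA]; apply: near_sub;
    first by case: (prodalg_alg Ca [pred j | (m <= j)%N]).
  exact: (prodalg_sub Ca (j := j)).
pose D M := near P (prodalg C [pred j | (j < M)%N]).
have cD M : cfactor (D M) by exact: prodalg_cfactor.
have indD M : indep P (D M) (G M).
  move=> A B DA /Gtail GB; apply: (indep_near _ DA GB).
  by apply: prodalg_indep => // j /=; rewrite ltnNge andNb.
(* A set of [prodalg] depends on finitely many coordinates, so a finite-valued approximation is
   measurable for [D M] as soon as [M] is large. *)
have Dgen (K : finType) (g : X -> K) (eps : R) : fmeas measurable g -> 0 < eps ->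
    exists M0 (g' : X -> K), pr [set x | g x != g' x] < eps /\
      forall M, (M0 <= M)%N -> fmeas (D M) g'.
  move=> mg eps0; have ng : fmeas (near P (prodalg C predT)) g.
    move=> v; have h : near P (prodalg C [pred j | (0 <= j)%N]) (g @^-1` [set v]).
      by apply: Gtail; apply: G0; exact: mg.
    by apply: near_mono h; exact: prodalg_mono.
  have [g' [pg' gg']] := approx_fun (prodalg_alg Ca predT) eps0 ng.
  have [n hn] : {n : K -> nat & forall v M, (n v <= M)%N -> D M (g' @^-1` [set v])}.
    apply: (@choice _ _ (fun v n => forall M, (n <= M)%N -> D M (g' @^-1` [set v]))) => v;
      have [n [L [b [Cb h]]]] := pg' v; exists n => M nM.
    apply: near_sub; first by case: (prodalg_alg Ca [pred j | (j < M)%N]).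
    exists n, L, b; split=> // x y xy; apply: h => j jn _; apply: xy => //=.
    exact: leq_trans jn nM.
  exists (\max_v n v)%N, g'; split=> // M hM v; apply: hn; apply: leq_trans hM.
  exact: leq_bigmax.
have nf : (@measurable d X) `<=` near P (sigma_rv f).
  by apply: subset_mod_near => //; case: (sub_sigma_rv mf).
have [e [me ie ge]] : exists e, [/\ mbits e, forall c, iid_over P T (triv P) (letter e c) &
    (@measurable d X) `<=` near P (wcyls T Tinv e)].
  (* Markers require nontrivial bits at arbitrarily high levels. Otherwise some [G M] is trivial,
     and the initial bits of lower levels already generate. *)
  case: (pselect (forall M, exists m i, [/\ (M <= m)%N, 0 < pr [set x | xi m i x] &
      pr [set x | xi m i x] < 1])) => [rich|].
    exact: (bits_of_rich hT cG Gdec G0 ixi gxi Gxi cD indD Dgen mf nf rich).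
  move=> /existsNP[M hM]; apply: (bits_of_trivial hT cG Gdec G0 ixi gxi Gxi (M := M)).
  apply: (tail_trivial hT cG gxi cD indD Dgen) => m i Mm.
  have mx : measurable [set x | xi m i x] := cfactor_meas (cG m) (Gxi m i).
  split=> //; apply: contrapT => /not_orP[p0 p1]; apply: hM; exists m, i; split=> //.
    by rewrite lt_neqAle pr_ge0 andbT eq_sym; apply/eqP.
  by rewrite lt_neqAle pr_le1 // andbT; apply/eqP.
exact: (bernoulli_of_bits hT me ie ge).
Qed.

End ProductType.

Theorem theorem2p23 (R : realType) (d : measure_display) (X : measurableType d)
  (P : probability X R) (T Tinv : X -> X) (F : nat -> set (set X)) :
  lebesgue_space P -> invertible_mp P T Tinv -> weak_pinsker P T Tinv F ->
  (K_system P T <-> kolmogorovian P F) /\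
  (product_type P T F -> bernoulli_sys P T Tinv).
Proof.
move=> lX hT wF; split; last exact: (product_type_bernoulli hT lX wF).
by split; [exact: (K_kolmogorovian hT wF)|exact: (kolmogorovian_K hT wF)].
Qed.
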